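(* Let $K$ be a field, $c\ge0$ an integer and $\mathcal{P}=K[X_{c\times\mathbb{N}}]$. There is a finite algorithm which, given as input an integer $s\ge1$ and a finite subset $B$ of a finitely generated free $\operatorname{Sym}$-module $\mathcal{F}=\bigoplus_{i=1}^r\mathcal{F}^{\operatorname{Sym},d_i}$ over $\mathcal{P}$ (with integers $d_i\ge0$), outputs an exact sequence of finitely generated $\operatorname{Sym}$-modules over $\mathcal{P}$ $$\mathcal{F}_s\to\mathcal{F}_{s-1}\to\cdots\to\mathcal{F}_1\to\mathcal{M}\to0$$ with $\operatorname{Sym}$-equivariant differentials, where $\mathcal{M}=\langle B\rangle_{\mathcal{F}}$ is the $\operatorname{Sym}$-submodule of $\mathcal{F}$ generated by $B$ and the $\mathcal{F}_i$ are free $\operatorname{Sym}$-modules.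
   Context: $\mathbb{N}=\{1,2,\dots\}$. $\operatorname{Sym}$ is the group of bijections $\pi\colon\mathbb{N}\to\mathbb{N}$ with $\pi(i)\ne i$ for only finitely many $i$. $\mathcal{P}=K[X_{c\times\mathbb{N}}]=K[x_{i,j}\mid1\le i\le c,\ j\in\mathbb{N}]$, with $\operatorname{Sym}$ acting by $K$-algebra homomorphisms via $\tau\cdot x_{i,j}=x_{i,\tau(j)}$. A $\operatorname{Sym}$-module over $\mathcal{P}$ is a $\mathcal{P}$-module $\mathcal{M}$ with an action of $\operatorname{Sym}$ satisfying $\tau\cdot(q_1+q_2)=\tau\cdot q_1+\tau\cdot q_2$ and $\tau\cdot(aq)=(\tau\cdot a)(\tau\cdot q)$. Morphisms are the $\operatorname{Sym}$-equivariant $\mathcal{P}$-module homomorphisms. The $\operatorname{Sym}$-submodule generated by a subset is the smallest $\operatorname{Sym}$-stable $\mathcal{P}$-submodule containing it; a $\operatorname{Sym}$-module is finitely generated if it is generated in this sense by a finite subset. For $d\ge0$ let $\operatorname{Hom}_{\mathrm{FI}}(d,\mathbb{N})$ be the set of injective maps $\{1,\dots,d\}\to\mathbb{N}$. Let $\mathcal{F}^{\operatorname{Sym},d}=\bigoplus_{\pi\in\operatorname{Hom}_{\mathrm{FI}}(d,\mathbb{N})}\mathcal{P}\,\epsilon_\pi$ with action induced by $\tau\cdot(a\epsilon_\pi)=(\tau\cdot a)\epsilon_{\tau\circ\pi}$; as a $\operatorname{Sym}$-module it is generated by $\epsilon_{\widetilde{\mathrm{id}_d}}$, where $\widetilde{\mathrm{id}_d}(j)=j$.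 A free $\operatorname{Sym}$-module is one isomorphic to a direct sum of modules $\mathcal{F}^{\operatorname{Sym},d_\lambda}$. Conventions on computation: the field operations and equality tests in $K$ count as elementary steps; elements of free modules are given explicitly as finite linear combinations of basis elements with polynomial coefficients; morphisms out of free $\operatorname{Sym}$-modules are given by the images of the generators $\epsilon_{\widetilde{\mathrm{id}_{d_i}},i}$. A finite algorithm is one that terminates after finitely many steps on every input. *)

(* Defs.v *)
From HB Require Import structures.
From mathcomp Require Import all_boot all_algebra.
From mathcomp Require Import boolp.
From mathcomp Require Import finmap.
From mathcomp Require Import monalg.

Set Implicit Arguments.
Unset Strict Implicit.
Unset Printing Implicit Defensive.

Import GRing.Theory.
Local Open Scope ring_scope.

(* The index set {1, 2, ...} is replaced throughout by [nat] = {0, 1, ...},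
   and {1, ..., d} by ['I_d] = {0, ..., d - 1}. *)

Record Sym := MkSym {
  sym_fun :> nat -> nat;
  sym_bij : bijective sym_fun;
  sym_fin : exists s : seq nat, forall j, sym_fun j != j -> j \in s
}.

Lemma sym1_fin : exists s : seq nat, forall j, id j != j -> j \in s.
Proof. by exists [::] => j; rewrite eqxx. Qed.

Definition sym1 : Sym := @MkSym id (inv_bij (fun=> erefl)) sym1_fin.

Lemma symM_fin (s t : Sym) :
  exists l : seq nat, forall j, (s \o t) j != j -> j \in l.
Proof.
have [ls Hs] := sym_fin s; have [lt Ht] := sym_fin t.
exists (lt ++ ls) => j /=; rewrite mem_cat.
case: (t j =P j) => [-> /Hs -> | /eqP/Ht -> //].
by rewrite orbT.
Qed.

Definition symM (s t : Sym) : Sym :=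
  @MkSym (s \o t) (bij_comp (sym_bij s) (sym_bij t)) (symM_fin s t).

(* K[x_(i,j) | i < c, j : nat], as the monoid algebra of the free commutative
   monoid on the pairs (i, j). *)
Notation polyP K c := {malg K[{cmonom ('I_c * nat)%type}]}.

Definition varP (K : fieldType) (c : nat) (v : 'I_c * nat) : polyP K c :=
  << ucm v >>.

Lemma malgUM (M : conomType) (R : comNzRingType) (a b : R) (m n : M) :
  << a *g m >> * << b *g n >> = << a * b *g mmul m n >> :> {malg R[M]}.
Proof. by rewrite malgM_def; apply: fgmulUU. Qed.

Lemma malgUX (M : conomType) (R : comNzRingType) (m : M) n :
  << m >> ^+ n = << iter n (mmul m) mone >> :> {malg R[M]}.
Proof.
elim: n => [|n IH]; first by rewrite expr0.
by rewrite exprS IH malgUM mulr1.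
Qed.

Section PolyAction.
Context (K : fieldType) (c : nat).
Implicit Types (s t : Sym).

Definition sym_var s (v : 'I_c * nat) : 'I_c * nat := (v.1, s v.2).

Definition sym_mon s (m : {cmonom ('I_c * nat)%type}) : polyP K c :=
  \prod_(v <- finsupp m) varP K (sym_var s v) ^+ m v.

Lemma sym_monEw s (d : {fset 'I_c * nat}) (m : {cmonom ('I_c * nat)%type}) :
  (finsupp m `<=` d)%fset ->
  sym_mon s m = \prod_(v <- d) varP K (sym_var s v) ^+ m v.
Proof.
move=> le; rewrite [LHS](big_fset_incl _ le) => //= x xd.
by rewrite -cmE_eq0 => /eqP->; rewrite expr0.
Qed.

Lemma sym_mon_mmorphism s : mmorphism (sym_mon s).
Proof.
split; last by rewrite /sym_mon mdom1 big_seq_fset0.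
move=> m1 m2; rewrite (@sym_monEw s (finsupp m1 `|` finsupp m2)%fset);
  last by rewrite mdomD.
rewrite (sym_monEw s (fsubsetUl (finsupp m1) (finsupp m2))).
rewrite (sym_monEw s (fsubsetUr (finsupp m1) (finsupp m2))) -big_split /=.
by apply: eq_bigr => v _; rewrite cmM exprD.
Qed.

HB.instance Definition _ s :=
  isMultiplicative.Build _ _ (sym_mon s) (sym_mon_mmorphism s).

(* The K-algebra endomorphism x_(i,j) |-> x_(i, s j). *)
Definition actP s : polyP K c -> polyP K c := mmap (@malgC _ K) (sym_mon s).

HB.instance Definition _ s := GRing.RMorphism.on (actP s).

Lemma actPC s (a : K) : actP s a%:MP = a%:MP.
Proof. exact: mmapC. Qed.

Lemma actPZ s (a : K) p : actP s (a *: p) = a *: actP s p.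
Proof. by rewrite -!mul_malgC rmorphM /= actPC. Qed.

Lemma actPX s v : actP s (varP K v) = varP K (sym_var s v).
Proof.
rewrite /actP /varP mmapU /= mpolyC1E mul1r /sym_mon mdomU.
by rewrite big_seq_fset1 cmUU expr1.
Qed.

Lemma sym_mon1 m : sym_mon sym1 m = << m >>.
Proof.
pose pw n v : {cmonom ('I_c * nat)%type} := iter n (mmul (ucm v)) mone.
have varPX n v : varP K (sym_var sym1 v) ^+ n = << pw n v >>.
  by rewrite /varP /sym_var /= -surjective_pairing malgUX.
have pwE n v i : pw n v i = (n * (v == i))%N.
  by elim: n => [|n IH] /=; rewrite ?cm1 // cmM IH cmU mulSn.
have -> : sym_mon sym1 m = << \big[mmul/mone]_(v <- finsupp m) pw (m v) v >>.
  rewrite /sym_mon; elim/big_rec2: _ => [//|v y1 y2 _ ->].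
  by rewrite varPX malgUM (mulr1 (1 : K)).
congr (<< _ >>); apply/eqP/cmP => i.
have -> : (\big[mmul/mone]_(v <- finsupp m) pw (m v) v) i
        = (\sum_(v <- finsupp m) m v * (v == i))%N.
  elim/big_rec2: _ => [|v y1 y2 _ <-]; first by rewrite cm1.
  by rewrite cmM pwE.
case: (boolP (i \in finsupp m)) => im.
  rewrite (big_fsetD1 i) //= eqxx muln1 big1_fset ?addn0 // => v.
  by rewrite !inE => /andP[/negPf-> _] _; rewrite muln0.
rewrite big1_fset; first by apply/esym/eqP; rewrite cmE_eq0.
by move=> v vm _; case: eqP vm im => [-> ->//|]; rewrite muln0.
Qed.

Lemma actP1 p : actP sym1 p = p.
Proof.
rewrite /actP /mmap [RHS]monalgE; apply: eq_bigr => m _.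
by rewrite sym_mon1 /= malgUM mulr1 mul1m.
Qed.

Lemma actPM s t p : actP (symM s t) p = actP s (actP t p).
Proof.
rewrite {1 3}/actP /mmap rmorph_sum /=; apply: eq_bigr => m _.
rewrite rmorphM /= actPC; congr (_ * _); rewrite rmorph_prod /=.
by apply: eq_bigr => v _; rewrite rmorphXn /= actPX.
Qed.

End PolyAction.

Record symModule (K : fieldType) (c : nat) := SymModule {
  sm_car :> lmodType (polyP K c);
  sm_act : Sym -> sm_car -> sm_car;
  sm_actD : forall s, {morph sm_act s : q1 q2 / q1 + q2};
  sm_actZ : forall s a q, sm_act s (a *: q) = actP s a *: sm_act s q;
  sm_act1 : forall q, sm_act sym1 q = q;
  sm_actM : forall s t q, sm_act (symM s t) q = sm_act s (sm_act t q)
}.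

Record symHom (K : fieldType) (c : nat) (M N : symModule K c) := SymHom {
  sh_fun :> {linear M -> N};
  sh_equiv : forall s q, sh_fun (sm_act s q) = sm_act s (sh_fun q)
}.

Section Submodules.
Context (K : fieldType) (c : nat) (M : symModule K c).

Record symSubmodule (N : M -> Prop) : Prop := SymSubmodule {
  ss_0 : N 0;
  ss_D : forall x y, N x -> N y -> N (x + y);
  ss_Z : forall (a : polyP K c) x, N x -> N (a *: x);
  ss_act : forall s x, N x -> N (sm_act s x)
}.

Definition in_span (B : seq M) (x : M) : Prop :=
  forall N : M -> Prop, symSubmodule N -> (forall b, b \in B -> N b) -> N x.

Lemma in_span_submodule B : symSubmodule (in_span B).
Proof.
split=> [N NS _|x y Hx Hy N NS NB|a x Hx N NS NB|s x Hx N NS NB].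
- exact: ss_0 NS.
- by apply: (ss_D NS); [apply: Hx | apply: Hy].
- by apply: (ss_Z NS); apply: Hx.
- by apply: (ss_act NS); apply: Hx.
Qed.

Definition span_pred (B : seq M) : {pred M} := fun x => `[< in_span B x >].

Lemma span_predP B x : reflect (in_span B x) (x \in span_pred B).
Proof. exact: asboolP. Qed.

Lemma span_closed B : submod_closed (span_pred B).
Proof.
have S := in_span_submodule B; split=> [|a x y /span_predP Hx /span_predP Hy].
  by apply/span_predP; apply: ss_0 S.
by apply/span_predP; apply: (ss_D S) => //; apply: (ss_Z S).
Qed.

HB.instance Definition _ B :=
  GRing.isSubmodClosed.Build _ _ (span_pred B) (span_closed B).

Record span_type (B : seq M) : predArgType := SpanType {
  span_val : M;
  span_valP : span_val \in span_pred B
}.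

HB.instance Definition _ B := [isSub for @span_val B].
HB.instance Definition _ B := [Choice of span_type B by <:].
HB.instance Definition _ B := [SubChoice_isSubLmodule of span_type B by <:].

Lemma span_act_subproof B s (x : span_type B) :
  sm_act s (val x) \in span_pred B.
Proof.
by apply/span_predP; apply: (ss_act (in_span_submodule B)); apply/span_predP/(valP x).
Qed.

Definition span_act B s (x : span_type B) : span_type B :=
  SpanType (span_act_subproof s x).

Lemma span_actD B s : {morph @span_act B s : x y / x + y}.
Proof. by move=> x y; apply: val_inj; rewrite /= sm_actD. Qed.

Lemma span_actZ B s a (x : span_type B) :
  span_act s (a *: x) = actP s a *: span_act s x.
Proof. by apply: val_inj; rewrite /= sm_actZ. Qed.

Lemma span_act1 B (x : span_type B) : span_act sym1 x = x.
Proof. by apply: val_inj; rewrite /= sm_act1. Qed.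

Lemma span_actM B s t (x : span_type B) :
  span_act (symM s t) x = span_act s (span_act t x).
Proof. by apply: val_inj; rewrite /= sm_actM. Qed.

Definition span_module (B : seq M) : symModule K c :=
  SymModule (@span_actD B) (@span_actZ B) (@span_act1 B) (@span_actM B).

Definition finitely_generated : Prop :=
  exists B : seq M, forall x, in_span B x.

End Submodules.

Definition surjective_hom K c (M N : symModule K c) (f : symHom M N) : Prop :=
  forall y, exists x, f x = y.

Definition exact_at K c (L M N : symModule K c)
    (f : symHom L M) (g : symHom M N) : Prop :=
  forall y : M, g y = 0 <-> exists x : L, f x = y.

Notation inj_maps n := {f : {ffun 'I_n -> nat} | injectiveb f}.

(* The basis elements (i, pi) of the direct sum of the modules F^(Sym, d_i),
   i < size d; the direct sum itself is the free module {malg P[free_basis d]}.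
   The basis element e is << e >>. *)
Notation free_basis d := {i : 'I_(size d) & inj_maps (nth 0%N d i)}.

Lemma comp_inj_subproof n (s : Sym) (p : inj_maps n) :
  injectiveb [ffun j => s (val p j)].
Proof.
apply/injectiveP => j k; rewrite !ffunE => /(bij_inj (sym_bij s)).
exact: (injectiveP _ (valP p)).
Qed.

Definition comp_inj n (s : Sym) (p : inj_maps n) : inj_maps n :=
  exist (fun f : {ffun 'I_n -> nat} => injectiveb f) _ (comp_inj_subproof s p).

Lemma incl_inj_subproof n : injectiveb [ffun j : 'I_n => nat_of_ord j].
Proof. by apply/injectiveP => j k; rewrite !ffunE => /val_inj. Qed.

Definition incl_inj n : inj_maps n :=
  exist (fun f : {ffun 'I_n -> nat} => injectiveb f) _ (incl_inj_subproof n).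

Definition act_basis (d : seq nat) (s : Sym) (e : free_basis d) : free_basis d :=
  Tagged (fun i : 'I_(size d) => inj_maps (nth 0%N d i)) (comp_inj s (tagged e)).

Lemma malgZU (I : choiceType) (R : nzRingType) (a b : R) (e : I) :
  a *: << b *g e >> = << a * b *g e >> :> {malg R[I]}.
Proof. by apply/malgP => k; rewrite mcoeffZ !mcoeffU mulrnAr. Qed.

Section FreeModule.
Context (K : fieldType) (c : nat) (d : seq nat).

Local Notation F := {malg (polyP K c)[free_basis d]}.
Implicit Types (s t : Sym) (q : F).

Definition free_act s q : F :=
  \sum_(e <- msupp q) << actP s q@_e *g act_basis s e >>.

Lemma free_actEw s (D : {fset free_basis d}) q : (msupp q `<=` D)%fset ->
  free_act s q = \sum_(e <- D) << actP s q@_e *g act_basis s e >>.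
Proof.
move=> le; rewrite [LHS](big_fset_incl _ le) => //= x xd /mcoeff_outdom ->.
by rewrite raddf0 monalgU0.
Qed.

Lemma free_actD s : {morph free_act s : q1 q2 / q1 + q2}.
Proof.
move=> q1 q2; rewrite (free_actEw s (msuppD_le q1 q2)).
rewrite (free_actEw s (fsubsetUl (msupp q1) (msupp q2))).
rewrite (free_actEw s (fsubsetUr (msupp q1) (msupp q2))) -big_split /=.
by apply: eq_bigr => e _; rewrite mcoeffD raddfD monalgUD.
Qed.

Lemma free_actU s a e : free_act s << a *g e >> = << actP s a *g act_basis s e >>.
Proof. by rewrite (free_actEw s msuppU_le) big_seq_fset1 mcoeffUU. Qed.

Lemma free_act0 s : free_act s 0 = 0.
Proof. by rewrite /free_act msupp0 big_seq_fset0. Qed.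

Lemma free_act_sum s I (r : seq I) (G : I -> F) :
  free_act s (\sum_(i <- r) G i) = \sum_(i <- r) free_act s (G i).
Proof. exact: (big_morph _ (free_actD s) (free_act0 s)). Qed.

Lemma free_actZ s a q : free_act s (a *: q) = actP s a *: free_act s q.
Proof.
rewrite [in LHS](monalgE q) scaler_sumr free_act_sum [free_act s q]/free_act.
rewrite scaler_sumr; apply: eq_bigr => e _.
by rewrite !malgZU free_actU rmorphM.
Qed.

Lemma act_basis1 (e : free_basis d) : act_basis sym1 e = e.
Proof.
case: e => i p; rewrite /act_basis /=; congr (Tagged _ _).
by apply/val_inj/ffunP => j; rewrite ffunE.
Qed.

Lemma act_basisM s t (e : free_basis d) :
  act_basis (symM s t) e = act_basis s (act_basis t e).
Proof.
case: e => i p; rewrite /act_basis /=; congr (Tagged _ _).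
by apply/val_inj/ffunP => j; rewrite !ffunE.
Qed.

Lemma free_act1 q : free_act sym1 q = q.
Proof.
by rewrite [RHS]monalgE; apply: eq_bigr => e _; rewrite actP1 act_basis1.
Qed.

Lemma free_actM s t q : free_act (symM s t) q = free_act s (free_act t q).
Proof.
rewrite [in RHS]/free_act -/(free_act t q) [X in _ = free_act _ X]/free_act.
rewrite free_act_sum; apply: eq_bigr => e _.
by rewrite free_actU actPM act_basisM.
Qed.

Definition free_module : symModule K c :=
  SymModule free_actD free_actZ free_act1 free_actM.

(* the basis element (i, id~) *)
Definition free_gen (i : 'I_(size d)) : free_module :=
  << Tagged (fun i : 'I_(size d) => inj_maps (nth 0%N d i))
            (incl_inj (nth 0%N d i)) >>.

End FreeModule.

(* Explicit linear combinations are lists of terms, neither sorted nor free of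
   repetitions or zero coefficients. A monomial is the list of its variables with multiplicity. *)

Notation poly_repr K c := (seq (K * seq ('I_c * nat))).
Notation elt_repr K c d := (seq (poly_repr K c * free_basis d)).

Definition poly_of (K : fieldType) (c : nat) (p : poly_repr K c) : polyP K c :=
  \sum_(t <- p) t.1 *: \prod_(v <- t.2) varP K v.

Definition elt_of (K : fieldType) (c : nat) (d : seq nat) (q : elt_repr K c d) :
    free_module K c d :=
  \sum_(t <- q) poly_of t.1 *: (<< t.2 >> : {malg (polyP K c)[free_basis d]}).

(* The model of computation is that of WHILE programs over binary trees, whose
   leaves are empty or carry a scalar. A program does not depend on K and
   contains no scalar besides 0 and 1; it acts on scalars only through the
   field operations and the equality test. *)

Inductive data (K : Type) : Type :=
| Nil
| Scal of K
| Pair of data K & data K.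
Arguments Nil {K}.

Inductive elementary : Type :=
| OpId | OpNil | OpFst | OpSnd
| OpZero | OpOne | OpAdd | OpOpp | OpMul | OpInv | OpEq.

Inductive program : Type :=
| Op of elementary
| Fork of program & program
| Seq of program & program
| If of program & program & program
| While of program & program.

Section Semantics.
Context (K : fieldType).
Implicit Types (x y z b : data K) (p q r : program).

(* OpInv maps 0 to 0; operations applied to data of the wrong shape return
   Nil. *)
Definition run_elementary (o : elementary) x : data K :=
  match o, x with
  | OpId, _ => x
  | OpFst, Pair y _ => y
  | OpSnd, Pair _ z => z
  | OpZero, _ => Scal 0
  | OpOne, _ => Scal 1
  | OpAdd, Pair (Scal a) (Scal b) => Scal (a + b)
  | OpOpp, Scal a => Scal (- a)
  | OpMul, Pair (Scal a) (Scal b) => Scal (a * b)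
  | OpInv, Scal a => Scal a^-1
  | OpEq, Pair (Scal a) (Scal b) => if a == b then Pair Nil Nil else Nil
  | _, _ => Nil
  end.

Definition truthy x : bool := if x is Nil then false else true.

(* [eval p x y]: on input x the program p terminates, with output y. *)
Inductive eval : program -> data K -> data K -> Prop :=
| EvalOp o x : eval (Op o) x (run_elementary o x)
| EvalFork p q x y z :
    eval p x y -> eval q x z -> eval (Fork p q) x (Pair y z)
| EvalSeq p q x y z :
    eval p x y -> eval q y z -> eval (Seq p q) x z
| EvalIfTrue p q r x b y :
    eval p x b -> truthy b -> eval q x y -> eval (If p q r) x y
| EvalIfFalse p q r x b y :
    eval p x b -> ~~ truthy b -> eval r x y -> eval (If p q r) x y
| EvalWhileFalse p q x b :
    eval p x b -> ~~ truthy b -> eval (While p q) x x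
| EvalWhileTrue p q x b y z :
    eval p x b -> truthy b -> eval q x y -> eval (While p q) y z ->
    eval (While p q) x z.

Lemma eval_functional p x y z : eval p x y -> eval p x z -> y = z.
Proof.
move=> H; elim: H z => {p x y}; intros;
  match goal with H : eval _ _ ?w |- _ = ?w => inversion H; subst end;
  repeat match goal with
  | IH : forall w, eval ?p ?x w -> _ = w, E : eval ?p ?x ?w |- _ =>
      move: (IH w E) => ?; clear E; subst
  end;
  first [reflexivity | match goal with
  | H1 : is_true (truthy ?b), H2 : is_true (~~ truthy ?b) |- _ =>
      by rewrite H1 in H2
  end].
Qed.

End Semantics.

Section Encoding.
Context (K : fieldType) (c : nat).

Definition enc_list (T : Type) (enc : T -> data K) (l : seq T) : data K :=
  foldr (fun t x => Pair (enc t) x) Nil l.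

Definition enc_nat (n : nat) : data K := iter n (Pair Nil) Nil.

Definition enc_var (v : 'I_c * nat) : data K :=
  Pair (enc_nat v.1) (enc_nat v.2).

Definition enc_poly (p : poly_repr K c) : data K :=
  enc_list (fun t => Pair (Scal t.1) (enc_list enc_var t.2)) p.

Definition enc_basis (d : seq nat) (e : free_basis d) : data K :=
  Pair (enc_nat (tag e))
    (enc_list enc_nat
      [seq val (tagged e) j | j <- enum 'I_(nth 0%N d (tag e))]).

Definition enc_elt (d : seq nat) (q : elt_repr K c d) : data K :=
  enc_list (fun t => Pair (enc_poly t.1) (enc_basis t.2)) q.

Definition enc_input (s : nat) (d : seq nat) (B : seq (elt_repr K c d)) :
    data K :=
  Pair (enc_nat s) (Pair (enc_list enc_nat d) (enc_list (@enc_elt d) B)).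

(* A chain of free modules F_0 <- F_1 <- ... <- F_s is given by rk, where F_k is
   the direct sum of the F^(Sym, n), n in rk k, and by the images img k i in
   F_k of the generators of F_(k+1). *)
Definition enc_output (s : nat) (rk : nat -> seq nat)
    (img : forall k, 'I_(size (rk k.+1)) -> elt_repr K c (rk k)) : data K :=
  enc_list
    (fun k => Pair (enc_list enc_nat (rk k.+1))
       (enc_list (fun i => enc_elt (img k i)) (enum 'I_(size (rk k.+1)))))
    (iota 0 s).

End Encoding.

Definition with_head (d : seq nat) (e : nat -> seq nat) (k : nat) : seq nat :=
  if k is k'.+1 then e k' else d.

(* Main.v *)
Require Import Defs.
From HB Require Import structures.
From mathcomp Require Import all_boot all_algebra.
From mathcomp Require Import boolp finmap monalg.
From mathcomp Require Import zify.

(* Each step of the resolution is the kernel of the map F_1 -> F_0 that sends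
   the i-th generator to b_i, where the rank of that generator is the number of
   columns that b_i uses. This kernel is computed by elimination: it is the
   intersection with F_1 of the submodule of F_1 + F_0 generated by the pairs
   (generator, b_i), that is, of the graph of the map, and a Gröbner basis for
   an order in which F_0 dominates F_1 restricts to a Gröbner basis of it.

   A basis element eps_pi is encoded as the product of d marker variables, the
   k-th one in column pi(k), so that terms become finite multisets of letters
   (row, column). Replacing Sym by the strictly increasing maps of the columns,
   which preserve a monomial order, costs only the closure of the generators
   under permutations of their columns. Divisibility up to increasing maps is a
   well-quasi-order by Higman's lemma; hence the monomial order is well-founded
   and Buchberger's algorithm terminates. There are finitely many S-polynomials
   for each pair, because both leading terms can be moved to a common set of at
   most w + w' columns.

   Functions computed by WHILE programs are closed under composition, case
   distinction and recursion on lists, which covers all parts of the algorithm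
   except the main loop. *)
Set Implicit Arguments.
Unset Strict Implicit.
Unset Printing Implicit Defensive.

Import GRing.Theory.

(** * Functions computed by WHILE programs *)

(** [Sym] preserves no total order on the letters, since a transposition exchanges two of them.
    Increasing maps preserve one but need not lie in [Sym]. What connects the two is that an element
    involves only finitely many columns, on which an injective map agrees with some finitary
    permutation. The Gröbner theory needs only a vector space with a totally ordered basis and a
    monoid acting on this basis by strictly monotone maps. Therefore variables and increasing maps
    form one monoid of operators, free modules are embedded into the vector space on pairs (index,
    multiset of letters), and only the resulting kernel is translated back. A generator of rank n
    can be sent to b_i if b_i is fixed by all permutations that fix the first n columns; this is why
    its rank is the number of columns of b_i. The algorithm works on unsorted lists of terms, in
    which monomials may repeat and cancel, so all tests go through multiplicities and summed
    coefficients. The number of iterations of the main loop is not computed: its finiteness is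
    proved classically, while the loop itself is a program. *)

Class encodable (K : fieldType) (T : Type) := encode : T -> data K.

Section Encodings.
Context (K : fieldType).

#[global] Instance encodable_scal : encodable K K := @Scal K.
#[global] Instance encodable_unit : encodable K unit := fun=> Defs.Nil.
#[global] Instance encodable_bool : encodable K bool :=
  fun b => if b then Pair Defs.Nil Defs.Nil else Defs.Nil.
#[global] Instance encodable_nat : encodable K nat := enc_nat K.
#[global] Instance encodable_prod A B (eA : encodable K A) (eB : encodable K B) :
  encodable K (A * B) := fun x => Pair (encode x.1) (encode x.2).
#[global] Instance encodable_seq A (eA : encodable K A) : encodable K (seq A) :=
  enc_list encode.

(** The closure rules speak of functions [fun g => ...] of an environment [g : G]; a bound variable
    is paired with the environment. Since the rules follow the syntax of function bodies, proof
    search over them works as a compiler. *)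
Definition cbl A B (eA : encodable K A) (eB : encodable K B) (f : A -> B) : Prop :=
  exists p, forall a, eval p (encode a) (encode (f a)).

End Encodings.
Arguments cbl {K A B eA eB} f.

Create HintDb cbl.

Ltac compute_step := cbv beta; solve [typeclasses eauto with cbl typeclass_instances].

Section BasicPrograms.
Context (K : fieldType).
Context (G A B C : Type) (eG : encodable K G) (eA : encodable K A)
  (eB : encodable K B) (eC : encodable K C).

Lemma eval_op o (x y : data K) : run_elementary o x = y -> eval (Op o) x y.
Proof. by move=> <-; constructor. Qed.

Lemma cbl_id : cbl (fun g : G => g).
Proof. by exists (Op OpId) => g; apply: eval_op. Qed.

Lemma cbl_comp (f : A -> B) (a : G -> A) : cbl f -> cbl a -> cbl (fun g => f (a g)).
Proof. by move=> [p Hp] [q Hq]; exists (Seq q p) => g; econstructor. Qed.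

Lemma cbl_ext (f h : G -> A) : f =1 h -> cbl f -> cbl h.
Proof. by move=> fh [p Hp]; exists p => g; rewrite -fh. Qed.

Lemma cbl_pair (a : G -> A) (b : G -> B) :
  cbl a -> cbl b -> cbl (fun g => (a g, b g)).
Proof. by move=> [p Hp] [q Hq]; exists (Fork p q) => g; constructor. Qed.

Lemma cbl_fst (a : G -> A * B) : cbl a -> cbl (fun g => (a g).1).
Proof.
move=> [p Hp]; exists (Seq p (Op OpFst)) => g.
by econstructor; [apply: Hp | apply: eval_op].
Qed.

Lemma cbl_snd (a : G -> A * B) : cbl a -> cbl (fun g => (a g).2).
Proof.
move=> [p Hp]; exists (Seq p (Op OpSnd)) => g.
by econstructor; [apply: Hp | apply: eval_op].
Qed.

Lemma cbl_nil : cbl (fun g : G => [::] : seq A).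
Proof. by exists (Op OpNil) => g; apply: eval_op. Qed.

Lemma cbl_cons (a : G -> A) (s : G -> seq A) :
  cbl a -> cbl s -> cbl (fun g => a g :: s g).
Proof. by move=> [p Hp] [q Hq]; exists (Fork p q) => g; constructor. Qed.

Lemma cbl_const_nat (n : nat) : cbl (fun g : G => n).
Proof.
elim: n => [|n [p Hp]]; first by exists (Op OpNil) => g; apply: eval_op.
by exists (Fork (Op OpNil) p) => g; constructor=> //; apply: eval_op.
Qed.

Lemma cbl_const_bool (b : bool) : cbl (fun g : G => b).
Proof.
case: b; last by exists (Op OpNil) => g; apply: eval_op.
by exists (Fork (Op OpNil) (Op OpNil)) => g; constructor; apply: eval_op.
Qed.

Lemma cbl_S (n : G -> nat) : cbl n -> cbl (fun g => (n g).+1).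
Proof.
move=> [p Hp]; exists (Fork (Op OpNil) p) => g.
by constructor=> //; apply: eval_op.
Qed.

Lemma cbl_if (b : G -> bool) (a1 a2 : G -> A) : cbl b -> cbl a1 -> cbl a2 ->
  cbl (fun g => if b g then a1 g else a2 g).
Proof.
move=> [p Hp] [q Hq] [r Hr]; exists (If p q r) => g.
case E: (b g); move: (Hp g); rewrite E => H; first exact: EvalIfTrue H _ _.
exact: EvalIfFalse H _ _.
Qed.

Lemma cbl_negb (b : G -> bool) : cbl b -> cbl (fun g => ~~ b g).
Proof.
move=> [p Hp]; exists (If p (Op OpNil) (Fork (Op OpNil) (Op OpNil))) => g.
case: (b g) (Hp g) => H.
  by apply: EvalIfTrue H _ _ => //; apply: eval_op.
by apply: EvalIfFalse H _ _ => //; constructor; apply: eval_op.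
Qed.

Lemma cbl_nilp (s : G -> seq A) : cbl s -> cbl (fun g => nilp (s g)).
Proof.
move=> [p Hp]; have [pt Ht] := cbl_const_bool true.
have [pf Hf] := cbl_const_bool false; exists (If p pf pt) => g.
case E: (s g) (Hp g) => [|x l] H; first exact: EvalIfFalse H _ _.
exact: EvalIfTrue H _ _.
Qed.

Lemma cbl_behead (s : G -> seq A) : cbl s -> cbl (fun g => behead (s g)).
Proof.
move=> [p Hp]; exists (Seq p (Op OpSnd)) => g.
by econstructor; [apply: Hp | apply: eval_op; case: (s g)].
Qed.

Lemma cbl_pred (n : G -> nat) : cbl n -> cbl (fun g => (n g).-1).
Proof.
move=> [p Hp]; exists (Seq p (Op OpSnd)) => g.
by econstructor; [apply: Hp | apply: eval_op; case: (n g)].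
Qed.

Lemma cbl_eq0 (n : G -> nat) : cbl n -> cbl (fun g => n g == 0).
Proof.
move=> [p Hp]; have [pt Ht] := cbl_const_bool true.
have [pf Hf] := cbl_const_bool false; exists (If p pf pt) => g.
case E: (n g) (Hp g) => [|m] H; first exact: EvalIfFalse H _ _.
exact: EvalIfTrue H _ _.
Qed.

(** A number and a list of that many [tt] have the same encoding, so recursion on numbers becomes
    recursion on lists. *)
Lemma cbl_nseq (n : G -> nat) : cbl n -> cbl (fun g => nseq (n g) tt).
Proof.
have E m : encode (nseq m tt) = encode m :> data K.
  by elim: m => // m IH; exact: (congr1 (Pair Defs.Nil) IH).
by move=> [p Hp]; exists p => g; rewrite E.
Qed.

Lemma cbl_head (a : G -> A) (s : G -> seq A) :
  cbl a -> cbl s -> cbl (fun g => head (a g) (s g)).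
Proof.
move=> [p Hp] [q Hq]; exists (If q (Seq q (Op OpFst)) p) => g.
case E: (s g) (Hq g) => [|x l] H; first exact: EvalIfFalse H _ _.
by apply: EvalIfTrue H _ _ => //; econstructor; [apply: Hq | rewrite E; apply: eval_op].
Qed.

End BasicPrograms.

Section ScalarPrograms.
Context (K : fieldType) (G : Type) (eG : encodable K G).
Implicit Types a b : G -> K.

Let cbl_binop o (f : K -> K -> K) :
  (forall x y, run_elementary o (Pair (Scal x) (Scal y)) = Scal (f x y)) ->
  forall a b, cbl a -> cbl b -> cbl (fun g => f (a g) (b g)).
Proof.
move=> Ho a b [p Hp] [q Hq]; exists (Seq (Fork p q) (Op o)) => g.
by econstructor; [constructor; [apply: Hp | apply: Hq] | apply: eval_op; apply: Ho].
Qed.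

Let cbl_unop o (f : K -> K) :
  (forall x, run_elementary o (Scal x) = Scal (f x)) ->
  forall a, cbl a -> cbl (fun g => f (a g)).
Proof.
move=> Ho a [p Hp]; exists (Seq p (Op o)) => g.
by econstructor; [apply: Hp | apply: eval_op; apply: Ho].
Qed.

Lemma cbl_addr a b : cbl a -> cbl b -> cbl (fun g => a g + b g)%R.
Proof. exact: (@cbl_binop OpAdd). Qed.

Lemma cbl_mulr a b : cbl a -> cbl b -> cbl (fun g => a g * b g)%R.
Proof. exact: (@cbl_binop OpMul). Qed.

Lemma cbl_oppr a : cbl a -> cbl (fun g => - a g)%R.
Proof. exact: (@cbl_unop OpOpp). Qed.

Lemma cbl_invr a : cbl a -> cbl (fun g => (a g)^-1)%R.
Proof. exact: (@cbl_unop OpInv). Qed.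

Lemma cbl_0r : cbl (fun _ : G => 0%R : K).
Proof. by exists (Op OpZero) => g; apply: eval_op. Qed.

Lemma cbl_1r : cbl (fun _ : G => 1%R : K).
Proof. by exists (Op OpOne) => g; apply: eval_op. Qed.

Lemma cbl_eqr a b : cbl a -> cbl b -> cbl (fun g => a g == b g).
Proof.
move=> [p Hp] [q Hq]; exists (Seq (Fork p q) (Op OpEq)) => g.
by econstructor; [constructor; [apply: Hp | apply: Hq] | apply: eval_op].
Qed.

End ScalarPrograms.

(** The number of iterations only has to exist and is given from outside, so a loop can be run whose
    termination is proved by a well-founded argument. *)
Lemma eval_while (K : fieldType) A (eA : encodable K A) (b : A -> bool) (f : A -> A) : cbl b -> cbl f ->
  exists p, forall n x, (forall k, k < n -> b (iter k f x)) ->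
    ~~ b (iter n f x) -> eval p (encode x) (encode (iter n f x)).
Proof.
move=> [p Hp] [q Hq]; exists (While p q); elim=> [|n IH] x Hlt Hn.
  by apply: EvalWhileFalse (Hp x) _; move: Hn => /=; case: (b x).
have bx := Hlt 0 isT; apply: EvalWhileTrue (Hp x) _ (Hq x) _.
  by move: bx => /= ->.
rewrite iterSr; apply: IH => [k kn|]; last by rewrite -iterSr.
by rewrite -iterSr; apply: Hlt.
Qed.

Section FoldPrograms.
Context (K : fieldType).
Context (G A B C : Type) (eG : encodable K G) (eA : encodable K A)
  (eB : encodable K B) (eC : encodable K C).

Lemma cbl_foldl (f : G -> A -> B -> A) (a : G -> A) (s : G -> seq B) :
  cbl (fun x : G * A * B => f x.1.1 x.1.2 x.2) -> cbl a -> cbl s ->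
  cbl (fun g => foldl (f g) (a g) (s g)).
Proof.
move=> Hf Ha Hs.
(* Taking [head] of the mapped list avoids a default element of [B], which may be an empty type; on
   an empty list the accumulator stays. *)
pose step (x : G * A * seq B) := ((x.1.1, head x.1.2 (map (f x.1.1 x.1.2) x.2)), behead x.2).
have Hc : cbl (fun x : G * A * seq B => ~~ nilp x.2).
  by apply/cbl_negb/cbl_nilp/cbl_snd/cbl_id.
have Hst : cbl step.
  case: Hf => p Hp.
  exists (If (Op OpSnd)
    (Fork (Fork (Seq (Op OpFst) (Op OpFst))
       (Seq (Fork (Op OpFst) (Seq (Op OpSnd) (Op OpFst))) p)) (Seq (Op OpSnd) (Op OpSnd)))
    (Op OpId)) => -[[g x] [|y l]].
    by apply: EvalIfFalse; [exact: eval_op | | exact: eval_op].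
  apply: EvalIfTrue; [exact: eval_op | by [] | ].
  repeat (econstructor; rewrite ?/encode /=).
  exact: (Hp (g, x, y)).
have [w Hw] := eval_while Hc Hst.
case: Ha => pa Ha; case: Hs => ps Hs.
exists (Seq (Seq (Fork (Fork (Op OpId) pa) ps) w) (Seq (Op OpFst) (Op OpSnd))) => g.
have E n : n <= size (s g) -> iter n step ((g, a g), s g) =
    ((g, foldl (f g) (a g) (take n (s g))), drop n (s g)).
  elim: n => [|n IH] ns; first by rewrite take0 drop0.
  rewrite iterS IH 1?ltnW // /step /=; case: (s g) ns => [//|y0 l0] ns.
  by rewrite (take_nth y0) // foldl_rcons (drop_nth y0 ns) /=.
have := Hw (size (s g)) ((g, a g), s g).
rewrite E // drop_size take_size => H.
have {}H : eval w (encode (g, a g, s g)) (encode (g, foldl (f g) (a g) (s g), [::] : seq B)).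
  by apply: H => // k kn; rewrite E 1?ltnW //= /nilp size_drop subn_eq0 -ltnNge.
apply: EvalSeq (EvalSeq _ H) _.
  by apply: EvalFork (Hs g); apply: EvalFork (Ha g); apply: eval_op.
by apply: EvalSeq; apply: eval_op.
Qed.

End FoldPrograms.

#[global] Hint Resolve cbl_id cbl_fst cbl_snd | 0 : cbl.
#[global] Hint Extern 3 (cbl (fun _ => (_, _))) => apply: cbl_pair : cbl.
#[global] Hint Extern 3 (cbl (fun _ => _ :: _)) => apply: cbl_cons : cbl.
#[global] Hint Resolve cbl_nil
  cbl_const_nat cbl_const_bool cbl_S cbl_if cbl_negb cbl_nilp cbl_behead
  cbl_pred cbl_eq0 cbl_nseq cbl_head cbl_addr cbl_mulr cbl_oppr cbl_invr
  cbl_0r cbl_1r cbl_eqr cbl_foldl : cbl.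

Section ListPrograms.
Context (K : fieldType).
Context (G A B C : Type) (eG : encodable K G) (eA : encodable K A)
  (eB : encodable K B) (eC : encodable K C).

Lemma cbl_rev (s : G -> seq A) : cbl s -> cbl (fun g => rev (s g)).
Proof.
move=> Hs; apply: (@cbl_ext _ _ _ _ _ (fun g => foldl (fun l x => x :: l) [::] (s g))).
  move=> g; rewrite -[s g in LHS]revK foldl_rev.
  by elim: (rev (s g)) => //= x l ->.
by compute_step.
Qed.

End ListPrograms.
#[global] Hint Resolve cbl_rev : cbl.

Section ListPrograms2.
Context (K : fieldType).
Context (G A B C : Type) (eG : encodable K G) (eA : encodable K A)
  (eB : encodable K B) (eC : encodable K C).

Lemma cbl_foldr (f : G -> B -> A -> A) (a : G -> A) (s : G -> seq B) :
  cbl (fun x : G * B * A => f x.1.1 x.1.2 x.2) -> cbl a -> cbl s ->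
  cbl (fun g => foldr (f g) (a g) (s g)).
Proof.
move=> Hf Ha Hs.
apply: (@cbl_ext _ _ _ _ _ (fun g => foldl (fun x y => f g y x) (a g) (rev (s g)))).
  by move=> g; rewrite foldl_rev.
apply: cbl_foldl => //; last exact: cbl_rev.
by apply: (@cbl_comp _ (G * A * B) (G * B * A) _ _ _ _
  (fun x => f x.1.1 x.1.2 x.2) (fun x => ((x.1.1, x.2), x.1.2))) => //; compute_step.
Qed.

End ListPrograms2.
#[global] Hint Resolve cbl_foldr : cbl.

Section ListPrograms3.
Context (K : fieldType).
Context (G A B C : Type) (eG : encodable K G) (eA : encodable K A)
  (eB : encodable K B) (eC : encodable K C).

Lemma cbl_map (f : G -> B -> A) (s : G -> seq B) :
  cbl (fun x : G * B => f x.1 x.2) -> cbl s -> cbl (fun g => map (f g) (s g)).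
Proof.
move=> Hf Hs; apply: (@cbl_ext _ _ _ _ _ (fun g => foldr (fun y l => f g y :: l) [::] (s g))).
  by move=> g; elim: (s g) => //= x l ->.
apply: cbl_foldr => //; last by compute_step.
apply: cbl_cons; last by compute_step.
by apply: (cbl_comp (f := fun x => f x.1 x.2) (a := fun x => x.1)) => //; compute_step.
Qed.

Lemma cbl_cat (s t : G -> seq A) : cbl s -> cbl t -> cbl (fun g => s g ++ t g).
Proof.
move=> Hs Ht; apply: (@cbl_ext _ _ _ _ _ (fun g => foldr cons (t g) (s g))).
  by move=> g; elim: (s g) => //= x l ->.
by compute_step.
Qed.

Lemma cbl_filter (p : G -> A -> bool) (s : G -> seq A) :
  cbl (fun x : G * A => p x.1 x.2) -> cbl s -> cbl (fun g => filter (p g) (s g)).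
Proof.
move=> Hp Hs.
apply: (@cbl_ext _ _ _ _ _ (fun g => foldr (fun y l => if p g y then y :: l else l) [::] (s g))).
  by move=> g; elim: (s g) => //= x l ->.
apply: cbl_foldr => //; last by compute_step.
apply: cbl_if; try by compute_step.
by apply: (cbl_comp (f := fun x => p x.1 x.2) (a := fun x => x.1)) => //; compute_step.
Qed.

Lemma cbl_iter (f : G -> A -> A) (n : G -> nat) (a : G -> A) :
  cbl (fun x : G * A => f x.1 x.2) -> cbl n -> cbl a ->
  cbl (fun g => iter (n g) (f g) (a g)).
Proof.
move=> Hf Hn Ha.
apply: (@cbl_ext _ _ _ _ _ (fun g => foldr (fun _ => f g) (a g) (nseq (n g) tt))).
  by move=> g; elim: (n g) => //= m ->.
apply: cbl_foldr; try by compute_step.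
by apply: (cbl_comp (f := fun x => f x.1 x.2) (a := fun x => (x.1.1, x.2))) => //; compute_step.
Qed.

End ListPrograms3.
#[global] Hint Resolve cbl_map cbl_cat cbl_filter cbl_iter : cbl.

Section ListPrograms4.
Context (K : fieldType).
Context (G A B C : Type) (eG : encodable K G) (eA : encodable K A)
  (eB : encodable K B) (eC : encodable K C).
Implicit Types (n m : G -> nat) (b : G -> bool).

Lemma cbl_flatten (s : G -> seq (seq A)) : cbl s -> cbl (fun g => flatten (s g)).
Proof. by move=> Hs; rewrite /flatten; compute_step. Qed.

Lemma cbl_size (s : G -> seq A) : cbl s -> cbl (fun g => size (s g)).
Proof.
move=> Hs; apply: (@cbl_ext _ _ _ _ _ (fun g => foldr (fun _ k => k.+1) 0 (s g))) => //.
by compute_step.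
Qed.

Lemma cbl_andb b1 b2 : cbl b1 -> cbl b2 -> cbl (fun g => b1 g && b2 g).
Proof. by move=> H1 H2; rewrite /andb; compute_step. Qed.

Lemma cbl_orb b1 b2 : cbl b1 -> cbl b2 -> cbl (fun g => b1 g || b2 g).
Proof. by move=> H1 H2; rewrite /orb; compute_step. Qed.

Lemma cbl_addn n m : cbl n -> cbl m -> cbl (fun g => n g + m g).
Proof.
move=> Hn Hm; apply: (@cbl_ext _ _ _ _ _ (fun g => iter (n g) S (m g))).
  by move=> g; rewrite iter_succn addnC.
by compute_step.
Qed.

Lemma cbl_subn n m : cbl n -> cbl m -> cbl (fun g => n g - m g).
Proof.
move=> Hn Hm; apply: (@cbl_ext _ _ _ _ _ (fun g => iter (m g) predn (n g))).
  by move=> g; rewrite iter_predn.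
by compute_step.
Qed.

Lemma cbl_leq n m : cbl n -> cbl m -> cbl (fun g => n g <= m g).
Proof. by move=> Hn Hm; apply/cbl_eq0/cbl_subn. Qed.

End ListPrograms4.
#[global] Hint Resolve cbl_flatten cbl_size cbl_andb cbl_orb cbl_addn cbl_subn
  cbl_leq : cbl.

Section ListPrograms5.
Context (K : fieldType).
Context (G A B C : Type) (eG : encodable K G) (eA : encodable K A)
  (eB : encodable K B) (eC : encodable K C).
Implicit Types (n m : G -> nat) (b : G -> bool).

Lemma cbl_eqn n m : cbl n -> cbl m -> cbl (fun g => n g == m g).
Proof.
move=> Hn Hm; apply: (@cbl_ext _ _ _ _ _ (fun g => (n g <= m g) && (m g <= n g))).
  by move=> g; rewrite eqn_leq.
by compute_step.
Qed.

Lemma cbl_maxn n m : cbl n -> cbl m -> cbl (fun g => maxn (n g) (m g)).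
Proof. by move=> Hn Hm; rewrite /maxn; compute_step. Qed.

Lemma cbl_iota n m : cbl n -> cbl m -> cbl (fun g => iota (n g) (m g)).
Proof.
move=> Hn Hm.
apply: (@cbl_ext _ _ _ _ _ (fun g => iter (m g) (fun s => rcons s (n g + size s)) [::])).
  move=> g; elim: (m g) => // k IH; rewrite iterS IH size_iota.
  by rewrite -addn1 iotaD cats1.
apply: cbl_iter; try by compute_step.
apply: (@cbl_ext _ _ _ _ _ (fun x => x.2 ++ [:: n x.1 + size x.2])).
  by move=> x; rewrite cats1.
have Hn1 : cbl (fun x : G * seq nat => n x.1) by apply: cbl_comp => //; compute_step.
by compute_step.
Qed.

Lemma cbl_all (p : G -> A -> bool) (s : G -> seq A) :
  cbl (fun x : G * A => p x.1 x.2) -> cbl s -> cbl (fun g => all (p g) (s g)).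
Proof.
move=> Hp Hs; apply: (@cbl_ext _ _ _ _ _ (fun g => nilp (filter (fun x => ~~ p g x) (s g)))).
  by move=> g; elim: (s g) => //= x l <-; case: (p g x).
apply/cbl_nilp/cbl_filter => //; exact: cbl_negb.
Qed.

Lemma cbl_has (p : G -> A -> bool) (s : G -> seq A) :
  cbl (fun x : G * A => p x.1 x.2) -> cbl s -> cbl (fun g => has (p g) (s g)).
Proof.
move=> Hp Hs; apply: (@cbl_ext _ _ _ _ _ (fun g => ~~ nilp (filter (p g) (s g)))).
  by move=> g; rewrite /nilp size_filter -lt0n has_count.
exact/cbl_negb/cbl_nilp/cbl_filter.
Qed.

Lemma cbl_count (p : G -> A -> bool) (s : G -> seq A) :
  cbl (fun x : G * A => p x.1 x.2) -> cbl s -> cbl (fun g => count (p g) (s g)).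
Proof.
move=> Hp Hs; apply: (@cbl_ext _ _ _ _ _ (fun g => size (filter (p g) (s g)))).
  by move=> g; rewrite size_filter.
exact/cbl_size/cbl_filter.
Qed.

Lemma cbl_drop n (s : G -> seq A) :
  cbl n -> cbl s -> cbl (fun g => drop (n g) (s g)).
Proof.
move=> Hn Hs; apply: (@cbl_ext _ _ _ _ _ (fun g => iter (n g) behead (s g))).
  by move=> g; elim: (n g) => [|k IH]; rewrite ?drop0 // iterS IH -drop1 drop_drop add1n.
by compute_step.
Qed.

Lemma cbl_nth (a : G -> A) n (s : G -> seq A) :
  cbl a -> cbl n -> cbl s -> cbl (fun g => nth (a g) (s g) (n g)).
Proof.
move=> Ha Hn Hs; apply: (@cbl_ext _ _ _ _ _ (fun g => head (a g) (drop (n g) (s g)))).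
  by move=> g; rewrite -nth0 nth_drop addn0.
by apply: cbl_head => //; apply: cbl_drop.
Qed.

Lemma cbl_eq_letter (u v : G -> nat * nat) :
  cbl u -> cbl v -> cbl (fun g => u g == v g).
Proof.
move=> Hu Hv; apply: (@cbl_ext _ _ _ _ _ (fun g => ((u g).1 == (v g).1) && ((u g).2 == (v g).2))).
  by move=> g; rewrite -pair_eqE.
by apply: cbl_andb; apply: cbl_eqn; compute_step.
Qed.

End ListPrograms5.
#[global] Hint Resolve cbl_eqn cbl_maxn cbl_iota cbl_all cbl_has cbl_count
  cbl_drop cbl_nth cbl_eq_letter : cbl.

(** * The elimination algorithm *)

(* A letter is a pair (row, column): the rows below [c] are those of the
   variables, and a basis element (i, pi) is represented by the index i together
   with the marker letters (c + k, pi k). *)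
Notation letter := (nat * nat)%type.
Notation rmono := (nat * seq letter)%type.
Notation relt K := (seq (K * rmono)).

(* Columns are compared first, so that increasing maps of the columns preserve
   the order. *)
Definition letter_le (u v : letter) : bool :=
  (u.2 < v.2) || ((u.2 == v.2) && (u.1 <= v.1)).

Definition cnt (v : letter) (l : seq letter) : nat := count (fun u : letter => u == v) l.

Definition eql (l m : seq letter) : bool :=
  all (fun v => cnt v l == cnt v m) (l ++ m).

(** The greatest letter on which the multiplicities differ decides. It is sought in [m] only,
    because its multiplicity there is positive. *)
Definition ltl (l m : seq letter) : bool :=
  has (fun v => (cnt v l < cnt v m) &&
         all (fun u => letter_le u v || (cnt u l == cnt u m)) (l ++ m)) m.

Definition eqm (a b : rmono) : bool := (a.1 == b.1) && eql a.2 b.2.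

(** With the indices of F_0 above those of F_1, comparing indices first makes this an elimination
    order. *)
Definition ltm (a b : rmono) : bool :=
  (a.1 < b.1) || ((a.1 == b.1) && ltl a.2 b.2).

Definition dedup (l : seq letter) : seq letter :=
  foldr (fun x s => if has (fun y : letter => y == x) s then s else x :: s) [::] l.

(** Multiset difference cut off at zero, that is, the least common multiple of [l] and [m] divided
    by [m]. *)
Definition diffl (l m : seq letter) : seq letter :=
  flatten [seq [seq v | _ <- iota 0 (cnt v l - cnt v m)] | v <- dedup l].

Definition subl (l m : seq letter) : bool := all (fun v => cnt v l <= cnt v m) l.

Definition mapl (f : seq nat) (l : seq letter) : seq letter :=
  [seq (v.1, nth 0 f v.2) | v <- l].

Definition rtmul (m : seq letter) (f : seq nat) (a : rmono) : rmono :=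
  (a.1, m ++ mapl f a.2).

Definition wdl (l : seq letter) : nat := foldr (fun v n => maxn v.2.+1 n) 0 l.

Definition seqs (w n : nat) : seq (seq nat) :=
  iter w (fun L => flatten [seq [seq x :: l | l <- L] | x <- iota 0 n]) [:: [::]].

Definition incrb (l : seq nat) : bool :=
  all (fun i => nth 0 l i < nth 0 l i.+1) (iota 0 (size l).-1).

Definition uniqb (l : seq nat) : bool :=
  all (fun i => all (fun j => (i == j) || ~~ (nth 0 l i == nth 0 l j))
                    (iota 0 (size l))) (iota 0 (size l)).

Definition incs (w n : nat) : seq (seq nat) := [seq l <- seqs w n | incrb l].
Definition perms (w : nat) : seq (seq nat) := [seq l <- seqs w w | uniqb l].

Section Algorithm.
Context (K : fieldType).
Implicit Types (q g h x : relt K) (a b : rmono) (G Q : seq (relt K)).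

Definition coef q a : K :=
  foldr (fun t k => if eqm t.2 a then t.1 + k else k)%R 0%R q.

(** Terms may repeat or cancel, so a candidate is tested by its total coefficient. An empty result
    means that [q] represents zero; this is the zero test of the algorithm. *)
Definition leads q : seq rmono :=
  [seq t.2 | t <- [seq t <- q | ~~ (coef q t.2 == 0%R) &&
     all (fun u => (coef q u.2 == 0%R) || ~~ ltm t.2 u.2) q]].

Definition lead q : rmono := head (0, [::]) (leads q).

Definition lcoef q : K := coef q (lead q).

Definition wd q : nat := foldr (fun t n => maxn (wdl t.2.2) n) 0 q.

Definition scal (k : K) (m : seq letter) (f : seq nat) q : relt K :=
  [seq (k * t.1, rtmul m f t.2)%R | t <- q].

Definition divs g x : seq (seq nat) :=
  [seq f <- incs (wd g) (wd x) |
     ((lead g).1 == (lead x).1) && subl (mapl f (lead g).2) (lead x).2].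

Definition reducers G x : seq (relt K * seq nat) :=
  flatten [seq [seq (g, f) | f <- divs g x] | g <- G].

Definition reduce1 x g (f : seq nat) : relt K :=
  x ++ scal (- (lcoef x * (lcoef g)^-1))%R (diffl (lead x).2 (mapl f (lead g).2)) f g.

Definition spoly g h (f f' : seq nat) : relt K :=
  scal (lcoef h) (diffl (mapl f' (lead h).2) (mapl f (lead g).2)) f g ++
  scal (- lcoef g)%R (diffl (mapl f (lead g).2) (mapl f' (lead h).2)) f' h.

Definition rows_lt (c : nat) (l : seq letter) : bool := all (fun v => v.1 < c) l.

(** The cofactors must be products of variables: multiples of two basis elements meet only if these
    are equal, so the markers of the two translates have to coincide. *)
Definition overlap (c : nat) g h (f f' : seq nat) : bool :=
  ((lead g).1 == (lead h).1) &&
  (rows_lt c (diffl (mapl f' (lead h).2) (mapl f (lead g).2)) &&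
   rows_lt c (diffl (mapl f (lead g).2) (mapl f' (lead h).2))).

Definition spolys (c : nat) g h : seq (relt K) :=
  flatten [seq [seq spoly g h f f' |
    f' <- [seq f' <- incs (wd h) (wd g + wd h) | overlap c g h f f']] |
    f <- incs (wd g) (wd g + wd h)].

(** The algorithm calls it with [x] also in [G], since translates of one element under different
    increasing maps overlap as well. Both orders of a pair are listed to match [spoly_obl], which
    speaks of ordered pairs. *)
Definition all_spolys (c : nat) x G : seq (relt K) :=
  flatten [seq spolys c x g ++ spolys c g x | g <- G].

(* The state consists of the current basis and of the queue of elements that
   remain to be reduced to zero. *)
Definition buch_step (c : nat) (S : seq (relt K) * seq (relt K)) :
    seq (relt K) * seq (relt K) :=
  if nilp S.2 then S else
  if nilp (leads (head [::] S.2)) then (S.1, behead S.2) else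
  if nilp (reducers S.1 (head [::] S.2))
  then (head [::] S.2 :: S.1,
        all_spolys c (head [::] S.2) (head [::] S.2 :: S.1) ++ behead S.2)
  else (S.1, reduce1 (head [::] S.2)
               (head ([::], [::]) (reducers S.1 (head [::] S.2))).1
               (head ([::], [::]) (reducers S.1 (head [::] S.2))).2
             :: behead S.2).

End Algorithm.

(** * Programs for the operations of the elimination algorithm *)

Section AlgorithmPrograms.
Context (K : fieldType).
Context (G : Type) (eG : encodable K G).

Section Application.
Context (A1 A2 A3 A4 B : Type) (e1 : encodable K A1) (e2 : encodable K A2)
  (e3 : encodable K A3) (e4 : encodable K A4) (eB : encodable K B).

Lemma cbl_app1 (f : A1 -> B) (a1 : G -> A1) :
  cbl (fun x => f x) -> cbl a1 -> cbl (fun g => f (a1 g)).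
Proof. exact: cbl_comp. Qed.

(** The body of [f] is compiled once, in the small environment made of its arguments; callers only
    compose. *)
Lemma cbl_app2 (f : A1 -> A2 -> B) (a1 : G -> A1) (a2 : G -> A2) :
  cbl (fun x : A1 * A2 => f x.1 x.2) -> cbl a1 -> cbl a2 ->
  cbl (fun g => f (a1 g) (a2 g)).
Proof. by move=> Hf H1 H2; exact: (cbl_comp Hf (cbl_pair H1 H2)). Qed.

Lemma cbl_app3 (f : A1 -> A2 -> A3 -> B) (a1 : G -> A1) (a2 : G -> A2) (a3 : G -> A3) :
  cbl (fun x : A1 * A2 * A3 => f x.1.1 x.1.2 x.2) -> cbl a1 -> cbl a2 -> cbl a3 ->
  cbl (fun g => f (a1 g) (a2 g) (a3 g)).
Proof.
by move=> Hf H1 H2 H3; exact: (cbl_comp Hf (cbl_pair (cbl_pair H1 H2) H3)).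
Qed.

Lemma cbl_app4 (f : A1 -> A2 -> A3 -> A4 -> B)
    (a1 : G -> A1) (a2 : G -> A2) (a3 : G -> A3) (a4 : G -> A4) :
  cbl (fun x : A1 * A2 * A3 * A4 => f x.1.1.1 x.1.1.2 x.1.2 x.2) ->
  cbl a1 -> cbl a2 -> cbl a3 -> cbl a4 ->
  cbl (fun g => f (a1 g) (a2 g) (a3 g) (a4 g)).
Proof.
move=> Hf H1 H2 H3 H4.
exact: (cbl_comp Hf (cbl_pair (cbl_pair (cbl_pair H1 H2) H3) H4)).
Qed.

End Application.
End AlgorithmPrograms.

Section AlgorithmPrograms1.
Context (K : fieldType).
Context (G : Type) (eG : encodable K G).

Lemma cbl_letter_le (u v : G -> letter) :
  cbl u -> cbl v -> cbl (fun g => letter_le (u g) (v g)).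
Proof. by apply: cbl_app2; rewrite /letter_le; compute_step. Qed.

Lemma cbl_cnt (u : G -> letter) (l : G -> seq letter) :
  cbl u -> cbl l -> cbl (fun g => cnt (u g) (l g)).
Proof. by apply: cbl_app2; rewrite /cnt; compute_step. Qed.

Lemma cbl_wdl (l : G -> seq letter) : cbl l -> cbl (fun g => wdl (l g)).
Proof. by apply: cbl_app1; rewrite /wdl; compute_step. Qed.

Lemma cbl_dedup (l : G -> seq letter) : cbl l -> cbl (fun g => dedup (l g)).
Proof. by apply: cbl_app1; rewrite /dedup; compute_step. Qed.

Lemma cbl_mapl (f : G -> seq nat) (l : G -> seq letter) :
  cbl f -> cbl l -> cbl (fun g => mapl (f g) (l g)).
Proof. by apply: cbl_app2; rewrite /mapl; compute_step. Qed.

Lemma cbl_seqs (w n : G -> nat) : cbl w -> cbl n -> cbl (fun g => seqs (w g) (n g)).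
Proof. by apply: cbl_app2; rewrite /seqs; compute_step. Qed.

Lemma cbl_incrb (l : G -> seq nat) : cbl l -> cbl (fun g => incrb (l g)).
Proof. by apply: cbl_app1; rewrite /incrb; compute_step. Qed.

Lemma cbl_uniqb (l : G -> seq nat) : cbl l -> cbl (fun g => uniqb (l g)).
Proof. by apply: cbl_app1; rewrite /uniqb; compute_step. Qed.

Lemma cbl_rows_lt (c : G -> nat) (l : G -> seq letter) :
  cbl c -> cbl l -> cbl (fun g => rows_lt (c g) (l g)).
Proof. by apply: cbl_app2; rewrite /rows_lt; compute_step. Qed.

End AlgorithmPrograms1.
#[global] Hint Resolve cbl_letter_le cbl_cnt cbl_wdl cbl_dedup cbl_mapl cbl_seqs
  cbl_incrb cbl_uniqb cbl_rows_lt : cbl.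

Section AlgorithmPrograms2.
Context (K : fieldType).
Context (G : Type) (eG : encodable K G).
Implicit Types (l m : G -> seq letter).

Lemma cbl_eql l m : cbl l -> cbl m -> cbl (fun g => eql (l g) (m g)).
Proof. by apply: cbl_app2; rewrite /eql; compute_step. Qed.

Lemma cbl_ltl l m : cbl l -> cbl m -> cbl (fun g => ltl (l g) (m g)).
Proof. by apply: cbl_app2; rewrite /ltl; compute_step. Qed.

Lemma cbl_diffl l m : cbl l -> cbl m -> cbl (fun g => diffl (l g) (m g)).
Proof. by apply: cbl_app2; rewrite /diffl; compute_step. Qed.

Lemma cbl_subl l m : cbl l -> cbl m -> cbl (fun g => subl (l g) (m g)).
Proof. by apply: cbl_app2; rewrite /subl; compute_step. Qed.

Lemma cbl_incs (w n : G -> nat) : cbl w -> cbl n -> cbl (fun g => incs (w g) (n g)).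
Proof. by apply: cbl_app2; rewrite /incs; compute_step. Qed.

Lemma cbl_perms (w : G -> nat) : cbl w -> cbl (fun g => perms (w g)).
Proof. by apply: cbl_app1; rewrite /perms; compute_step. Qed.

Lemma cbl_rtmul m (f : G -> seq nat) (a : G -> rmono) :
  cbl m -> cbl f -> cbl a -> cbl (fun g => rtmul (m g) (f g) (a g)).
Proof. by apply: cbl_app3; rewrite /rtmul; compute_step. Qed.

End AlgorithmPrograms2.
#[global] Hint Resolve cbl_eql cbl_ltl cbl_diffl cbl_subl cbl_incs cbl_perms cbl_rtmul : cbl.

Section AlgorithmPrograms3.
Context (K : fieldType).
Context (G : Type) (eG : encodable K G).
Implicit Types (a b : G -> rmono) (q : G -> relt K).

Lemma cbl_eqm a b : cbl a -> cbl b -> cbl (fun g => eqm (a g) (b g)).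
Proof. by apply: cbl_app2; rewrite /eqm; compute_step. Qed.

Lemma cbl_ltm a b : cbl a -> cbl b -> cbl (fun g => ltm (a g) (b g)).
Proof. by apply: cbl_app2; rewrite /ltm; compute_step. Qed.

Lemma cbl_wd q : cbl q -> cbl (fun g => wd (q g)).
Proof. by apply: cbl_app1; rewrite /wd; compute_step. Qed.

Lemma cbl_scal (k : G -> K) (m : G -> seq letter) (f : G -> seq nat) q :
  cbl k -> cbl m -> cbl f -> cbl q -> cbl (fun g => scal (k g) (m g) (f g) (q g)).
Proof. by apply: cbl_app4; rewrite /scal; compute_step. Qed.

End AlgorithmPrograms3.
#[global] Hint Resolve cbl_eqm cbl_ltm cbl_wd cbl_scal : cbl.

Lemma cbl_coef (K : fieldType) (G : Type) (eG : encodable K G) (a : G -> rmono)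
    (q : G -> relt K) :
  cbl q -> cbl a -> cbl (fun g => coef (q g) (a g)).
Proof. by apply: cbl_app2; rewrite /coef; compute_step. Qed.
#[global] Hint Resolve cbl_coef : cbl.

Lemma cbl_leads (K : fieldType) (G : Type) (eG : encodable K G) (q : G -> relt K) :
  cbl q -> cbl (fun g => leads (q g)).
Proof. by apply: cbl_app1; rewrite /leads; compute_step. Qed.
#[global] Hint Resolve cbl_leads : cbl.

Lemma cbl_lead (K : fieldType) (G : Type) (eG : encodable K G) (q : G -> relt K) :
  cbl q -> cbl (fun g => lead (q g)).
Proof. by apply: cbl_app1; rewrite /lead; compute_step. Qed.
#[global] Hint Resolve cbl_lead : cbl.

Lemma cbl_lcoef (K : fieldType) (G : Type) (eG : encodable K G) (q : G -> relt K) :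
  cbl q -> cbl (fun g => lcoef (q g)).
Proof. by apply: cbl_app1; rewrite /lcoef; compute_step. Qed.
#[global] Hint Resolve cbl_lcoef : cbl.

Section AlgorithmPrograms4.
Context (K : fieldType).
Context (G : Type) (eG : encodable K G).
Implicit Types (g h x : G -> relt K).

Lemma cbl_divs g x : cbl g -> cbl x -> cbl (fun t => divs (g t) (x t)).
Proof. by apply: cbl_app2; rewrite /divs; compute_step. Qed.

Lemma cbl_reduce1 x g (f : G -> seq nat) :
  cbl x -> cbl g -> cbl f -> cbl (fun t => reduce1 (x t) (g t) (f t)).
Proof. by apply: cbl_app3; rewrite /reduce1; compute_step. Qed.

Lemma cbl_spoly g h (f f' : G -> seq nat) :
  cbl g -> cbl h -> cbl f -> cbl f' -> cbl (fun t => spoly (g t) (h t) (f t) (f' t)).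
Proof. by apply: cbl_app4; rewrite /spoly; compute_step. Qed.

Lemma cbl_overlap c g h (f f' : G -> seq nat) :
  cbl g -> cbl h -> cbl f -> cbl f' -> cbl (fun t => overlap c (g t) (h t) (f t) (f' t)).
Proof. by apply: cbl_app4; rewrite /overlap; compute_step. Qed.

End AlgorithmPrograms4.
#[global] Hint Resolve cbl_divs cbl_reduce1 cbl_spoly cbl_overlap : cbl.

Lemma cbl_reducers (K : fieldType) (A : Type) (eA : encodable K A)
    (G : A -> seq (relt K)) (x : A -> relt K) :
  cbl G -> cbl x -> cbl (fun g => reducers (G g) (x g)).
Proof. by apply: cbl_app2; rewrite /reducers; compute_step. Qed.
#[global] Hint Resolve cbl_reducers : cbl.

Lemma cbl_spolys (K : fieldType) (A : Type) (eA : encodable K A) c (g h : A -> relt K) :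
  cbl g -> cbl h -> cbl (fun t => spolys c (g t) (h t)).
Proof. by apply: cbl_app2; rewrite /spolys; compute_step. Qed.
#[global] Hint Resolve cbl_spolys : cbl.

Lemma cbl_all_spolys (K : fieldType) (A : Type) (eA : encodable K A) c
    (x : A -> relt K) (G : A -> seq (relt K)) :
  cbl x -> cbl G -> cbl (fun t => all_spolys c (x t) (G t)).
Proof. by apply: cbl_app2; rewrite /all_spolys; compute_step. Qed.
#[global] Hint Resolve cbl_all_spolys : cbl.

Lemma cbl_buch_step (K : fieldType) c : cbl (@buch_step K c).
Proof. by rewrite /buch_step; compute_step. Qed.

(** * Well-quasi-orders and Higman's lemma *)

Definition wqo (A : Type) (R : A -> A -> Prop) : Prop :=
  forall f : nat -> A, exists i j, i < j /\ R (f i) (f j).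

Lemma increasing_seq (f : nat -> nat) :
  (forall n, f n < f n.+1) -> forall i j, i < j -> f i < f j.
Proof.
move=> H i; elim=> // j IH; rewrite ltnS leq_eqVlt => /predU1P[-> //|/IH ij].
exact: ltn_trans ij (H j).
Qed.

Lemma wf_no_descent (A : Type) (R : A -> A -> Prop) :
  (forall f : nat -> A, ~ forall n, R (f n.+1) (f n)) -> well_founded R.
Proof.
move=> H x; apply: contrapT => Nx.
have nxt (z : {x | ~ Acc R x}) : exists y : {x | ~ Acc R x}, R (sval y) (sval z).
  case: z => z Nz /=; apply: contrapT => Hz; apply: Nz; constructor=> y yz.
  by apply: contrapT => Ny; apply: Hz; exists (exist _ y Ny).
have [g Hg] := choice nxt.
by apply: (H (fun n => sval (iter n g (exist _ x Nx)))) => n /=; apply: Hg.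
Qed.

(** Call an index terminal if its member is related to no later one. Infinitely many terminal
    indices would form a sequence contradicting [wqo R]. Beyond the last of them each member is
    related to a later one, and these are chained. *)
Lemma wqo_subsequence (A : Type) (R : A -> A -> Prop) (f : nat -> A) :
  (forall a b c, R a b -> R b c -> R a c) -> wqo R ->
  exists phi : nat -> nat, (forall n, phi n < phi n.+1) /\
    forall i j, i < j -> R (f (phi i)) (f (phi j)).
Proof.
move=> Rtr Rwqo.
pose terminal i := forall j, i < j -> ~ R (f i) (f j).
have [N HN] : exists N, forall i, N <= i -> ~ terminal i.
  apply: contrapT => HN.
  have nxt N : exists i, N <= i /\ terminal i.
    by apply: contrapT => H; apply: HN; exists N => i Ni Ti; apply: H; exists i.
  have [g Hg] := choice nxt.
  pose t n := iter n (fun i => g i.+1) (g 0).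
  have tT n : terminal (t n) by case: n => [|n]; [exact: (Hg 0).2 | exact: (Hg _).2].
  have tS n : t n < t n.+1 by rewrite /=; case: (Hg (t n).+1).
  have [i [j [ij Rij]]] := Rwqo (f \o t).
  exact: tT (increasing_seq tS ij) Rij.
have nxt i : exists j, N <= i -> i < j /\ R (f i) (f j).
  have [Ni|] := boolP (N <= i); last by exists 0.
  apply: contrapT => H; apply: (HN i Ni) => j ij Rij.
  by apply: H; exists j.
have [g Hg] := choice nxt.
pose t n := iter n g N.
have tN n : N <= t n.
  elim: n => //= n IH; case: (Hg _ IH) => /ltnW H _; exact: leq_trans IH H.
have tS n : t n < t n.+1 by case: (Hg _ (tN n)).
exists t; split=> // i; elim=> // j IH; rewrite ltnS leq_eqVlt.
have Rj : R (f (t j)) (f (t j.+1)) by case: (Hg _ (tN j)).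
by move=> /predU1P[-> //|/IH Rij]; apply: Rtr Rij Rj.
Qed.

Lemma wqo_and (A : Type) (R S : A -> A -> Prop) :
  (forall a b c, R a b -> R b c -> R a c) -> wqo R -> wqo S ->
  wqo (fun a b => R a b /\ S a b).
Proof.
move=> Rtr Rw Sw f; have [phi [phiS phiR]] := wqo_subsequence f Rtr Rw.
have [i [j [ij Sij]]] := Sw (f \o phi).
exists (phi i), (phi j); split; first exact: increasing_seq.
by split=> //; apply: phiR.
Qed.

Lemma wqo_leq (A : Type) (m : A -> nat) : wqo (fun a b => m a <= m b).
Proof.
move=> f; have H : exists n, `[< exists i, m (f i) = n >].
  by exists (m (f 0)); apply/asboolP; exists 0.
case: (ex_minnP H) => n /asboolP[i Hi] min.
exists i, i.+1; split=> //; rewrite Hi; apply: min; apply/asboolP.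
by exists i.+1.
Qed.

(** Dickson's lemma, for the first [R] coordinates. *)
Lemma wqo_leq_upto (A : Type) (m : A -> nat -> nat) (R : nat) :
  wqo (fun a b => forall r, r < R -> m a r <= m b r).
Proof.
elim: R => [|R IH]; first by move=> f; exists 0, 1.
have Htr a b c : (forall r, r < R -> m a r <= m b r) ->
    (forall r, r < R -> m b r <= m c r) -> forall r, r < R -> m a r <= m c r.
  by move=> H1 H2 r rR; apply: leq_trans (H1 r rR) (H2 r rR).
move=> f; have [i [j [ij [H1 H2]]]] := wqo_and Htr IH (wqo_leq (m^~ R)) f.
exists i, j; split=> // r; rewrite ltnS leq_eqVlt => /predU1P[->//|]; exact: H1.
Qed.

(** Infinite pigeonhole principle, by induction on the number of values: either the top value stops
    occurring, or its occurrences form the subsequence. *)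
Lemma wqo_eq_bounded (A : Type) (m : A -> nat) (N : nat) (f : nat -> A) :
  (forall n, m (f n) < N) -> exists phi : nat -> nat,
    (forall n, phi n < phi n.+1) /\ forall i j, m (f (phi i)) = m (f (phi j)).
Proof.
elim: N f => [|N IH] f Hf; first by have := Hf 0.
have [[n0 Hn0]|H] := pselect (exists n0, forall n, n0 <= n -> m (f n) < N).
  have [phi [phiS phiE]] := IH (fun n => f (n0 + n)) (fun n => Hn0 _ (leq_addr _ _)).
  by exists (fun n => n0 + phi n); split=> [n|//]; rewrite ltn_add2l.
have nxt n0 : exists n, n0 <= n /\ m (f n) = N.
  apply: contrapT => Hn; apply: H; exists n0 => n n0n.
  rewrite ltn_neqAle -ltnS Hf andbT; apply/eqP => E.
  by apply: Hn; exists n.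
have [g Hg] := choice nxt.
pose t n := iter n (fun i => g i.+1) (g 0).
have tT n : m (f (t n)) = N by case: n => [|n]; [exact: (Hg 0).2 | exact: (Hg _).2].
exists t; split=> [n|i j]; last by rewrite !tT.
by rewrite /=; case: (Hg (t n).+1).
Qed.

Section Higman.
Context (A : Type) (R : A -> A -> Prop).

Inductive emb : seq A -> seq A -> Prop :=
| EmbNil v : emb [::] v
| EmbSkip y u v : emb u v -> emb u (y :: v)
| EmbCons x y u v : R x y -> emb u v -> emb (x :: u) (y :: v).

(** For words of columns, the list of positions becomes the increasing map in a divisibility. *)
Lemma emb_index u v : emb u v -> exists f : seq nat,
  [/\ size f = size u, forall i, i.+1 < size f -> nth 0 f i < nth 0 f i.+1,
      all (fun j => j < size v) f &
      forall x0 i, i < size u -> R (nth x0 u i) (nth x0 v (nth 0 f i))].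
Proof.
elim=> {u v} [v|y u v _ [f [sf pf af Hf]]|x y u v Rxy _ [f [sf pf af Hf]]].
- by exists [::].
- exists (map S f); rewrite size_map all_map /=; split=> // [i iu|x0 i iu].
    by rewrite !(nth_map 0) ?(ltnW iu) // ltnS pf.
  by rewrite (nth_map 0) ?sf //; apply: Hf.
exists (0 :: map S f); rewrite /= size_map sf all_map; split=> // [[|i] iu|x0 [//|i] iu].
- by rewrite /= (nth_map 0) // sf.
- have iu' : i.+1 < size f by rewrite sf.
  by rewrite /= !(nth_map 0) ?(ltnW iu') // ltnS pf.
by rewrite /= (nth_map 0) ?sf //; apply: Hf.
Qed.

Definition bad (s : nat -> seq A) := forall i j, i < j -> ~ emb (s i) (s j).

Lemma bad_minimize n (s : nat -> seq A) : bad s ->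
  exists t, [/\ bad t, forall i, i < n -> t i = s i &
    forall u, bad u -> (forall i, i < n -> u i = s i) -> size (t n) <= size (u n)].
Proof.
move=> bs.
have H : exists m, `[< exists t, [/\ bad t, forall i, i < n -> t i = s i & size (t n) = m] >].
  by exists (size (s n)); apply/asboolP; exists s.
case: (ex_minnP H) => m /asboolP[t [bt ts tm]] min.
exists t; split=> // u bu us; rewrite tm; apply: min.
by apply/asboolP; exists u.
Qed.

(* Nash-Williams' minimal bad sequence argument. *)
Lemma higman : (forall a b c, R a b -> R b c -> R a c) -> wqo R -> wqo emb.
Proof.
move=> Rtr Rw f; apply: contrapT => Hf.
have bf : bad f by move=> i j ij E; apply: Hf; exists i, j.
have step (z : nat * {s | bad s}) : exists t : {s | bad s},
    (forall i, i < z.1 -> sval t i = sval z.2 i) /\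
    forall u, bad u -> (forall i, i < z.1 -> u i = sval z.2 i) ->
      size (sval t z.1) <= size (u z.1).
  case: z => n [s bs] /=; have [t [bt ts tm]] := bad_minimize n bs.
  by exists (exist _ t bt).
have [g Hg] := choice step.
(* Each [S n] is bad, agrees with its predecessor on the first [n] terms and has its [n]-th term as
   short as possible; the diagonal [M] is the minimal bad sequence. *)
pose S := fix S n := if n is k.+1 then g (k.+1, S k) else g (0, exist _ f bf).
pose M n := sval (S n) n.
have SE n m i : i <= n -> sval (S (m + n)) i = sval (S n) i.
  move=> le; elim: m => // m IH; rewrite addSn /= (Hg _).1 //=.
  by rewrite ltnS (leq_trans le) // leq_addl.
have ME n i : i <= n -> sval (S n) i = M i.
  by move=> le; rewrite -(subnK le) SE.
have bM : bad M.
  by move=> i j ij; rewrite -(ME j i (ltnW ij)) -(ME j j (leqnn _)); exact: (svalP (S j)) ij.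
have Mmin n u : bad u -> (forall i, i < n -> u i = M i) -> size (M n) <= size (u n).
  case: n => [|n] bu Hu; first by apply: ((Hg _).2 u).
  apply: ((Hg (n.+1, S n)).2 u) => //= i; rewrite ltnS => le.
  by rewrite Hu ?ltnS // ME.
have Mcons n : exists xt : A * seq A, M n = xt.1 :: xt.2.
  case E: (M n) => [|x t]; last by exists (x, t).
  by case: (bM n n.+1 (leqnn _)); rewrite E; constructor.
have [h Hh] := choice Mcons.
have [phi [phiS phiR]] := wqo_subsequence (fun n => (h n).1) Rtr Rw.
(* The sequence [M] before [phi 0], then the tails of the words [M (phi k)], whose first letters
   ascend. An embedding of tails extends to the whole words, so [u] is bad; but its term at [phi 0]
   is shorter than that of [M]. *)
pose u n := if n < phi 0 then M n else (h (phi (n - phi 0))).2.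
have sub n : phi 0 <= phi n by case: n => // n; apply/ltnW/(increasing_seq phiS).
have bu : bad u.
  move=> i j ij; rewrite /u; case: (ltnP j (phi 0)) => jp.
    by rewrite (ltn_trans ij jp); apply: bM.
  case: (ltnP i (phi 0)) => ip E.
    apply: (bM i (phi (j - phi 0))); first exact: leq_trans ip (sub _).
    by rewrite [M (phi _)]Hh; constructor.
  have lt : i - phi 0 < j - phi 0 by lia.
  apply: (bM (phi (i - phi 0)) (phi (j - phi 0))); first exact: increasing_seq.
  by rewrite !(Hh (phi _)); constructor => //; apply: phiR.
have /= := Mmin (phi 0) u bu.
rewrite {2}/u ltnn subnn (Hh (phi 0)) /= ltnn => H; suff : false by [].
by apply: H => i ip; rewrite /u ip.
Qed.

End Higman.

(** * Gröbner bases in a vector space with a monoid acting on its basis *)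

Local Open Scope ring_scope.

Section LinearExtension.
Context (K : nzRingType).

Definition lin (I J : choiceType) (h : I -> J) (x : {malg K[I]}) : {malg K[J]} :=
  \sum_(i <- msupp x) << x@_i *g h i >>.

Context (I J : choiceType) (h : I -> J).
Implicit Types x y : {malg K[I]}.

Lemma linEw (D : {fset I}) x : (msupp x `<=` D)%fset ->
  lin h x = \sum_(i <- D) << x@_i *g h i >>.
Proof.
move=> le; rewrite [LHS](big_fset_incl _ le) => //= i _ /mcoeff_outdom ->.
by rewrite monalgU0.
Qed.

Lemma linD x y : lin h (x + y) = lin h x + lin h y.
Proof.
rewrite (linEw (msuppD_le x y)) (linEw (fsubsetUl (msupp x) (msupp y))).
rewrite (linEw (fsubsetUr (msupp x) (msupp y))) -big_split /=.
by apply: eq_bigr => e _; rewrite mcoeffD monalgUD.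
Qed.

Lemma linU k i : lin h << k *g i >> = << k *g h i >>.
Proof. by rewrite (linEw msuppU_le) big_seq_fset1 mcoeffUU. Qed.

Lemma lin0 : lin h 0 = 0.
Proof. by rewrite /lin msupp0 big_seq_fset0. Qed.

Lemma lin_sum A (r : seq A) (F : A -> {malg K[I]}) :
  lin h (\sum_(a <- r) F a) = \sum_(a <- r) lin h (F a).
Proof. exact: (big_morph _ linD lin0). Qed.

Lemma linZ k x : lin h (k *: x) = k *: lin h x.
Proof.
rewrite [in LHS](monalgE x) scaler_sumr lin_sum [lin h x]/lin scaler_sumr.
by apply: eq_bigr => i _; rewrite !malgZU linU.
Qed.

Lemma linN x : lin h (- x) = - lin h x.
Proof. by rewrite -scaleN1r linZ scaleN1r. Qed.

Lemma mcoeff_lin x j : (lin h x)@_j != 0 -> exists2 i, x@_i != 0 & h i = j.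
Proof.
move=> Hj; apply: contrapT => H; move/eqP: Hj; apply.
rewrite /lin raddf_sum /= big_seq big1 // => i ix.
rewrite mcoeffU; case: eqP => [hi|]; last by rewrite mulr0n.
by case: H; exists i => //; rewrite mcoeff_neq0.
Qed.

Lemma mcoeff_lin_inj x i : injective h -> (lin h x)@_(h i) = x@_i.
Proof.
move=> hI; rewrite [in RHS](monalgE x) /lin !raddf_sum /=.
by apply: eq_bigr => k _; rewrite !mcoeffU (inj_eq hI).
Qed.

End LinearExtension.

Lemma lin_comp (K : nzRingType) (I J L : choiceType) (h : J -> L) (h' : I -> J)
    (x : {malg K[I]}) : lin h (lin h' x) = lin (h \o h') x.
Proof. by rewrite [lin h' x]/lin lin_sum; apply: eq_bigr => i _; rewrite linU. Qed.

Lemma eq_lin (K : nzRingType) (I J : choiceType) (h h' : I -> J) (x : {malg K[I]}) :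
  (forall i, x@_i != 0 -> h i = h' i) -> lin h x = lin h' x.
Proof.
move=> H; rewrite /lin [LHS]big_seq [RHS]big_seq; apply: eq_bigr => i.
by rewrite -mcoeff_neq0 => /H ->.
Qed.

Section Groebner.
Context (K : fieldType) (M : choiceType) (lt : M -> M -> Prop).
Local Notation V := {malg K[M]}.
Implicit Types (x y v w : V) (a b c : M).

Definition le a b := a = b \/ lt a b.

Definition islead x a := x@_a <> 0 /\ forall b, x@_b <> 0 -> le b a.

Context (lt_trans : forall b a c, lt a b -> lt b c -> lt a c).
Context (lt_irr : forall a, ~ lt a a).
Context (lt_total : forall a b, [\/ a = b, lt a b | lt b a]).
Context (T : Type) (act : T -> M -> M) (mul : T -> T -> T).
Context (lt_act : forall t a b, lt a b -> lt (act t a) (act t b)).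
Context (act_mul : forall s t a, act (mul s t) a = act s (act t a)).
(** This will be a bound on the index and on the rows of a monomial, under which divisibility up to
    increasing maps is a well-quasi-order. *)
Context (ok : M -> Prop).
Context (lt_wf : well_founded (fun a b => ok a /\ lt a b)).

Lemma act_inj t : injective (act t).
Proof.
by move=> a b E; case: (lt_total a b) => // /(lt_act t); rewrite E => /lt_irr.
Qed.

Lemma le_trans b a c : le a b -> le b c -> le a c.
Proof.
by move=> [->//|ab] [<-|bc]; right=> //; apply: lt_trans ab bc.
Qed.

Lemma islead_lin t x a : islead x a -> islead (lin (act t) x) (act t a).
Proof.
move=> [xa xle]; split; first by rewrite mcoeff_lin_inj //; apply: act_inj.
move=> b /eqP/mcoeff_lin[c /eqP/xle xc <-].
by case: xc => [->|/(lt_act t)]; [left | right].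
Qed.

Context (G : V -> M -> Prop).

(** Linear combinations of translates of members of [G] whose leading monomials all satisfy [bd]. If
    [bd] is the set of monomials up to the lead of [x], this is a standard representation of [x]. *)
Inductive rep (bd : M -> Prop) : V -> Prop :=
| Rep0 : rep bd 0
| RepS x k t v a : rep bd x -> G v a -> bd (act t a) ->
    rep bd (x + k *: lin (act t) v).

Lemma rep_sub (bd bd' : M -> Prop) x :
  (forall a, bd a -> bd' a) -> rep bd x -> rep bd' x.
Proof.
move=> H; elim=> {x} [|x k t v a _ IH Gv bt]; first exact: Rep0.
by apply: (RepS k IH Gv); apply: H.
Qed.

Lemma rep_add bd x y : rep bd x -> rep bd y -> rep bd (x + y).
Proof.
move=> Hx; elim=> {y} [|y k t v a _ IH Gv bt]; first by rewrite addr0.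
by rewrite addrA; apply: (RepS k IH Gv).
Qed.

Lemma rep_scale bd k x : rep bd x -> rep bd (k *: x).
Proof.
elim=> {x} [|x l t v a _ IH Gv bt]; first by rewrite scaler0; apply: Rep0.
by rewrite scalerDr scalerA; apply: (RepS _ IH Gv).
Qed.

Lemma rep1 (bd : M -> Prop) k t v a : G v a -> bd (act t a) -> rep bd (k *: lin (act t) v).
Proof. by move=> Gv bt; rewrite -[_ *: _]add0r; apply: RepS (Rep0 bd) Gv bt. Qed.

Lemma rep_lin (bd bd' : M -> Prop) t x :
  (forall a, bd a -> bd' (act t a)) -> rep bd x -> rep bd' (lin (act t) x).
Proof.
move=> H; elim=> {x} [|x k s v a _ IH Gv bt]; first by rewrite lin0; apply: Rep0.
rewrite linD linZ lin_comp.
have -> : lin (act t \o act s) v = lin (act (mul t s)) v.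
  by apply: eq_lin => i _; rewrite act_mul.
by apply: (RepS k IH Gv); rewrite act_mul; apply: H.
Qed.

Context (G_lead : forall v a, G v a -> islead v a).
Context (G_ok : forall v a t, G v a -> ok (act t a)).

Lemma rep_mcoeff c x b : rep (lt^~ c) x -> x@_b <> 0 -> lt b c.
Proof.
elim=> {x} [|x k t v a _ IH Gv bt]; first by rewrite mcoeff0.
rewrite mcoeffD mcoeffZ => Hb.
have [/IH //|/contrapT xb] := pselect (x@_b <> 0).
have /eqP/mcoeff_lin[d /eqP vd tE] : (lin (act t) v)@_b <> 0.
  by move=> E; apply: Hb; rewrite E mulr0 addr0.
have [_ vle] := G_lead Gv; case: (vle _ vd) => [E|/(lt_act t) dt].
  by rewrite -tE E.
by rewrite -tE; apply: lt_trans dt bt.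
Qed.

Lemma rep_max bd x : rep bd x ->
  x = 0 \/ exists c, [/\ bd c, ok c & rep (le^~ c) x].
Proof.
elim=> {x} [|x k t v a _ IH Gv bt]; first by left.
right; case: IH => [->|[c [bc okc Hc]]].
  by exists (act t a); split=> //; [apply: G_ok Gv | apply: RepS (Rep0 _) Gv _; left].
have [ac|ca] : le (act t a) c \/ le c (act t a).
- by case: (lt_total (act t a) c) => [->|H|H]; [left; left|left; right|right; right].
- by exists c; split=> //; apply: RepS Hc Gv _.
exists (act t a); split=> //; first exact: G_ok Gv.
apply: RepS Gv _; last by left.
by apply: rep_sub Hc => b bc'; apply: le_trans ca.
Qed.

(** All pairs of operators are quantified here; [common_factor] reduces them to finitely many
    S-polynomials for each pair of generators. *)
Definition buchberger : Prop := forall v a w b s t, G v a -> G w b ->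
  act s a = act t b ->
  rep (lt^~ (act s a)) (w@_b *: lin (act s) v - v@_a *: lin (act t) w).

Context (G_buch : buchberger).

(** The terms whose leading monomial is exactly [c] are merged into one multiple of a single
    translate. Each merge costs a multiple of an S-polynomial, which is represented below [c] by
    [G_buch]. *)
Lemma rep_top c x : rep (le^~ c) x ->
  rep (lt^~ c) x \/ exists v a t k,
    [/\ G v a, act t a = c & rep (lt^~ c) (x - k *: lin (act t) v)].
Proof.
elim=> {x} [|x k t v a _ IH Gv [tc|tc]]; first by left; apply: Rep0.
  right; case: IH => [Hx|[v' [a' [t' [k' [Gv' tc' Hx]]]]]].
    by exists v, a, t, k; split=> //; rewrite addrK.
  have [v'0 _] := G_lead Gv'; move/eqP in v'0.
  (* The translate of [v] times [k] is the translate of [v'] times [k / v'@_a' * v@_a] plus the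
     S-polynomial times [k / v'@_a']. *)
  exists v', a', t', (k' + k / v'@_a' * v@_a); split=> //.
  have := G_buch Gv Gv' (etrans tc (esym tc')); rewrite tc => /(rep_scale (k / v'@_a')).
  move=> /(rep_add Hx); rewrite scalerBr !scalerA divfK //.
  by rewrite scalerDl opprD addrACA.
case: IH => [Hx|[v' [a' [t' [k' [Gv' tc' Hx]]]]]]; [left|right].
  exact: RepS Hx Gv tc.
by exists v', a', t', k'; split=> //; rewrite addrAC; apply: RepS Hx Gv tc.
Qed.

(** If the merged multiple at [c] is nonzero, then [c] cannot cancel against the terms below it and
    is the lead. Otherwise the representation lies strictly below [c], and the induction applies at
    its greatest leading monomial. *)
Lemma rep_lead_le c x : ok c -> rep (le^~ c) x ->
  x = 0 \/ exists2 a, islead x a & rep (le^~ a) x.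
Proof.
elim/(well_founded_ind lt_wf): c x => c IH x okc Hx.
have down : rep (lt^~ c) x -> x = 0 \/ exists2 a, islead x a & rep (le^~ a) x.
  by case/rep_max=> [|[d [dc okd Hd]]]; [left | apply: IH Hd].
case: (rep_top Hx) => // -[v [a [t [k [Gv tc Hxk]]]]].
have [k0|/eqP k0] := pselect (k = 0).
  by apply: down; move: Hxk; rewrite k0 scale0r subr0.
right; exists c => //.
have [va vle] := islead_lin t (G_lead Gv); rewrite tc in va vle.
have xE b : x@_b = (x - k *: lin (act t) v)@_b + k * (lin (act t) v)@_b.
  by rewrite mcoeffB mcoeffZ subrK.
split=> [|b].
  rewrite xE; set y := (_ - _)@_c; have -> : y = 0.
    by apply: contrapT => /(rep_mcoeff Hxk)/lt_irr.
  by rewrite add0r; apply/eqP; rewrite mulf_neq0 //; apply/eqP.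
rewrite xE => Hb; have [/vle //|vb] := pselect ((lin (act t) v)@_b <> 0).
right; apply: (rep_mcoeff Hxk) => E; apply: Hb; rewrite E add0r.
by move/contrapT: vb => ->; rewrite mulr0.
Qed.

Lemma rep_lead x : rep (fun=> True) x ->
  x = 0 \/ exists2 a, islead x a & rep (le^~ a) x.
Proof.
by case/rep_max=> [|[c [_ okc Hc]]]; [left | apply: rep_lead_le Hc].
Qed.

End Groebner.

(** * Monomials as multisets of letters *)

Local Open Scope nat_scope.

Notation cmon := {cmonom letter}.
Notation mono := (nat * cmon)%type.

Section MonomialOfList.
Context (I : choiceType).
Implicit Types (l : seq I) (m : {cmonom I}) (v : I).

Definition cm l : {cmonom I} := \big[mmul/mone]_(v <- l) ucm v.

Definition letters_of m : seq I := flatten [seq nseq (m v) v | v <- finsupp m].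

Lemma cm_count l v : cm l v = count_mem v l.
Proof.
rewrite /cm; elim: l => [|u l IH]; first by rewrite big_nil cm1.
by rewrite big_cons cmM IH cmU.
Qed.

Lemma count_flatten_nseq (F : I -> nat) (s : seq I) v : uniq s ->
  count_mem v (flatten [seq nseq (F u) u | u <- s]) = (v \in s) * F v.
Proof.
elim: s => //= u s IH /andP[us /IH]; rewrite count_cat inE => ->.
rewrite count_nseq /= eq_sym; case: eqP => [->|_]; last by rewrite add0n.
by rewrite (negPf us) addn0.
Qed.

Lemma letters_ofK m : cm (letters_of m) = m.
Proof.
apply/eqP/cmP => v; rewrite cm_count count_flatten_nseq ?fset_uniq //.
by case: (boolP (v \in finsupp m)) => [|H]; rewrite ?mul1n // mul0n; apply/esym/eqP; rewrite cmE_eq0.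
Qed.

Lemma cm_cat l l' : cm (l ++ l') = mmul (cm l) (cm l').
Proof. by apply/eqP/cmP => v; rewrite cmM !cm_count count_cat. Qed.

Lemma cm_perm l l' : cm l = cm l' -> perm_eq l l'.
Proof. by move=> E; apply/allP => v _ /=; rewrite -!cm_count E. Qed.

End MonomialOfList.

Lemma cm_cnt (l : seq letter) v : cm l v = cnt v l.
Proof. exact: cm_count. Qed.

Lemma eq_cm (l l' : seq letter) : (forall v, cnt v l = cnt v l') -> cm l = cm l'.
Proof. by move=> H; apply/eqP/cmP => v; rewrite !cm_cnt. Qed.

Lemma cnt_cat v l l' : cnt v (l ++ l') = cnt v l + cnt v l'.
Proof. exact: count_cat. Qed.

Lemma cnt_gt0 v l : (0 < cnt v l) = (v \in l).
Proof. by rewrite -has_count; apply/hasP/idP => [[u ul /eqP <-]|vl] //; exists v. Qed.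

Lemma cnt0 v l : v \notin l -> cnt v l = 0.
Proof. by rewrite -cnt_gt0 -eqn0Ngt => /eqP. Qed.

Definition colmap (f : nat -> nat) (v : letter) : letter := (v.1, f v.2).

Lemma colmap_inj f : injective f -> injective (colmap f).
Proof. by move=> fI [r j] [r' j'] [-> /fI ->]. Qed.

Lemma cnt_map (F : letter -> letter) v l : injective F -> cnt (F v) (map F l) = cnt v l.
Proof. by move=> FI; rewrite /cnt count_map; apply: eq_count => u /=; rewrite inj_eq. Qed.

Lemma cnt_perm v l l' : perm_eq l l' -> cnt v l = cnt v l'.
Proof. by move=> /permP; apply. Qed.

Definition cmap (f : nat -> nat) (m : cmon) : cmon := cm (map (colmap f) (letters_of m)).

Lemma cmap_cm f l : cmap f (cm l) = cm (map (colmap f) l).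
Proof.
by apply: eq_cm => v; apply/cnt_perm/perm_map/cm_perm; rewrite letters_ofK.
Qed.

Lemma cmap_inj f m v : injective f -> cmap f m (colmap f v) = m v.
Proof.
by move=> fI; rewrite -[m in RHS]letters_ofK !cm_cnt cnt_map //; apply: colmap_inj.
Qed.

Lemma cmap_out f m v : (forall j, f j <> v.2) -> cmap f m v = 0.
Proof.
move=> H; rewrite cm_cnt cnt0 //; apply/mapP => -[u _ E].
by apply: (H u.2); rewrite E.
Qed.

Lemma cmapM f m m' : cmap f (mmul m m') = mmul (cmap f m) (cmap f m').
Proof.
by rewrite -[m]letters_ofK -[m']letters_ofK -cm_cat !cmap_cm map_cat cm_cat.
Qed.

Lemma cmap_comp f g m : cmap f (cmap g m) = cmap (f \o g) m.
Proof. by rewrite -[m]letters_ofK !cmap_cm -map_comp. Qed.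

Lemma eq_cmap f g (m : cmon) :
  (forall v, 0 < m v -> f v.2 = g v.2) -> cmap f m = cmap g m.
Proof.
move=> H; congr cm; apply/eq_in_map => v.
rewrite -cnt_gt0 -cm_cnt letters_ofK => /H E.
by rewrite /colmap E.
Qed.

Section LetterOrder.
Implicit Types u v w : letter.

Lemma letter_le_refl v : letter_le v v.
Proof. by rewrite /letter_le eqxx leqnn orbT. Qed.

Lemma letter_le_trans v u w : letter_le u v -> letter_le v w -> letter_le u w.
Proof. rewrite /letter_le; lia. Qed.

Lemma letter_le_total u v : letter_le u v || letter_le v u.
Proof. rewrite /letter_le; lia. Qed.

Lemma letter_le_anti u v : letter_le u v -> letter_le v u -> u = v.
Proof. by case: u v => [a b] [a' b'] H1 H2; congr pair; move: H1 H2; rewrite /letter_le /=; lia. Qed.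

Lemma letter_max (l : seq letter) : l <> [::] ->
  exists2 v, v \in l & forall u, u \in l -> letter_le u v.
Proof.
elim: l => // v [|u l] IH _.
  by exists v => [|u]; rewrite inE // => /eqP ->; apply: letter_le_refl.
case: IH => // w wl wmax; have [vw|wv] := orP (letter_le_total v w).
  by exists w => [|x]; rewrite inE ?wl ?orbT // => /predU1P[->|/wmax].
exists v => [|x]; rewrite inE ?eqxx // => /predU1P[->|/wmax xw].
  exact: letter_le_refl.
exact: letter_le_trans xw wv.
Qed.

End LetterOrder.

Definition ltc (m n : cmon) : Prop := exists v, m v < n v /\
  forall u, ~~ letter_le u v -> m u = n u.

Definition ltM (a b : mono) : Prop := a.1 < b.1 \/ (a.1 = b.1 /\ ltc a.2 b.2).

Lemma ltc_trans n m p : ltc m n -> ltc n p -> ltc m p.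
Proof.
move=> [v [mv Hv]] [w [nw Hw]].
have [vw|wv] := orP (letter_le_total v w).
  exists w; split=> [|u uw].
    have [E|/negP wv] := pselect (letter_le w v); last by rewrite Hv.
    by rewrite -(letter_le_anti vw E) in nw *; apply: ltn_trans mv nw.
  by rewrite Hv ?Hw //; apply: contra uw => uv; apply: letter_le_trans uv vw.
exists v; split=> [|u uv].
  have [E|/negP vw] := pselect (letter_le v w); last by rewrite -Hw.
  by rewrite (letter_le_anti wv E) in nw *; apply: ltn_trans mv nw.
by rewrite Hv ?Hw //; apply: contra uv => uw; apply: letter_le_trans uw wv.
Qed.

Lemma ltc_irr m : ~ ltc m m.
Proof. by move=> [v []]; rewrite ltnn. Qed.

Lemma ltc_total m n : [\/ m = n, ltc m n | ltc n m].
Proof.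
pose D := [seq v <- letters_of m ++ letters_of n | m v != n v].
have DP u : u \notin D -> m u = n u.
  rewrite mem_filter negb_and negbK => /orP[/eqP//|].
  rewrite mem_cat negb_or -!cnt_gt0 -!cm_cnt !letters_ofK -!eqn0Ngt.
  by move=> /andP[/eqP -> /eqP ->].
have [D0|/letter_max[v vD vmax]] := pselect (D = [::]).
  by constructor 1; apply/eqP/cmP => v; apply: DP; rewrite D0.
have Hu u : ~~ letter_le u v -> m u = n u.
  by move=> uv; apply: DP; apply: contra uv; apply: vmax.
move: vD; rewrite mem_filter neq_ltn => /andP[/orP[] H _].
  by constructor 2; exists v.
by constructor 3; exists v; split=> // u /Hu.
Qed.

Lemma ltM_trans b a c : ltM a b -> ltM b c -> ltM a c.
Proof.
move=> [ab|[ab abc]] [bc|[bc bcc]].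
- by left; apply: ltn_trans ab bc.
- by left; rewrite -bc.
- by left; rewrite ab.
by right; split; [rewrite ab | apply: ltc_trans abc bcc].
Qed.

Lemma ltM_irr a : ~ ltM a a.
Proof. by move=> [|[_ /ltc_irr]]; rewrite ?ltnn. Qed.

Lemma ltM_total a b : [\/ a = b, ltM a b | ltM b a].
Proof.
case: (ltngtP a.1 b.1) => H; [by constructor 2; left|by constructor 3; left|].
case: (ltc_total a.2 b.2) => Hc.
- by constructor 1; case: a b H Hc => [i m] [j n] /= -> ->.
- by constructor 2; right.
by constructor 3; right.
Qed.

Definition rmono_of (a : rmono) : mono := (a.1, cm a.2).

Lemma eqlP l l' : reflect (cm l = cm l') (eql l l').
Proof.
apply: (iffP allP) => [H|E v _]; last first.
  by apply/eqP; rewrite -!cm_cnt E.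
apply: eq_cm => v; have [/H/eqP//|] := boolP (v \in l ++ l').
by rewrite mem_cat negb_or => /andP[vl vl']; rewrite !cnt0.
Qed.

Lemma eqmP a b : reflect (rmono_of a = rmono_of b) (eqm a b).
Proof.
apply: (iffP andP) => [[/eqP E /eqlP E']|[-> /eqlP]//].
by rewrite /rmono_of E E'.
Qed.

Lemma ltlP l l' : reflect (ltc (cm l) (cm l')) (ltl l l').
Proof.
apply: (iffP hasP) => [[v vl /andP[lv /allP H]]|[v [lv H]]].
  exists v; split=> [|u uv]; first by rewrite !cm_cnt.
  rewrite !cm_cnt; have [/H|] := boolP (u \in l ++ l').
    by rewrite (negPf uv) => /eqP.
  by rewrite mem_cat negb_or => /andP[ul ul']; rewrite !cnt0.
exists v; first by rewrite -cnt_gt0 -cm_cnt; apply: leq_ltn_trans lv.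
rewrite -!cm_cnt lv; apply/allP => u _.
by case: (boolP (letter_le u v)) => //= uv; rewrite -!cm_cnt H.
Qed.

Lemma ltmP a b : reflect (ltM (rmono_of a) (rmono_of b)) (ltm a b).
Proof.
apply: (iffP orP) => [[H|/andP[/eqP H /ltlP H']]|[H|[H /ltlP H']]].
- by left.
- by right.
- by left.
by right; rewrite H' andbT; apply/eqP.
Qed.

(** * The monoid generated by the variables and the increasing maps *)

Section Operators.
Context (c : nat).

(** Apply the increasing map, then multiply by a product of variables; [op_rows] excludes marker
    letters. Composition is that of a semidirect product. The map lives on all columns and need not
    be a permutation. *)
Record oper := Oper {
  op_m : seq letter;
  op_f : nat -> nat;
  op_rows : rows_lt c op_m;
  op_incr : forall i j, i < j -> op_f i < op_f j
}.

Lemma op_mul_rows s t : rows_lt c (op_m s ++ map (colmap (op_f s)) (op_m t)).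
Proof.
by rewrite /rows_lt all_cat all_map; apply/andP; split; [exact: op_rows s | exact: op_rows t].
Qed.

Lemma op_mul_incr s t i j : i < j -> op_f s (op_f t i) < op_f s (op_f t j).
Proof. by move=> ij; do 2 apply: op_incr. Qed.

Definition op_mul (s t : oper) : oper := Oper (op_mul_rows s t) (@op_mul_incr s t).

Definition op_act (t : oper) (a : mono) : mono :=
  (a.1, mmul (cm (op_m t)) (cmap (op_f t) a.2)).

Lemma cmon_mulA (m n p : cmon) : mmul m (mmul n p) = mmul (mmul m n) p.
Proof. by apply/eqP/cmP => v; rewrite !cmM addnA. Qed.

Lemma cmon_mulC (m n : cmon) : mmul m n = mmul n m.
Proof. by apply/eqP/cmP => v; rewrite !cmM addnC. Qed.

Lemma cmon_mulI (m n p : cmon) : mmul m n = mmul m p -> n = p.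
Proof.
by move=> E; apply/eqP/cmP => v; apply: (@addnI (m v)); rewrite -!cmM E.
Qed.

Lemma op_act_mul s t a : op_act (op_mul s t) a = op_act s (op_act t a).
Proof.
by rewrite /op_act /= cm_cat cmapM cmap_cm cmap_comp cmon_mulA.
Qed.

Lemma incr_inj f : (forall i j, i < j -> f i < f j) -> injective f.
Proof. by move=> H i j E; case: (ltngtP i j) => // /H; rewrite E ltnn. Qed.

Lemma ltc_cmap f m n : (forall i j, i < j -> f i < f j) ->
  ltc m n -> ltc (cmap f m) (cmap f n).
Proof.
move=> fI [v [mv Hv]]; have fi := incr_inj fI.
exists (colmap f v); split=> [|u uv]; first by rewrite !cmap_inj.
have [[j Hj]|Hj] := pselect (exists j, f j = u.2); last first.
  by rewrite !cmap_out // => j E; apply: Hj; exists j.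
have -> : u = colmap f (u.1, j) by rewrite /colmap /= Hj -surjective_pairing.
rewrite !cmap_inj // Hv //; apply: contra uv.
rewrite /letter_le /= -Hj => /orP[/fI ->//|/andP[/eqP -> ->]].
by rewrite eqxx orbT.
Qed.

Lemma op_act_lt t a b : ltM a b -> ltM (op_act t a) (op_act t b).
Proof.
move=> [H|[H /(ltc_cmap (@op_incr t))[v [mv Hv]]]]; [by left|right].
split=> //; exists v; split=> [|u /Hv E]; first by rewrite !cmM ltn_add2l.
by rewrite !cmM E.
Qed.

End Operators.

(** * Well-foundedness of the order *)

(** A word with one letter per column, namely the vector of multiplicities by row. An embedding of
    such words is an increasing map of columns that takes the first monomial to a divisor of the
    second, as far as the rows and columns in question go. *)
Definition colword (w : nat) (m : cmon) : seq (nat -> nat) :=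
  [seq (fun r => m (r, j)) | j <- iota 0 w].

Definition leq_upto (R : nat) (g h : nat -> nat) : Prop := forall r, r < R -> g r <= h r.

(** Operators need a map on all columns. Past the end of the list the values exceed [last 0 f],
    which keeps an increasing list increasing. *)
Definition inc_ext (f : seq nat) (j : nat) : nat :=
  if j < size f then nth 0 f j else (last 0 f).+1 + j.

Lemma incrbP f : reflect (forall i, i.+1 < size f -> nth 0 f i < nth 0 f i.+1) (incrb f).
Proof.
apply: (iffP allP) => H i; last by rewrite mem_iota => Hi; apply: H; lia.
by move=> Hi; apply: H; rewrite mem_iota; lia.
Qed.

Lemma incrb_ltn f i j : incrb f -> i < j -> j < size f -> nth 0 f i < nth 0 f j.
Proof.
move=> /incrbP H; elim: j => // j IH; rewrite ltnS leq_eqVlt => /predU1P[->|ij] js.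
  exact: H.
exact: ltn_trans (IH ij (ltnW js)) (H _ js).
Qed.

Lemma inc_ext_incr f : incrb f -> forall i j, i < j -> inc_ext f i < inc_ext f j.
Proof.
move=> If i j ij; rewrite /inc_ext; case: (ltnP j (size f)) => jf.
  by rewrite (ltn_trans ij jf); apply: incrb_ltn.
case: (ltnP i (size f)) => ifs; last by lia.
suff : nth 0 f i <= last 0 f by lia.
rewrite -nth_last; have [->|ne] := eqVneq i (size f).-1; first by [].
by apply/ltnW/incrb_ltn => //; lia.
Qed.

Lemma seqs_mem w n l : (l \in seqs w n) = (size l == w) && all (fun j => j < n) l.
Proof.
elim: w l => [|w IH] l; first by rewrite inE; case: l.
rewrite /seqs iterS -/(seqs w n); apply/flatten_mapP/andP.
  move=> [x]; rewrite mem_iota add0n /= => xn /mapP[l' Hl' ->] /=.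
  by move: Hl'; rewrite IH eqSS xn => /andP[-> ->].
case: l => [[]//|x l] [] /=; rewrite eqSS => ls /andP[xn la].
exists x; first by rewrite mem_iota.
by apply/mapP; exists l => //; rewrite IH ls.
Qed.

Lemma incs_mem w n f :
  (f \in incs w n) = [&& incrb f, size f == w & all (fun j => j < n) f].
Proof. by rewrite mem_filter seqs_mem. Qed.

Lemma emb_incs R w w' (m n : cmon) :
  emb (leq_upto R) (colword w m) (colword w' n) ->
  exists2 f, f \in incs w w' &
    forall r j, r < R -> j < w -> m (r, j) <= n (r, nth 0 f j).
Proof.
case/emb_index => f []; rewrite !size_map !size_iota => sf /incrbP If af Hf.
exists f => [|r j rR jw]; first by rewrite incs_mem If sf eqxx.
have := Hf (fun=> 0) j jw r rR.
rewrite !(nth_map 0) ?size_iota ?nth_iota ?add0n //.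
all: by apply: (allP af); rewrite mem_nth // sf.
Qed.

Lemma wdlP l v : v \in l -> v.2 < wdl l.
Proof.
elim: l => //= x l IH; rewrite inE => /predU1P[<-|/IH]; rewrite leq_max ?leqnn //.
by move=> ->; rewrite orbT.
Qed.

(** Suppose [n] is smaller than [m], with deciding letter [v]. Then [F] moves the column of [v],
    hence moves it up forever. Above [v] the two agree, so the multiplicity of [v] in [m] is at most
    that of each letter in its orbit, and [m] would be infinite. *)
Lemma ltc_noninflating F (m n : cmon) : (forall i j, i < j -> F i < F j) ->
  (forall v, m v <= n (colmap F v)) -> ~ ltc n m.
Proof.
move=> FI Hm [v [nv Hv]]; have Fge j : j <= F j.
  by elim: j => // j IH; apply: leq_ltn_trans IH (FI _ _ _).
have [E|ne] := eqVneq (F v.2) v.2.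
  by have := Hm v; rewrite /colmap E -surjective_pairing leqNgt nv.
pose u k := (v.1, iter k F v.2).
have Fu k : v.2 + k <= iter k F v.2 /\ iter k F v.2 < iter k.+1 F v.2.
  elim: k => [|k [IH1 IH2]]; first by rewrite addn0 ltn_neqAle eq_sym ne Fge.
  by split; [rewrite addnS; apply: leq_ltn_trans IH1 IH2 | apply: FI].
have mu k : m v <= m (u k).
  elim: k => [|k IH]; first by rewrite /u -surjective_pairing.
  apply: leq_trans IH _; apply: leq_trans (Hm _) _; rewrite /u /colmap /= Hv //.
  by rewrite /letter_le /=; have [] := Fu k.+1; rewrite /= => H _; lia.
(* The column of [u W] is at least [W], beyond all columns of [m]. *)
pose W := wdl (letters_of m).
have := mu W; rewrite leqNgt => /negP; apply.
suff -> : m (u W) = 0 by apply: leq_ltn_trans nv.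
apply/eqP; rewrite eqn0Ngt -{1}[m]letters_ofK cm_cnt cnt_gt0; apply/negP => /wdlP /=.
by have [H _] := Fu W; rewrite ltnNge (leq_trans (leq_addl _ _) H).
Qed.

Definition okM (N R : nat) (a : mono) : Prop :=
  a.1 < N /\ forall v, R <= v.1 -> a.2 v = 0.

Definition colbound (w : nat) (m : cmon) : Prop := forall v, w <= v.2 -> m v = 0.

Lemma colbound_cm l : colbound (wdl l) (cm l).
Proof.
by move=> v lv; rewrite cm_cnt cnt0 //; apply/negP => /wdlP; rewrite ltnNge lv.
Qed.

(** The index is constant on a subsequence, on which Higman's lemma over Dickson's applies to the
    words of columns. The attached number may be any bound on the columns, so that [extends_wf] can
    take the width of a whole element and not only of its lead. *)
Lemma wqo_mono N R (f : nat -> mono * nat) :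
  (forall n, okM N R (f n).1 /\ colbound (f n).2 (f n).1.2) ->
  exists i j, [/\ i < j, (f i).1.1 = (f j).1.1 &
    exists2 F, F \in incs (f i).2 (f j).2 &
      forall v, (f i).1.2 v <= (f j).1.2 (v.1, nth 0 F v.2)].
Proof.
move=> Hf; have [phi [phiS phiE]] := @wqo_eq_bounded _ (fun x : mono * nat => x.1.1) N f (fun n => (Hf n).1.1).
have [i [j [ij E]]] : exists i j, i < j /\ emb (leq_upto R)
    (colword (f (phi i)).2 (f (phi i)).1.2) (colword (f (phi j)).2 (f (phi j)).1.2).
  apply: (@higman _ (leq_upto R) _ _ (fun n => colword (f (phi n)).2 (f (phi n)).1.2)).
    by move=> g h k gh hk r rR; apply: leq_trans (gh r rR) (hk r rR).
  exact: (wqo_leq_upto (fun g : nat -> nat => g) R).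
exists (phi i), (phi j); split; [exact: increasing_seq | exact: phiE |].
have [F HF HFm] := emb_incs E; exists F => // -[r k] /=.
have [[_ ok] cb] := Hf (phi i).
case: (ltnP r R) => rR; last by rewrite ok.
by case: (ltnP k (f (phi i)).2) => kw; [apply: HFm | rewrite cb].
Qed.

(** In an infinite descent some term would divide a later, smaller one up to an increasing map,
    which [ltc_noninflating] excludes. *)
Lemma ltM_wf N R : well_founded (fun a b => okM N R a /\ ltM a b).
Proof.
apply: wf_no_descent => f Hf.
(* The shift by one is there because [okM] is known for every term but the first. *)
pose w n := wdl (letters_of (f n.+1).2).
have [n|i [j [ij tE [F HF HFm]]]] := @wqo_mono N R (fun n => (f n.+1, w n)).
  split; first by case: (Hf n).
  by have := @colbound_cm (letters_of (f n.+1).2); rewrite letters_ofK.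
have : ltM (f j.+1) (f i.+1).
  elim: j ij {tE HF HFm} => // j IH; rewrite ltnS leq_eqVlt => /predU1P[->|/IH lt].
    by case: (Hf j.+1).
  by apply: ltM_trans lt; case: (Hf j.+1).
move: HF; rewrite incs_mem /= => /and3P[If /eqP sF _].
case=> [|[_]]; first by rewrite tE ltnn.
apply: (ltc_noninflating (inc_ext_incr If)) => v /=.
rewrite /colmap /inc_ext sF; case: (ltnP v.2 (w i)) => vw; first exact: HFm.
have -> // : (f i.+1).2 v = 0.
by rewrite -[(f i.+1).2]letters_ofK; apply: colbound_cm.
Qed.

(** * Semantics of the elimination algorithm *)

Local Open Scope nat_scope.

(** The action of [op_act] without its side conditions, so that it also covers permutations of the
    columns. *)
Definition mact (m : seq letter) (f : nat -> nat) (a : mono) : mono :=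
  (a.1, mmul (cm m) (cmap f a.2)).

Lemma has_pred1E x (s : seq letter) : has (fun y => y == x) s = (x \in s).
Proof. by apply/hasP/idP => [[u ul /eqP <-]|vl] //; exists x. Qed.

Lemma dedup_uniq_mem l : uniq (dedup l) /\ dedup l =i l.
Proof.
elim: l => //= x s [U E]; rewrite has_pred1E E; case: ifP => [xs|/negbT xs].
  by split=> // y; rewrite E inE; case: eqP => // ->.
by split=> [|y]; rewrite /= ?E ?xs // !inE E.
Qed.

Lemma cnt_diffl v l m : cnt v (diffl l m) = cnt v l - cnt v m.
Proof.
have [U E] := dedup_uniq_mem l.
have -> : diffl l m = flatten [seq nseq (cnt u l - cnt u m) u | u <- dedup l].
  rewrite /diffl; congr flatten; apply: eq_map => u.
  by elim: (_ - _) 0 => //= n IH k; rewrite IH.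
rewrite [LHS](count_flatten_nseq _ _ U) E; case: (boolP (v \in l)) => vl; first by rewrite mul1n.
by rewrite mul0n (cnt0 vl).
Qed.

Lemma sublP l m : reflect (forall v, cnt v l <= cnt v m) (subl l m).
Proof.
apply: (iffP allP) => H v; last by [].
by have [/H|/cnt0 ->] := boolP (v \in l).
Qed.

Lemma cm_diffl l m : subl m l -> cm (diffl l m ++ m) = cm l.
Proof.
by move=> /sublP H; apply: eq_cm => v; rewrite cnt_cat cnt_diffl subnK.
Qed.

Lemma rmono_rtmul m f F (a : rmono) : (forall j, j < wdl a.2 -> nth 0 f j = F j) ->
  rmono_of (rtmul m f a) = mact m F (rmono_of a).
Proof.
move=> H; rewrite /rmono_of /mact /= cm_cat cmap_cm; congr (_, mmul _ (cm _)).
by apply/eq_in_map => v /wdlP/H E; rewrite /colmap E.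
Qed.

Local Open Scope ring_scope.

Section Semantics.
Context (K : fieldType).
Implicit Types (q g h x : relt K) (a b : rmono) (G Q : seq (relt K)).
Local Notation V := {malg K[mono]}.

Definition sem q : V := \sum_(t <- q) << t.1 *g rmono_of t.2 >>.

Lemma sem_cat q r : sem (q ++ r) = sem q + sem r.
Proof. exact: big_cat. Qed.

Lemma mcoeff_sem q a : (sem q)@_(rmono_of a) = coef q a.
Proof.
elim: q => [|t q IH]; first by rewrite /sem big_nil mcoeff0.
rewrite /sem big_cons mcoeffD -/(sem q) IH mcoeffU /=.
case: eqmP => [->|/eqP/negPf ->]; first by rewrite eqxx mulr1n.
by rewrite mulr0n add0r.
Qed.

Lemma sem_supp q (b : mono) : (sem q)@_b != 0 -> exists2 t, t \in q & rmono_of t.2 = b.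
Proof.
move=> Hb; apply: contrapT => H; move/eqP: Hb; apply.
rewrite /sem raddf_sum /= big_seq big1 // => t tq.
rewrite mcoeffU; case: eqP => [E|]; last by rewrite mulr0n.
by case: H; exists t.
Qed.

Lemma wd_mem q t : t \in q -> (wdl t.2.2 <= wd q)%N.
Proof.
elim: q => //= u q IH; rewrite inE leq_max => /predU1P[->|/IH ->].
  by rewrite leqnn.
by rewrite orbT.
Qed.

Lemma sem_colbound q (a : mono) v : (sem q)@_a != 0 -> (wd q <= v.2)%N -> a.2 v = 0%N.
Proof.
move=> /sem_supp[t /wd_mem tq <-] qv.
by apply: colbound_cm; apply: leq_trans tq qv.
Qed.

Lemma sem_scal k m f F q : (forall j, (j < wd q)%N -> nth 0%N f j = F j) ->
  sem (scal k m f q) = k *: lin (mact m F) (sem q).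
Proof.
move=> H; rewrite /sem /scal big_map lin_sum scaler_sumr big_seq [RHS]big_seq.
apply: eq_bigr => t tq; rewrite linU malgZU /=.
rewrite (@rmono_rtmul _ _ F) // => j jt; apply: H.
exact: leq_trans jt (wd_mem tq).
Qed.

Lemma leadsP q a : a \in leads q ->
  (exists2 t, t \in q & t.2 = a) /\ islead ltM (sem q) (rmono_of a).
Proof.
move=> /mapP[t]; rewrite mem_filter => /andP[/andP[qt /allP H] tq] ->.
split; first by exists t.
split=> [|b /eqP qb]; first by rewrite mcoeff_sem; apply/eqP.
have [u uq E] := sem_supp qb; move: qb; rewrite -E mcoeff_sem => qu.
move: (H u uq); rewrite (negPf qu) /= => /ltmP.
by case: (ltM_total (rmono_of t.2) (rmono_of u.2)) => [->|//|]; [left | right].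
Qed.

Lemma leads_nil q : leads q = [::] -> sem q = 0.
Proof.
move=> L; apply: contrapT => /eqP q0.
pose P (t : K * rmono) := ~~ (coef q t.2 == 0).
have maxi (r : seq (K * rmono)) : {subset r <= q} -> has P r -> exists2 t, t \in r & P t /\
    forall u, u \in r -> P u -> ~ ltM (rmono_of t.2) (rmono_of u.2).
  elim: r => //= t r IH rq; have [Hr _|Nr] := boolP (has P r); last first.
    rewrite orbF => Pt; exists t; rewrite ?inE ?eqxx //; split=> // u.
    rewrite inE => /predU1P[->|ur Pu]; first by move=> _ /ltM_irr.
    by case/hasP: Nr; exists u.
  case: IH => // [u ur|s sr [Ps smax]]; first by apply: rq; rewrite inE ur orbT.
  have [Pt|Pt] := boolP (P t); last first.
    exists s; rewrite ?inE ?sr ?orbT //; split=> // u.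
    by rewrite inE => /predU1P[-> /(negP Pt)//|]; apply: smax.
  have [st|st] := pselect (ltM (rmono_of s.2) (rmono_of t.2)).
    exists t; rewrite ?inE ?eqxx //; split=> // u.
    rewrite inE => /predU1P[->|ur Pu tu]; first by move=> _ /ltM_irr.
    exact: (smax u ur Pu (ltM_trans st tu)).
  exists s; rewrite ?inE ?sr ?orbT //; split=> // u.
  by rewrite inE => /predU1P[->|]; [move=> _ /st | apply: smax].
have /maxi[//|t tq [Pt tmax]] : has P q.
  have [b qb] : exists b : mono, (sem q)@_b != 0.
    apply: contrapT => H; case/eqP: q0; apply/malgP => a; rewrite mcoeff0.
    by apply: contrapT => /eqP qa; apply: H; exists a.
  have [t tq E] := sem_supp qb; apply/hasP; exists t => //.
  by rewrite /P -mcoeff_sem E.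
have : t.2 \in leads q.
  apply/mapP; exists t => //; rewrite mem_filter tq andbT -/(P t) Pt /=.
  apply/allP => u uq; case: (boolP (coef q u.2 == 0)) => //= Pu.
  by apply/ltmP; apply: tmax.
by rewrite L.
Qed.

Lemma leadP q : ~~ nilp (leads q) ->
  (exists2 t, t \in q & t.2 = lead q) /\ islead ltM (sem q) (rmono_of (lead q)).
Proof.
move=> H; apply: leadsP; rewrite /lead; case: (leads q) H => //= a l _.
by rewrite inE eqxx.
Qed.

Lemma lead_wdl q : ~~ nilp (leads q) -> (wdl (lead q).2 <= wd q)%N.
Proof. by case/leadP=> -[t tq <-] _; apply: wd_mem. Qed.

End Semantics.

Section WellFormed.
Context (K : fieldType) (c : nat) (d : seq nat).
Implicit Types (q g h x : relt K) (a b : rmono) (G Q : seq (relt K)).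

Definition rowcnt (r : nat) (l : seq letter) : nat := count (fun v : letter => v.1 == r) l.

(** The encoded terms of the free module with ranks [d]: one marker in each row from [c] to
    [c + d_i - 1], none above, and distinct columns for the markers because basis elements are
    injective maps. *)
Definition wfr a : Prop := [/\ (a.1 < size d)%N,
  forall r, (c <= r)%N -> rowcnt r a.2 = (r < c + nth 0%N d a.1)%N &
  forall u v, u \in a.2 -> v \in a.2 -> (c <= u.1)%N -> (c <= v.1)%N ->
    u.2 = v.2 -> u.1 = v.1].

Definition wfq q : Prop := forall t, t \in q -> wfr t.2.

Definition maxrow : nat := c + sumn d.

Lemma rowcnt_cat r l m : rowcnt r (l ++ m) = (rowcnt r l + rowcnt r m)%N.
Proof. exact: count_cat. Qed.

Lemma rowcnt_mapl r f l : rowcnt r (mapl f l) = rowcnt r l.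
Proof. by rewrite /rowcnt count_map. Qed.

Lemma rowcnt_cm r l m : cm l = cm m -> rowcnt r l = rowcnt r m.
Proof. by move=> /cm_perm/permP; apply. Qed.

Lemma rowcnt_eq0 r l : rows_lt c l -> (c <= r)%N -> rowcnt r l = 0%N.
Proof.
move=> /allP H cr; apply/eqP; rewrite eqn0Ngt -has_count; apply/hasPn => v /H.
by move=> vc; rewrite neq_ltn (leq_trans vc cr).
Qed.

Lemma rowcnt_rows_lt l : (forall r, (c <= r)%N -> rowcnt r l = 0%N) -> rows_lt c l.
Proof.
move=> H; apply/allP => v vl; rewrite ltnNge; apply/negP => /H/eqP.
by rewrite eqn0Ngt -has_count => /hasPn/(_ _ vl); rewrite eqxx.
Qed.

Lemma wfr_ok a : wfr a -> okM (size d) maxrow (rmono_of a).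
Proof.
move=> [ad Hr _]; split=> // v Rv; rewrite cm_cnt cnt0 //; apply/negP => va.
have cv : (c <= v.1)%N by apply: leq_trans Rv; rewrite leq_addr.
have := Hr v.1 cv; have -> : (v.1 < c + nth 0%N d a.1)%N = false.
  apply/negbTE; rewrite -leqNgt; apply: leq_trans Rv; rewrite leq_add2l.
  by elim: d a.1 ad {Hr} => //= x s IH [|i] /=; rewrite ?leq_addr // ltnS => /IH/leq_trans; apply; rewrite leq_addl.
have H : (0 < rowcnt v.1 a.2)%N by rewrite -has_count; apply/hasP; exists v.
by move=> E; rewrite E in H.
Qed.

Lemma wfr_rtmul m f a : rows_lt c m -> wfr a ->
  (forall i j, (i < wdl a.2)%N -> (j < wdl a.2)%N -> nth 0%N f i = nth 0%N f j -> i = j) ->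
  wfr (rtmul m f a).
Proof.
move=> Hm [ad Hr Hd] fI; split=> [//|r cr|u v] /=.
  by rewrite rowcnt_cat rowcnt_eq0 // rowcnt_mapl Hr.
have out w : w \in m ++ mapl f a.2 -> (c <= w.1)%N -> w \in mapl f a.2.
  by rewrite mem_cat => /orP[/(allP Hm) H|//]; rewrite leqNgt H.
move=> Hu Hv cu cv; move: (cu) (cv).
case/mapP: (out u Hu cu) => u' u'a ->; case/mapP: (out v Hv cv) => v' v'a -> /=.
by move=> cu' cv' E; apply: Hd => //; apply: fI => //; apply: wdlP.
Qed.

Lemma wfq_scal k m f q : rows_lt c m -> wfq q ->
  (forall i j, (i < wd q)%N -> (j < wd q)%N -> nth 0%N f i = nth 0%N f j -> i = j) ->
  wfq (scal k m f q).
Proof.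
move=> Hm Hq fI t /mapP[u uq -> /=]; apply: wfr_rtmul => //; first exact: Hq.
by move=> i j iu ju; apply: fI; apply: leq_trans (wd_mem uq).
Qed.

Lemma wfq_cat q g : wfq q -> wfq g -> wfq (q ++ g).
Proof. by move=> Hq Hg t; rewrite mem_cat => /orP[/Hq|/Hg]. Qed.

Lemma wfr_lead q : wfq q -> ~~ nilp (leads q) -> wfr (lead q).
Proof. by move=> Hq /leadP[[t /Hq Ht <-] _]. Qed.

(** Both monomials carry exactly one marker in each of the same rows, so the quotient has none and
    is a product of variables. *)
Lemma rows_lt_reduce a b f : wfr a -> wfr b -> a.1 = b.1 ->
  subl (mapl f a.2) b.2 -> rows_lt c (diffl b.2 (mapl f a.2)).
Proof.
move=> [_ Ha _] [_ Hb _] E /cm_diffl H; apply: rowcnt_rows_lt => r cr.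
have := rowcnt_cm r H; rewrite rowcnt_cat rowcnt_mapl Ha // Hb // E; lia.
Qed.

Lemma incs_inj w n f i j : f \in incs w n -> (i < w)%N -> (j < w)%N ->
  nth 0%N f i = nth 0%N f j -> i = j.
Proof.
rewrite incs_mem => /and3P[If /eqP sf _] iw jw.
by move=> E; case: (ltngtP i j) => // H; have := incrb_ltn If H; rewrite sf E ltnn => F; case: notF; apply: F.
Qed.

Lemma incs_ext w n f j : f \in incs w n -> (j < w)%N -> nth 0%N f j = inc_ext f j.
Proof. by rewrite incs_mem /inc_ext => /and3P[_ /eqP -> _] ->. Qed.

Lemma incs_incr w n f : f \in incs w n -> forall i j, (i < j)%N -> (inc_ext f i < inc_ext f j)%N.
Proof. by rewrite incs_mem => /and3P[/inc_ext_incr]. Qed.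

End WellFormed.

Section Cancellation.
Context (K : fieldType).
Local Notation V := {malg K[mono]}.
Implicit Types (x y : V) (a e : mono).

Lemma lead_cancel x y e k l : islead ltM x e -> islead ltM y e ->
  k * x@_e + l * y@_e = 0 ->
  forall m, (k *: x + l *: y)@_m <> 0 -> ltM m e.
Proof.
move=> [_ Hx] [_ Hy] E m; rewrite mcoeffD !mcoeffZ => Hm.
have : le ltM m e.
  have [/Hx//|/contrapT xm] := pselect (x@_m <> 0).
  by apply: Hy => ym; apply: Hm; rewrite xm ym !mulr0 addr0.
by case=> // me; case: Hm; rewrite me.
Qed.

End Cancellation.

(** * Invariants of Buchberger's algorithm *)

Section Buchberger.
Context (K : fieldType) (c : nat) (d : seq nat).
Implicit Types (q g h x : relt K) (a b : rmono) (G Q : seq (relt K)).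
Local Notation V := {malg K[mono]}.
Local Notation act := (@op_act c).
Local Notation op_lead_lin := (islead_lin ltM_irr ltM_total (@op_act_lt c)).
Local Notation wf q := (wfq c d q).

Definition gens G (v : V) (m : mono) : Prop :=
  exists2 g, g \in G & v = sem g /\ m = rmono_of (lead g).

Definition wfG G : Prop := forall g, g \in G -> wf g /\ ~~ nilp (leads g).

Lemma gens_lead G v m : wfG G -> gens G v m -> islead ltM v m.
Proof. by move=> HG [g /HG[_ /leadP[_ Hg]] [-> ->]]. Qed.

Lemma okM_act (t : oper c) m : okM (size d) (maxrow c d) m ->
  okM (size d) (maxrow c d) (act t m).
Proof.
move=> [md Hm]; split=> // v Rv; rewrite cmM.
have -> : cm (op_m t) v = 0%N.
  rewrite cm_cnt cnt0 //; apply/negP => /(allP (op_rows t)).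
  by rewrite ltnNge (leq_trans _ Rv) // leq_addr.
have [[j Hj]|Hj] := pselect (exists j, op_f t j = v.2); last first.
  by rewrite cmap_out // => j E; apply: Hj; exists j.
have -> : v = colmap (op_f t) (v.1, j) by rewrite /colmap /= Hj -surjective_pairing.
by rewrite cmap_inj ?Hm //; apply: incr_inj; apply: op_incr.
Qed.

Lemma gens_ok G v m t : wfG G -> gens G v m -> okM (size d) (maxrow c d) (act t m).
Proof.
move=> HG [g /HG[wg lg] [_ ->]].
by apply: okM_act; apply: wfr_ok; apply: wfr_lead.
Qed.

Lemma rep_gens_sub G G' bd (x : V) :
  {subset G <= G'} -> rep act (gens G) bd x -> rep act (gens G') bd x.
Proof.
move=> GG'; elim=> {x} [|x k t v a _ IH [g gG E] bt]; first exact: Rep0.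
by apply: RepS IH _ bt; exists g => //; apply: GG'.
Qed.

Lemma list_oper m f w n : rows_lt c m -> f \in incs w n ->
  exists t : oper c, op_m t = m /\ op_f t = inc_ext f.
Proof. by move=> Hm /incs_incr Hf; exists (Oper Hm Hf). Qed.

Lemma op_actE (t : oper c) : act t = mact (op_m t) (op_f t).
Proof. by []. Qed.

Lemma sem_scal_oper k m f n q : rows_lt c m -> f \in incs (wd q) n ->
  exists t : oper c, [/\ op_m t = m, op_f t = inc_ext f &
    sem (scal k m f q) = k *: lin (act t) (sem q)].
Proof.
move=> Hm Hf; have [t [tm tf]] := list_oper Hm Hf.
exists t; split=> //; rewrite (@sem_scal _ _ _ _ (op_f t)).
  by rewrite -tm -op_actE.
by move=> j jq; rewrite tf; apply: incs_ext Hf jq.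
Qed.

Lemma rtmul_lead (t : oper c) f n q : f \in incs (wd q) n -> op_f t = inc_ext f ->
  ~~ nilp (leads q) ->
  act t (rmono_of (lead q)) = rmono_of (rtmul (op_m t) f (lead q)).
Proof.
move=> Hf tf lq; rewrite (@rmono_rtmul _ _ (op_f t)) // => j jl.
by rewrite tf; apply: incs_ext Hf _; apply: leq_trans jl (lead_wdl lq).
Qed.

Lemma reduce1P x g f : wf x -> wf g -> ~~ nilp (leads x) -> ~~ nilp (leads g) ->
  f \in divs g x -> wf (reduce1 x g f) /\
  exists t : oper c, [/\ act t (rmono_of (lead g)) = rmono_of (lead x),
    sem (reduce1 x g f) = sem x + (- (lcoef x / lcoef g)) *: lin (act t) (sem g) &
    forall m, (sem (reduce1 x g f))@_m <> 0 -> ltM m (rmono_of (lead x))].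
Proof.
move=> wx wg lx lg; rewrite mem_filter => /andP[/andP[/eqP tE sub] Hf].
have Hr : rows_lt c (diffl (lead x).2 (mapl f (lead g).2)).
  by apply: (rows_lt_reduce (wfr_lead wg lg) (wfr_lead wx lx)).
split.
  apply: wfq_cat wx _; apply: wfq_scal wg _ => // i j; exact: incs_inj Hf.
have [t [tm tf E]] := sem_scal_oper (- (lcoef x / lcoef g)) Hr Hf.
have tL : act t (rmono_of (lead g)) = rmono_of (lead x).
  by rewrite (rtmul_lead Hf tf lg) tm /rmono_of /= tE cm_diffl.
have sE : sem (reduce1 x g f) = sem x + - (lcoef x / lcoef g) *: lin (act t) (sem g).
  by rewrite sem_cat E.
exists t; split=> // m; rewrite sE -[sem x]scale1r.
have [_ Lx] := leadP lx; have [_ Lg] := leadP lg.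
have := op_lead_lin t Lg; rewrite tL => Lt.
apply: (lead_cancel Lx Lt); rewrite mul1r -tL mcoeff_lin_inj; last first.
  exact: (act_inj ltM_irr ltM_total (@op_act_lt c)).
rewrite tL !mcoeff_sem -/(lcoef x) -/(lcoef g) mulNr divfK ?subrr //.
by apply/eqP; rewrite /lcoef -mcoeff_sem; case: Lg.
Qed.

(** The least common multiple of the two translated leads, at which the S-polynomial cancels. *)
Definition spbd g h f f' : mono :=
  rmono_of (rtmul (diffl (mapl f' (lead h).2) (mapl f (lead g).2)) f (lead g)).

Lemma spolyP g h f f' n n' : wf g -> wf h -> ~~ nilp (leads g) -> ~~ nilp (leads h) ->
  f \in incs (wd g) n -> f' \in incs (wd h) n' -> overlap c g h f f' ->
  wf (spoly g h f f') /\ exists s t : oper c,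
  [/\ [/\ op_m s = diffl (mapl f' (lead h).2) (mapl f (lead g).2),
       op_f s = inc_ext f,
       op_m t = diffl (mapl f (lead g).2) (mapl f' (lead h).2) &
       op_f t = inc_ext f'],
     act s (rmono_of (lead g)) = spbd g h f f',
     sem (spoly g h f f') =
       lcoef h *: lin (act s) (sem g) - lcoef g *: lin (act t) (sem h) &
     forall m, (sem (spoly g h f f'))@_m <> 0 -> ltM m (spbd g h f f')].
Proof.
move=> wg wh lg lh Hf Hf' /and3P[/eqP tE r1 r2]; split.
  apply: wfq_cat; [apply: wfq_scal wg _ | apply: wfq_scal wh _] => // i j.
    exact: incs_inj Hf.
  exact: incs_inj Hf'.
have [s [sm sf Es]] := sem_scal_oper (lcoef h) r1 Hf.
have [t [tm tf Et]] := sem_scal_oper (- lcoef g) r2 Hf'.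
have sL : act s (rmono_of (lead g)) = spbd g h f f'.
  by rewrite (rtmul_lead Hf sf lg) sm.
have tL : act t (rmono_of (lead h)) = spbd g h f f'.
  rewrite (rtmul_lead Hf' tf lh) tm /spbd /rmono_of /= tE; congr (_, _).
  by apply: eq_cm => v; rewrite !cnt_cat !cnt_diffl; lia.
have sE : sem (spoly g h f f') = lcoef h *: lin (act s) (sem g) + (- lcoef g) *: lin (act t) (sem h).
  by rewrite sem_cat Es Et.
exists s, t; split=> //; first by rewrite sE scaleNr.
move=> m; rewrite sE.
have [_ Lg] := leadP lg; have [_ Lh] := leadP lh.
have := op_lead_lin s Lg; have := op_lead_lin t Lh; rewrite sL tL => Lt Ls.
have inj := act_inj ltM_irr ltM_total (@op_act_lt c).
apply: (lead_cancel Ls Lt); rewrite -{1}sL -tL !mcoeff_lin_inj; try exact: inj.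
by rewrite !mcoeff_sem -/(lcoef h) -/(lcoef g) mulNr mulrC subrr.
Qed.

(* [x] is pending in the queue, up to multiples of [G] below [bd]. *)
Definition res G Q (bd : mono -> Prop) (x : V) : Prop :=
  rep act (gens G) bd x \/ exists q, [/\ q \in Q, rep act (gens G) bd (x - sem q) &
    forall m, (sem q)@_m <> 0 -> bd m].

Definition down_closed (bd : mono -> Prop) := forall m n, ltM m n -> bd n -> bd m.

Lemma oper_one : exists t : oper c, forall m, act t m = m.
Proof.
have r0 : rows_lt c [::] by [].
exists (@Oper c [::] id r0 (fun i j ij => ij)) => -[i m]; rewrite /op_act /=.
congr (_, _); apply/eqP/cmP => v; rewrite cmM cm_cnt /cnt /= add0n.
have -> : cmap id m = cm (letters_of m).
  by congr cm; rewrite -[RHS]map_id; apply: eq_map => -[].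
by rewrite letters_ofK.
Qed.

Lemma lin_one (t : oper c) (x : V) : (forall m, act t m = m) -> lin (act t) x = x.
Proof.
move=> H; rewrite [RHS]monalgE; apply: eq_bigr => m _; by rewrite H.
Qed.

Lemma rep_gen G g (bd : mono -> Prop) : g \in G -> bd (rmono_of (lead g)) ->
  rep act (gens G) bd (sem g).
Proof.
move=> gG bg; have [t Ht] := oper_one.
rewrite -[sem g]scale1r -[sem g](lin_one _ Ht); apply: rep1; first by exists g.
by rewrite !Ht.
Qed.

Lemma reducers_head G x : ~~ nilp (reducers G x) ->
  (head ([::], [::]) (reducers G x)).1 \in G /\
  (head ([::], [::]) (reducers G x)).2 \in divs (head ([::], [::]) (reducers G x)).1 x.
Proof.
move=> H; have : head ([::], [::]) (reducers G x) \in reducers G x.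
  by case: (reducers G x) H => //= y l _; rewrite inE eqxx.
by case/flatten_mapP=> g gG /mapP[f Hf ->].
Qed.

Definition wfS (S : seq (relt K) * seq (relt K)) : Prop :=
  wfG S.1 /\ forall q, q \in S.2 -> wf q.

Lemma all_spolysP x G y : y \in all_spolys c x G -> exists g h f f',
  [/\ (g = x /\ h \in G) \/ (h = x /\ g \in G), f \in incs (wd g) (wd g + wd h)%N,
    f' \in incs (wd h) (wd g + wd h)%N, overlap c g h f f' & y = spoly g h f f'].
Proof.
case/flatten_mapP=> z zG; rewrite mem_cat => /orP[] /flatten_mapP[f Hf] /mapP[f'];
  rewrite mem_filter => /andP[ov Hf'] ->.
  by exists x, z, f, f'; split=> //; left.
by exists z, x, f, f'; split=> //; right.
Qed.

Lemma mem_all_spolys x G g h f f' :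
  (g = x /\ h \in G) \/ (h = x /\ g \in G) -> f \in incs (wd g) (wd g + wd h)%N ->
  f' \in incs (wd h) (wd g + wd h)%N -> overlap c g h f f' ->
  spoly g h f f' \in all_spolys c x G.
Proof.
move=> gh Hf Hf' ov.
have Hs : spoly g h f f' \in spolys c g h.
  apply/flatten_mapP; exists f => //; apply/mapP; exists f' => //.
  by rewrite mem_filter ov.
apply/flatten_mapP; case: gh Hs => [[-> hG]|[-> gG]] Hs.
  by exists h => //; rewrite mem_cat Hs.
by exists g => //; rewrite mem_cat Hs orbT.
Qed.

Lemma wfS_step S : wfS S -> wfS (buch_step c S).
Proof.
case: S => [G [|q Q]] [HG HQ]; first by [].
rewrite /buch_step /=; have wq := HQ q (mem_head _ _).
have HQ' q' : q' \in Q -> wf q' by move=> q'Q; apply: HQ; rewrite inE q'Q orbT.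
case: ifP => [//|/negbT lq]; case: ifP => [_|/negbT red] /=; last first.
  split=> //= q'; rewrite inE => /predU1P[->|/HQ'//].
  have [gG Hf] := reducers_head red; have [wg lg] := HG _ gG.
  by case: (reduce1P wq wg lq lg Hf).
have HG' : wfG (q :: G) by move=> g; rewrite inE => /predU1P[->|/HG].
split=> //= q'; rewrite mem_cat => /orP[|/HQ'//].
case/all_spolysP=> g [h [f [f' [gh Hf Hf' ov ->]]]].
have [gG hG] : g \in q :: G /\ h \in q :: G.
  by case: gh => -[-> ->]; rewrite inE eqxx.
by have [wg lg] := HG' _ gG; have [wh lh] := HG' _ hG; case: (spolyP wg wh lg lh Hf Hf' ov).
Qed.

(** If the head of the queue is zero or joins the basis, whatever waited for it becomes represented.
    If it is reduced, the result takes its place and the subtracted multiple joins the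
    representation: the lead of that multiple is the lead of the old head, hence within [bd]. *)
Lemma res_step S bd (x : V) : wfS S -> down_closed bd -> res S.1 S.2 bd x ->
  res (buch_step c S).1 (buch_step c S).2 bd x.
Proof.
case: S => [G [|q Q]] [HG HQ] dbd; first by [].
rewrite /buch_step /= => Hx; have wq := HQ q (mem_head _ _).
case: ifP => [lq|/negbT lq] /=.
  case: Hx => [|[q' []]]; first by left.
  rewrite inE => /predU1P[->|q'Q] Hr Hb; last by right; exists q'.
  by left; move: Hr; rewrite leads_nil ?subr0 //; apply/nilP.
case: ifP => [_|/negbT red] /=.
  have sub : {subset G <= q :: G} by move=> g gG; rewrite inE gG orbT.
  case: Hx => [Hx|[q' []]]; first by left; apply: rep_gens_sub sub Hx.
  rewrite inE => /predU1P[->|q'Q] Hr Hb; last first.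
    right; exists q'; rewrite mem_cat q'Q orbT; split=> //.
    exact: rep_gens_sub sub Hr.
  left; rewrite -[x](subrK (sem q)); apply: rep_add.
    exact: rep_gens_sub sub Hr.
  apply: rep_gen; first exact: mem_head.
  by apply: Hb; have [_ []] := leadP lq.
have [gG Hf] := reducers_head red; have [wg lg] := HG _ gG.
set y := reduce1 _ _ _; have [_ [t [tL yE ylt]]] := reduce1P wq wg lq lg Hf.
case: Hx => [Hx|[q' []]]; first by left.
rewrite inE => /predU1P[->|q'Q] Hr Hb; last by right; exists q'; rewrite inE q'Q orbT.
right; exists y; rewrite mem_head; split=> //; last first.
  move=> m /ylt my; apply: dbd my _; apply: Hb.
  by have [_ []] := leadP lq.
rewrite yE opprD addrA -scaleNr opprK; apply: RepS Hr _ _; first by eexists; [exact: gG|].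
by rewrite tL; apply: Hb; have [_ []] := leadP lq.
Qed.

(** The invariant of the main loop; for an empty queue it is the finite form of Buchberger's
    criterion. *)
Definition spoly_obl G Q : Prop := forall g h f f', g \in G -> h \in G ->
  f \in incs (wd g) (wd g + wd h)%N -> f' \in incs (wd h) (wd g + wd h)%N ->
  overlap c g h f f' -> res G Q (ltM^~ (spbd g h f f')) (sem (spoly g h f f')).

Lemma down_closed_lt m : down_closed (ltM^~ m).
Proof. by move=> n p; apply: ltM_trans. Qed.

Lemma spoly_obl_step S : wfS S -> spoly_obl S.1 S.2 ->
  spoly_obl (buch_step c S).1 (buch_step c S).2.
Proof.
move=> HS HO g h f f' gG hG Hf Hf' ov.
have [gh|gh] := pselect (g \in S.1 /\ h \in S.1).
  by apply: res_step => //; [apply: down_closed_lt | apply: HO; case: gh].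
have := wfS_step HS; case: S HS HO gG hG gh => [G [|q Q]] HS HO; first by move=> gG hG [].
rewrite /buch_step /=; case: ifP => [_ gG hG []//|/negbT lq].
case: ifP => [_ /=|_ gG hG []//].
rewrite !inE => gG hG ngh [/= HG _].
have gh : (g = q /\ h \in q :: G) \/ (h = q /\ g \in q :: G).
  rewrite !inE; case/predU1P: gG => [->|gG]; first by left.
  by case/predU1P: hG => [->|hG]; [right; rewrite gG orbT | case: ngh].
have [gG' hG'] : g \in q :: G /\ h \in q :: G by rewrite !inE.
right; exists (spoly g h f f'); rewrite mem_cat mem_all_spolys //; split=> //.
  by rewrite subrr; apply: Rep0.
have [wg lg] := HG _ gG'; have [wh lh] := HG _ hG'.
by have [_ [s [t []]]] := spolyP wg wh lg lh Hf Hf' ov.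
Qed.

End Buchberger.

(** * Termination of Buchberger's algorithm *)

Section Termination.
Context (K : fieldType) (c : nat) (d : seq nat).
Implicit Types (q g h x : relt K) (G Q : seq (relt K)).
Local Notation V := {malg K[mono]}.
Local Notation act := (@op_act c).
Local Notation wf q := (wfq c d q).

Definition extends (G' G : seq (relt K)) : Prop := exists x,
  [/\ G' = x :: G, wf x, ~~ nilp (leads x) & nilp (reducers G x)].

(** In an infinite chain of extensions, [wqo_mono] yields a lead that is mapped to a divisor of a
    later lead by an increasing map on the columns of its whole element. The earlier element would
    then have been a reducer of the later one. *)
Lemma extends_wf : well_founded extends.
Proof.
apply: wf_no_descent => f /choice[x Hx].
have mem i j : (i < j)%N -> x i \in f j.
  elim: j => // j IH; rewrite ltnS leq_eqVlt; have [-> _ _ _] := Hx j.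
  by rewrite inE => /predU1P[->|/IH ->]; rewrite ?eqxx ?orbT.
have [n|i [j [ij /= tE [F HF Hle]]]] :=
    @wqo_mono (size d) (maxrow c d) (fun n => (rmono_of (lead (x n)), wd (x n))).
  have [_ wx lx _] := Hx n; split; first exact/wfr_ok/wfr_lead.
  by move=> v vx; apply: colbound_cm; apply: leq_trans (lead_wdl lx) vx.
have [_ wi li _] := Hx i; have [_ wj lj red] := Hx j.
have Hd : F \in divs (x i) (x j).
  rewrite mem_filter HF tE eqxx andbT /=; apply/sublP => u.
  have [/mapP[v vl ->]|/cnt0 -> //] := boolP (u \in mapl F (lead (x i)).2).
  have := Hle v; rewrite /= !cm_cnt; apply: leq_trans.
  have FE w : w \in (lead (x i)).2 -> nth 0%N F w.2 = inc_ext F w.2.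
    by move=> /wdlP Hw; apply: incs_ext HF _; apply: leq_trans Hw (lead_wdl li).
  rewrite (FE v vl) -[(_, _)]/(colmap (inc_ext F) v).
  have -> : mapl F (lead (x i)).2 = map (colmap (inc_ext F)) (lead (x i)).2.
    by apply/eq_in_map => w /FE E; rewrite /colmap E.
  by rewrite cnt_map //; apply/colmap_inj/incr_inj/(incs_incr HF).
have : (x i, F) \in reducers (f j) (x j).
  by apply/flatten_mapP; exists (x i); [exact: mem | apply/mapP; exists F].
by rewrite (nilP red).
Qed.

Definition terminates S : Prop := exists n, nilp (iter n (@buch_step K c) S).2.

Lemma terminates_step S : terminates (buch_step c S) -> terminates S.
Proof. by move=> [n Hn]; exists n.+1; rewrite iterSr. Qed.

(** Nested inductions on the basis, the queue and the lead of the head of the queue. The basis comes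
    outermost because extending it may lengthen the queue. *)
Lemma buch_terminates S : wfS c d S -> terminates S.
Proof.
case: S => G Q; elim/(well_founded_ind extends_wf): G Q => G IHG.
elim=> [|q Q IHQ] [/= HG HQ]; first by exists 0%N.
have HQ' q' : q' \in Q -> wf q' by move=> q'Q; apply: HQ; rewrite inE q'Q orbT.
have {IHQ} IHQ : terminates (G, Q) by apply: IHQ.
have wq : wf q by apply: HQ; apply: mem_head.
suff: forall m x, rmono_of (lead x) = m -> wf x -> terminates (G, x :: Q) by apply.
move=> {q HQ wq}; elim/(well_founded_ind (ltM_wf (size d) (maxrow c d))) => m IHm q mE wq.
have HS : wfS c d (G, q :: Q).
  by split=> // q'; rewrite inE => /predU1P[->|/HQ'].
apply: terminates_step; have := wfS_step HS; rewrite /buch_step /=.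
case: ifP => [//|/negbT lq]; case: ifP => [red HS'|/negbT red _].
  by apply: IHG HS'; exists q.
have [gG Hf] := reducers_head red; have [wg lg] := HG _ gG.
set y := reduce1 _ _ _; have [wy [t [_ _ ylt]]] := reduce1P wq wg lq lg Hf.
have [ly|ly] := boolP (nilp (leads y)).
  by apply: terminates_step; rewrite /buch_step /= -/y ly.
apply: (IHm (rmono_of (lead y)) _ y) => //; split; first exact/wfr_ok/wfr_lead.
by rewrite -mE; apply: ylt; have [_ []] := leadP ly.
Qed.

End Termination.

(** * Factorization of pairs of operators through finitely many *)

Section Lifting.
Context (K : fieldType) (c : nat).
Implicit Types (g h : relt K).
Local Notation act := (@op_act c).

Lemma lift_oper (s u : oper c) (l : seq letter) (f : nat -> nat) q :
  cm (op_m s) = cm (op_m u ++ map (colmap (op_f u)) l) ->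
  (forall j, (j < wd q)%N -> op_f s j = op_f u (f j)) ->
  lin (act s) (sem q : {malg K[mono]}) = lin (act u) (lin (mact l f) (sem q)).
Proof.
move=> Em Ef; rewrite lin_comp; apply: eq_lin => -[i m] Hm.
rewrite /op_act /mact /= Em cm_cat cmapM cmap_cm cmap_comp cmon_mulA.
congr (_, mmul _ _); apply: eq_cmap => v mv; apply: Ef.
rewrite ltnNge; apply/negP => qv; move: mv.
by rewrite (sem_colbound Hm qv).
Qed.

(* Both operators factor through a common one: relabel the columns that they
   reach on the columns of [g] and [h] increasingly by 0, ..., wd g + wd h - 1
   and divide by the common part of their monomials. *)
Lemma common_factor g h (s t : oper c) : ~~ nilp (leads g) -> ~~ nilp (leads h) ->
  act s (rmono_of (lead g)) = act t (rmono_of (lead h)) ->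
  exists f f' (u : oper c),
  [/\ f \in incs (wd g) (wd g + wd h)%N, f' \in incs (wd h) (wd g + wd h)%N,
      overlap c g h f f',
      lin (act s) (sem g) = lin (act u)
        (lin (mact (diffl (mapl f' (lead h).2) (mapl f (lead g).2)) (inc_ext f)) (sem g)) &
      lin (act t) (sem h) = lin (act u)
        (lin (mact (diffl (mapl f (lead g).2) (mapl f' (lead h).2)) (inc_ext f')) (sem h))]
  /\ act s (rmono_of (lead g)) = act u (spbd g h f f').
Proof.
move=> lg lh [tE mE].
pose rg := [seq op_f s j | j <- iota 0 (wd g)].
pose rh := [seq op_f t j | j <- iota 0 (wd h)].
(* As an increasing map, [E] becomes the column part of [u]; the positions in [E] of the images of
   the columns give [f] and [f']. *)
pose E := sort leq (undup (rg ++ rh)).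
have ltE : sorted ltn E by rewrite ltn_sorted_uniq_leq sort_uniq undup_uniq sort_sorted //; exact: leq_total.
have memE x : (x \in E) = (x \in rg ++ rh) by rewrite mem_sort mem_undup.
have szE : (size E <= wd g + wd h)%N.
  by rewrite size_sort (leq_trans (size_undup _)) // size_cat !size_map !size_iota.
have IE : incrb E.
  by apply/incrbP => i iE; apply: (sorted_ltn_nth ltn_trans) => //; rewrite inE // ltnW.
have idx (F : nat -> nat) w : (forall i j, (i < j)%N -> (F i < F j)%N) ->
    (forall j, (j < w)%N -> F j \in E) ->
    [seq index (F j) E | j <- iota 0 w] \in incs w (wd g + wd h)%N /\
    forall j, (j < w)%N ->
      inc_ext E (inc_ext [seq index (F j) E | j <- iota 0 w] j) = F j.
  move=> FI FE; set L := map _ _.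
  have sL : size L = w by rewrite size_map size_iota.
  have nL j : (j < w)%N -> nth 0%N L j = index (F j) E.
    by move=> jw; rewrite (nth_map 0%N) ?size_iota // nth_iota.
  split; last first.
    move=> j jw; rewrite [inc_ext L j]/inc_ext sL jw nL //.
    by rewrite /inc_ext index_mem FE // nth_index // FE.
  rewrite incs_mem sL eqxx; apply/and3P; split=> //.
    apply/incrbP => i; rewrite sL => iw; rewrite !nL ?(ltnW iw) //.
    rewrite ltnNge; apply/negP => le.
    have := FI i i.+1 (ltnSn _); rewrite ltnNge => /negP; apply.
    rewrite -(nth_index 0%N (FE _ iw)) -(nth_index 0%N (FE _ (ltnW iw))).
    move: le; rewrite leq_eqVlt => /predU1P[->//|lt].
    by apply/ltnW/incrb_ltn => //; rewrite index_mem FE // ltnW.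
  apply/(all_nthP 0%N) => j; rewrite sL => jw; rewrite nL //.
  by apply: leq_trans szE; rewrite index_mem FE.
have Eg j : (j < wd g)%N -> op_f s j \in E.
  by move=> jg; rewrite memE mem_cat map_f // mem_iota.
have Eh j : (j < wd h)%N -> op_f t j \in E.
  by move=> jh; rewrite memE mem_cat orbC map_f // mem_iota.
have [Hf ff] := idx _ _ (@op_incr _ s) Eg.
have [Hf' ff'] := idx _ _ (@op_incr _ t) Eh.
set f := map _ (iota 0 (wd g)) in Hf ff; set f' := map _ (iota 0 (wd h)) in Hf' ff'.
pose U := colmap (inc_ext E).
have UI : injective U by apply/colmap_inj/incr_inj/inc_ext_incr.
pose A := mapl f (lead g).2; pose B := mapl f' (lead h).2.
have mapE w0 (F : nat -> nat) q (L : seq nat) : ~~ nilp (leads q) -> L \in incs (wd q) w0 ->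
    (forall j, (j < wd q)%N -> inc_ext E (inc_ext L j) = F j) ->
    map U (mapl L (lead q).2) = map (colmap F) (lead q).2.
  move=> lq HL HF; rewrite -map_comp; apply/eq_in_map => v /wdlP vq.
  have vq' : (v.2 < wd q)%N := leq_trans vq (lead_wdl lq).
  by rewrite /U /colmap /= (incs_ext HL) // HF.
have UA : map U A = map (colmap (op_f s)) (lead g).2 by apply: mapE Hf ff.
have UB : map U B = map (colmap (op_f t)) (lead h).2 by apply: mapE Hf' ff'.
have cntE v : (cnt v (op_m s) + cnt v (map U A) = cnt v (op_m t) + cnt v (map U B))%N.
  by rewrite UA UB -!cnt_cat -!cm_cnt !cm_cat -!cmap_cm mE.
(* Counts are compared through [U] on its image only; outside the image, all multisets transported
   by [U] have count zero. *)
have cntU v : (exists2 w, v = U w & True) \/ forall l, cnt v (map U l) = 0%N.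
  have [[w ->]|H] := pselect (exists w, v = U w); first by left; exists w.
  by right=> l; apply: cnt0; apply/mapP => -[w _ E']; apply: H; exists w.
(* By [cntE] the monomial of [s] is a multiple of the image of [diffl B A]. The quotient is also the
   one obtained from [t] and [diffl A B]. *)
pose m2 := diffl (op_m s) (map U (diffl B A)).
have r2 : rows_lt c m2.
  apply/allP => v; rewrite -cnt_gt0 cnt_diffl => Hv; apply: (allP (op_rows s)).
  by rewrite -cnt_gt0; lia.
pose u := Oper r2 (inc_ext_incr IE).
have Es v : cnt v (op_m s) = (cnt v m2 + cnt v (map U (diffl B A)))%N.
  rewrite cnt_diffl; case: (cntU v) => [[w -> _]|->]; last by rewrite addn0 subn0.
  have := cntE (U w); rewrite !cnt_map // !cnt_diffl; lia.
have Et v : cnt v (op_m t) = (cnt v m2 + cnt v (map U (diffl A B)))%N.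
  have := cntE v; rewrite Es; case: (cntU v) => [[w -> _]|H]; last by rewrite !H; lia.
  rewrite !cnt_map // !cnt_diffl; lia.
have rs : rows_lt c (diffl B A).
  apply/allP => v vd; apply: (allP (op_rows s) (U v)).
  by rewrite -cnt_gt0 Es cnt_map // ltn_addl // cnt_gt0.
have rt : rows_lt c (diffl A B).
  apply/allP => v vd; apply: (allP (op_rows t) (U v)).
  by rewrite -cnt_gt0 Et cnt_map // ltn_addl // cnt_gt0.
exists f, f', u; split; first split.
- exact: Hf.
- exact: Hf'.
- by apply/and3P; split; [apply/eqP | exact: rs | exact: rt].
- by apply: lift_oper => [|j jg]; [apply: eq_cm => v; rewrite cnt_cat Es | exact: (esym (ff j jg))].
- by apply: lift_oper => [|j jg]; [apply: eq_cm => v; rewrite cnt_cat Et | exact: (esym (ff' j jg))].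
rewrite /op_act /spbd /rmono_of /=; congr (_, _).
rewrite !cmap_cm -!cm_cat map_cat -/U -UA; apply: eq_cm => v.
by rewrite !cnt_cat Es !addnA.
Qed.

End Lifting.

(** * Correctness of Buchberger's algorithm *)

Section Result.
Context (K : fieldType) (c : nat) (d : seq nat).
Implicit Types (q g h x : relt K) (G Q B : seq (relt K)).
Local Notation V := {malg K[mono]}.
Local Notation act := (@op_act c).
Local Notation wf q := (wfq c d q).

(** The difference for [s] and [t] is the image under the common operator [u] of one of the listed
    S-polynomials, and [u] carries the bounded representation of the latter along. *)
Lemma spoly_obl_buchberger G : wfG c d G -> spoly_obl c G [::] ->
  buchberger ltM act (gens G : V -> mono -> Prop).
Proof.
move=> HG HO _ _ _ _ s t [g gG [-> ->]] [h hG [-> ->]] st.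
have [wg lg] := HG _ gG; have [wh lh] := HG _ hG.
have [f [f' [u [[Hf Hf' ov Es Et] ->]]]] := common_factor lg lh st.
have [_ [s0 [t0 [[sm sf tm tf] _ E _]]]] := spolyP wg wh lg lh Hf Hf' ov.
rewrite !mcoeff_sem -/(lcoef g) -/(lcoef h) Es Et -sm -sf -tm -tf -!op_actE.
rewrite -[lcoef h *: _]linZ -[lcoef g *: _]linZ -linN -linD -E.
apply: (rep_lin (@op_act_mul c) (bd := ltM^~ (spbd g h f f'))) => [m|].
  exact: op_act_lt.
by case: (HO g h f f' gG hG Hf Hf' ov) => [H|[q []]]; [exact: H|].
Qed.

(** Used for the graph of a morphism: what the algorithm computes from elements of the graph stays
    in the graph. *)
Definition oper_closed (U : V -> Prop) : Prop :=
  U 0 /\ forall (x : V) k (t : oper c) (y : V), U x -> U y -> U (x + k *: lin (act t) y).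

Lemma closed_step (U : V -> Prop) S : oper_closed U -> wfS c d S ->
  (forall q, q \in S.1 ++ S.2 -> U (sem q)) ->
  forall q, q \in (buch_step c S).1 ++ (buch_step c S).2 -> U (sem q).
Proof.
case: S => [G [|q Q]] [U0 UD] [HG HQ] HU; first by [].
have UG g : g \in G -> U (sem g) by move=> gG; apply: HU; rewrite mem_cat gG.
have UQ x : x \in Q -> U (sem x) by move=> xQ; apply: HU; rewrite mem_cat inE xQ !orbT.
have Uq : U (sem q) by apply: HU; rewrite mem_cat inE eqxx orbT.
have wq := HQ q (mem_head _ _).
rewrite /buch_step /=; case: ifP => [_ x|/negbT lq].
  by rewrite mem_cat => /orP[/UG|/UQ].
case: ifP => [_ /= x|/negbT red /= x].
  rewrite inE mem_cat => /predU1P[->//|/orP[/UG//|]].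
  rewrite [x \in _]mem_cat => /orP[|/UQ//].
  have HG' g : g \in q :: G -> [/\ wf g, ~~ nilp (leads g) & U (sem g)].
    by rewrite inE => /predU1P[->|gG]; [split | have [] := HG _ gG; split=> //; apply: UG].
  case/all_spolysP=> g [h [f [f' [gh Hf Hf' ov ->]]]].
  have [gG hG] : g \in q :: G /\ h \in q :: G by case: gh => -[-> ->]; rewrite inE eqxx.
  have [wg lg Ug] := HG' _ gG; have [wh lh Uh] := HG' _ hG.
  have [_ [s [t [_ _ -> _]]]] := spolyP wg wh lg lh Hf Hf' ov.
  by rewrite -scaleNr; apply: (UD) => //; rewrite -[_ *: _]add0r; apply: UD.
have [gG Hf] := reducers_head red; have [wg lg] := HG _ gG.
rewrite mem_cat => /orP[/UG//|]; rewrite inE => /predU1P[->|/UQ//].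
have [_ [t [_ -> _]]] := reduce1P wq wg lq lg Hf.
by apply: UD => //; apply: UG.
Qed.

Theorem buch_correct B : (forall b, b \in B -> wf b) -> exists n,
  let S := iter n (@buch_step K c) ([::], B) in
  [/\ nilp S.2 /\ forall k, (k < n)%N -> ~~ nilp (iter k (@buch_step K c) ([::], B)).2,
      wfG c d S.1,
      buchberger ltM act (gens S.1 : V -> mono -> Prop),
      forall b, b \in B -> rep act (gens S.1) (fun=> True) (sem b) &
      forall U, oper_closed U -> (forall b, b \in B -> U (sem b)) ->
        forall g, g \in S.1 -> U (sem g)].
Proof.
move=> wB; have HS0 : wfS c d ([::], B) by split.
have inv n : let S := iter n (@buch_step K c) ([::], B) in
    [/\ wfS c d S, spoly_obl c S.1 S.2,
        forall b, b \in B -> res c S.1 S.2 (fun=> True) (sem b) &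
        forall U, oper_closed U -> (forall b, b \in B -> U (sem b)) ->
          forall g, g \in S.1 ++ S.2 -> U (sem g)].
  elim: n => [|n [IH1 IH2 IH3 IH4]].
    split=> // b bB; right; exists b; split=> //.
    by rewrite subrr; apply: Rep0.
  rewrite iterS; split.
  - exact: wfS_step.
  - exact: spoly_obl_step IH1 IH2.
  - by move=> b /IH3; apply: res_step IH1 _.
  by move=> U HU UB; apply: closed_step => //; apply: IH4.
have ex : exists n, nilp (iter n (@buch_step K c) ([::], B)).2 by apply: buch_terminates HS0.
(* The least such [n], so that the loop condition holds in all earlier states. *)
case: (ex_minnP ex) => n Hn min; exists n; have [[HG _] HO HB HU] := inv n.
split=> //.
- by split=> // k kn; apply/negP => /min; rewrite leqNgt kn.
- by apply: spoly_obl_buchberger; [exact: HG | move: HO; rewrite (nilP Hn)].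
- move=> b bB; case: (HB b bB) => [H|[q []]]; first exact: H.
  by rewrite (nilP Hn).
by move=> U U1 U2 g gS; apply: (HU U) => //; rewrite mem_cat gS.
Qed.

End Result.

(** * Morphisms out of free Sym-modules *)

Lemma sym_eq (s t : Sym) : s =1 t -> s = t.
Proof.
case: s t => [f bf ff] [g bg fg] /= E; have {}E : f = g by apply: funext.
by subst g; congr MkSym; apply: Prop_irrelevance.
Qed.

Lemma sym_inv (s : Sym) : exists t : Sym, symM t s = sym1 /\ symM s t = sym1.
Proof.
have [g sK gK] := sym_bij s.
have gf : exists l : seq nat, forall j, g j != j -> j \in l.
  have [l Hl] := sym_fin s; exists l => j gj; apply: Hl; apply: contra gj => /eqP E.
  by rewrite -{1}E sK.
by exists (MkSym (Bijective gK sK) gf); split; apply: sym_eq => j /=; rewrite ?sK ?gK.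
Qed.

Definition swap_fun (a b j : nat) : nat :=
  if j == a then b else if j == b then a else j.

Lemma swap_funK a b : involutive (swap_fun a b).
Proof. by move=> j; rewrite /swap_fun; do ! case: eqP => //; congruence. Qed.

Lemma swap_fin a b : exists l : seq nat, forall j, swap_fun a b j != j -> j \in l.
Proof.
exists [:: a; b] => j; rewrite /swap_fun !inE.
by case: (j == a) => //; case: (j == b) => //; rewrite eqxx.
Qed.

Definition swap (a b : nat) : Sym := MkSym (inv_bij (swap_funK a b)) (swap_fin a b).

(** Composing with the transposition of [s n] and [f n] corrects the value at [n] and, by
    injectivity, leaves the earlier values alone. This is how an increasing map is replaced by an
    element of [Sym] on finitely many columns. *)
Lemma sym_extend n (f : nat -> nat) :
  (forall i j, (i < n)%N -> (j < n)%N -> f i = f j -> i = j) ->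
  exists s : Sym, forall j, (j < n)%N -> s j = f j.
Proof.
elim: n => [|n IH] fI; first by exists sym1.
have [|s Hs] := IH; first by move=> i j iN jN; apply: fI; apply: leqW.
exists (symM (swap (s n) (f n)) s) => j; rewrite ltnS leq_eqVlt.
case/predU1P=> [->|jn]; rewrite /= /swap_fun; first by rewrite eqxx.
case: eqP => [/(bij_inj (sym_bij s)) E|_]; first by rewrite E ltnn in jn.
case: eqP => [|_]; last exact: Hs.
rewrite Hs // => /fI E; have {}E := E (leqW jn) (ltnSn n).
by rewrite E ltnn in jn.
Qed.

Section FreeLift.
Context (K : fieldType) (c : nat) (d : seq nat) (N : symModule K c).
Local Notation F := (free_module K c d).

Lemma act_basis_gen (e : free_basis d) (s : Sym) :
  (forall j : 'I_(nth 0%N d (tag e)), s j = val (tagged e) j) ->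
  e = act_basis s (Tagged (fun i : 'I_(size d) => inj_maps (nth 0%N d i))
                     (incl_inj (nth 0%N d (tag e)))).
Proof.
case: e => i p /= H; rewrite /act_basis /=; congr (Tagged _ _).
by apply/val_inj/ffunP => j; rewrite !ffunE H.
Qed.

Lemma basis_sym (e : free_basis d) : exists s : Sym,
  forall j : 'I_(nth 0%N d (tag e)), s j = val (tagged e) j.
Proof.
case: e => i [f /= fI]; pose n := nth 0%N d i.
pose g j := if insub j is Some k then f k else 0%N.
have gE (k : 'I_n) : g k = f k by rewrite /g valK.
have [j k jn kn|s Hs] := @sym_extend n g.
  rewrite -[j]/(val (Ordinal jn)) -[k]/(val (Ordinal kn)) !gE.
  by move/(injectiveP _ fI) => ->.
by exists s => j; rewrite Hs // gE.
Qed.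

Lemma free_ind (P : F -> Prop) : symSubmodule P -> (forall i, P (free_gen K c i)) ->
  forall x, P x.
Proof.
move=> [P0 PD PZ PA] Pg x; rewrite [x]monalgE.
elim/big_ind: _ => // e _; have [s Hs] := basis_sym e.
have -> : << x@_e *g e >> = x@_e *: (<< e >> : {malg _[_]}) by rewrite malgZU mulr1.
apply: PZ; rewrite (act_basis_gen Hs).
by have := PA s _ (Pg (tag e)); rewrite /= free_actU rmorph1.
Qed.

Section Lift.
Context (b : free_basis d -> N).

Definition free_lift (q : F) : N := \sum_(e <- msupp q) q@_e *: b e.

Lemma free_liftEw (D : {fset free_basis d}) q : (msupp q `<=` D)%fset ->
  free_lift q = \sum_(e <- D) q@_e *: b e.
Proof.
move=> le; rewrite [LHS](big_fset_incl _ le) => //= x xd /mcoeff_outdom ->.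
by rewrite scale0r.
Qed.

Lemma free_lift_is_linear : linear free_lift.
Proof.
move=> a q1 q2.
pose D := (msupp q1 `|` msupp q2 `|` msupp (a *: q1 + q2))%fset.
rewrite (@free_liftEw D) ?fsubsetUr // (@free_liftEw D) ?(fsubset_trans (fsubsetUl _ _) (fsubsetUl _ _)) //.
rewrite (@free_liftEw D q2) ?(fsubset_trans (fsubsetUr _ _) (fsubsetUl _ _)) //.
rewrite scaler_sumr -big_split; apply: eq_bigr => e _.
by rewrite mcoeffD mcoeffZ scalerDl scalerA.
Qed.

HB.instance Definition _ :=
  GRing.isLinear.Build (Defs.polyP K c) F N _ free_lift free_lift_is_linear.

Lemma free_liftU a e : free_lift << a *g e >> = a *: b e.
Proof. by rewrite (free_liftEw msuppU_le) big_seq_fset1 mcoeffUU. Qed.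

Lemma free_lift_act : (forall s e, b (act_basis s e) = sm_act s (b e)) ->
  forall s q, free_lift (sm_act s q) = sm_act s (free_lift q).
Proof.
move=> Hb s q; have act0 : sm_act s (0 : N) = 0.
  by apply: (@addrI _ (sm_act s 0)); rewrite -sm_actD !addr0.
rewrite /= /free_act linear_sum /= /free_lift (big_morph _ (sm_actD s) act0).
by apply: eq_bigr => e _; rewrite -/(free_lift _) free_liftU Hb sm_actZ.
Qed.

End Lift.

(** The basis element of pi is sent to the translate of [x i] by a permutation extending pi. Two
    extensions differ by a permutation that fixes the first d_i columns, so by assumption the choice
    does not matter and the map is equivariant. *)
Lemma free_hom (x : 'I_(size d) -> N) :
  (forall (i : 'I_(size d)) (s : Sym), (forall j, (j < nth 0%N d i)%N -> s j = j) -> sm_act s (x i) = x i) ->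
  exists phi : symHom F N, forall i, phi (free_gen K c i) = x i.
Proof.
move=> Hx; have [sg Hsg] := choice basis_sym.
have agree (i : 'I_(size d)) (s t : Sym) : (forall j, (j < nth 0%N d i)%N -> s j = t j) ->
    sm_act s (x i) = sm_act t (x i).
  move=> st; have [t' [t't tt']] := sym_inv t.
  have -> : s = symM t (symM t' s).
    by apply: sym_eq => j; have := congr1 (fun u : Sym => u (s j)) tt'.
  rewrite sm_actM; congr (sm_act t _); apply: Hx => j jn /=; rewrite st //.
  by have := congr1 (fun u : Sym => u j) t't.
pose b e := sm_act (sg e) (x (tag e)).
have Hb s e : b (act_basis s e) = sm_act s (b e).
  rewrite /b -sm_actM /=; apply: agree => j jn.
  have := Hsg (act_basis s e) (Ordinal jn); rewrite /= ffunE => ->.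
  by have := Hsg e (Ordinal jn) => /= ->.
exists (SymHom (sh_fun := free_lift b) (free_lift_act Hb)) => i.
rewrite /= free_liftU scale1r /b /=.
rewrite -[RHS]sm_act1; apply: agree => j jn.
by have := Hsg (Tagged (fun i : 'I_(size d) => inj_maps (nth 0%N d i)) (incl_inj (nth 0%N d i)))
  (Ordinal jn); rewrite /= ffunE => ->.
Qed.

End FreeLift.

(** * Free modules inside the vector space of letter multisets *)

Notation rpoly K := (seq (K * seq letter)).
Notation rtelt K := (seq (rpoly K * (nat * seq nat))).

Definition markers (c : nat) (l : seq nat) : seq letter :=
  [seq ((c + k)%N, nth 0%N l k) | k <- iota 0 (size l)].

(** The offset [o] puts the indices of F_0 behind those of F_1 in the direct sum. *)
Definition flat (K : fieldType) (c o : nat) (q : rtelt K) : relt K :=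
  flatten [seq [seq (u.1, ((o + t.2.1)%N, u.2 ++ markers c t.2.2)) | u <- t.1] | t <- q].

Section Link.
Context (K : fieldType) (c : nat).
Local Notation P := (Defs.polyP K c).
Local Notation V := {malg K[mono]}.
Local Notation pmon := {cmonom ('I_c * nat)%type}.

Definition emb_var (v : 'I_c * nat) : letter := (nat_of_ord v.1, v.2).

Lemma emb_var_inj : injective emb_var.
Proof. by move=> [i j] [i' j'] [/val_inj -> ->]. Qed.

Definition cemb (m : pmon) : cmon := cm (map emb_var (letters_of m)).

Lemma cemb_cm l : cemb (cm l) = cm (map emb_var l).
Proof.
by apply: eq_cm => v; apply/cnt_perm/perm_map/cm_perm; rewrite letters_ofK.
Qed.

Lemma cembM m n : cemb (mmul m n) = mmul (cemb m) (cemb n).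
Proof.
by rewrite -[m]letters_ofK -[n]letters_ofK -cm_cat !cemb_cm map_cat cm_cat.
Qed.

Lemma cemb_var m v : cemb m (emb_var v) = m v.
Proof.
rewrite cm_cnt -[m in RHS]letters_ofK cm_count /cnt count_map.
by apply: eq_count => u; rewrite /= (inj_eq emb_var_inj).
Qed.

Lemma cemb_out m v : (c <= v.1)%N -> cemb m v = 0%N.
Proof.
move=> cv; rewrite cm_cnt cnt0 //; apply/mapP => -[u _ E].
by move: cv; rewrite E leqNgt ltn_ord.
Qed.

Lemma cemb_inj : injective cemb.
Proof. by move=> m n E; apply/eqP/cmP => v; rewrite -!cemb_var E. Qed.

Lemma rows_lt_emb l : rows_lt c (map emb_var l).
Proof. by rewrite /rows_lt all_map; apply/allP => v _ /=. Qed.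

Lemma rows_lt_letters l : rows_lt c l -> exists l', l = map emb_var l'.
Proof.
elim: l => [|v l IH] /=; first by exists [::].
move=> /andP[vc /IH[l' ->]]; exists ((Ordinal vc, v.2) :: l').
by rewrite /= /emb_var /= -surjective_pairing.
Qed.

Lemma markers_mem l v : (v \in markers c l) ->
  exists2 k, (k < size l)%N & v = ((c + k)%N, nth 0%N l k).
Proof. by case/mapP=> k; rewrite mem_iota add0n /= => kl ->; exists k. Qed.

Lemma mem_markers l k : (k < size l)%N -> ((c + k)%N, nth 0%N l k) \in markers c l.
Proof. by move=> kl; apply/mapP; exists k => //; rewrite mem_iota. Qed.

Lemma markers_map (f : nat -> nat) l : markers c (map f l) = map (colmap f) (markers c l).
Proof.
rewrite /markers -map_comp size_map; apply/eq_in_map => k.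
by rewrite mem_iota add0n /= => kl; rewrite /colmap /= (nth_map 0%N).
Qed.

Lemma wfr_markers D i m l : (i < size D)%N -> nth 0%N D i = size l -> uniq l ->
  rows_lt c m -> wfr c D (i, m ++ markers c l).
Proof.
move=> iD Dl Ul Hm.
have out w : w \in m ++ markers c l -> (c <= w.1)%N -> w \in markers c l.
  by rewrite mem_cat => /orP[/(allP Hm) H|//]; rewrite leqNgt H.
split=> [//|r cr|u v] /=.
  rewrite rowcnt_cat (rowcnt_eq0 Hm) // Dl add0n /rowcnt count_map.
  rewrite (eq_count (a2 := pred1 (r - c)%N)) => [|k /=]; last first.
    by apply/eqP/eqP => /= H; lia.
  rewrite count_uniq_mem ?iota_uniq // mem_iota /=; congr nat_of_bool; lia.
move=> Hu Hv cu cv.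
have [k kl ->] := markers_mem (out u Hu cu).
have [k' kl' -> /= E] := markers_mem (out v Hv cv).
by rewrite (uniqP 0%N Ul k k' kl kl' E).
Qed.

Section OneModule.
Context (d : seq nat) (o : nat).
Local Notation F := (free_module K c d).
Implicit Types (x y : F) (e : free_basis d) (m : pmon).

Definition posn e : seq nat := [seq val (tagged e) j | j <- enum 'I_(nth 0%N d (tag e))].

Lemma size_posn e : size (posn e) = nth 0%N d (tag e).
Proof. by rewrite size_map size_enum_ord. Qed.

Lemma nth_posn e (k : 'I_(nth 0%N d (tag e))) : nth 0%N (posn e) k = val (tagged e) k.
Proof. by rewrite (nth_map k) ?size_enum_ord // nth_ord_enum. Qed.

Lemma posn_uniq e : uniq (posn e).
Proof.
by rewrite map_inj_uniq ?enum_uniq //; exact: (injectiveP _ (valP (tagged e))).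
Qed.

Lemma posn_act s e : posn (act_basis s e) = map s (posn e).
Proof. by rewrite /posn -map_comp; apply: eq_map => j /=; rewrite ffunE. Qed.

Lemma posn_inj e e' : tag e = tag e' -> posn e = posn e' -> e = e'.
Proof.
case: e e' => [i p] [i' p'] /= E; subst i' => H; congr (Tagged _ _).
apply/val_inj/ffunP => k.
have := nth_posn (e := Tagged _ p) k; rewrite H => /= <-.
exact: (nth_posn (e := Tagged _ p') k).
Qed.

Definition emb_mono e m : mono := ((o + tag e)%N, mmul (cemb m) (cm (markers c (posn e)))).

Lemma emb_injective e e' m m' : emb_mono e m = emb_mono e' m' -> e = e' /\ m = m'.
Proof.
move=> [/addnI/val_inj E Em].
have ee' : e = e'.
  apply: posn_inj => //; apply: (@eq_from_nth _ 0%N); first by rewrite !size_posn E.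
  (* Rows from [c] on contain markers only, so the marker of [e] in row [c + k] is also the one of
     [e']. *)
  move=> k kl; have H : (0 < (emb_mono e' m').2 ((c + k)%N, nth 0%N (posn e) k))%N.
    by rewrite /= -Em cmM ltn_addl // cm_cnt cnt_gt0 mem_markers.
  move: H; rewrite /= cmM cemb_out ?leq_addr // add0n cm_cnt cnt_gt0.
  by case/markers_mem => k' _ [/addnI -> ].
split=> //; apply: cemb_inj; subst e'.
by apply: (@cmon_mulI (cm (markers c (posn e)))); rewrite cmon_mulC [RHS]cmon_mulC.
Qed.

(** This embedding is only additive over K-linear pieces; [Psi_Z] and [Psi_act] turn multiplication
    by monomials and permutations into maps of the basis of [V]. *)
Definition Psi x : V := \sum_(e <- msupp x) lin (emb_mono e) x@_e.

Lemma PsiEw (D : {fset free_basis d}) x : (msupp x `<=` D)%fset ->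
  Psi x = \sum_(e <- D) lin (emb_mono e) x@_e.
Proof.
move=> le; rewrite [LHS](big_fset_incl _ le) => //= e _ /mcoeff_outdom ->.
exact: lin0.
Qed.

Lemma PsiD x y : Psi (x + y) = Psi x + Psi y.
Proof.
rewrite (PsiEw (msuppD_le x y)) (PsiEw (fsubsetUl (msupp x) (msupp y))).
rewrite (PsiEw (fsubsetUr (msupp x) (msupp y))) -big_split /=.
by apply: eq_bigr => e _; rewrite mcoeffD linD.
Qed.

Lemma Psi0 : Psi 0 = 0.
Proof. by rewrite /Psi msupp0 big_seq_fset0. Qed.

Lemma PsiU k m e : Psi << << k *g m >> *g e >> = << k *g emb_mono e m >>.
Proof. by rewrite (PsiEw msuppU_le) big_seq_fset1 mcoeffUU linU. Qed.

Lemma term_ind (Q : F -> Prop) : Q 0 -> (forall x y, Q x -> Q y -> Q (x + y)) ->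
  (forall k m e, Q << << k *g m >> *g e >>) -> forall x, Q x.
Proof.
move=> Q0 QD QU x; rewrite [x]monalgE; elim/big_ind: _ => // e _.
rewrite [x@_e]monalgE (big_morph (fun a => << a *g e >> : F)
  (fun a b => monalgUD e a b) (monalgU0 e)).
by elim/big_ind: _ => // m _; apply: QU.
Qed.

Lemma mcoeff_Psi x e m : (Psi x)@_(emb_mono e m) = (x@_e)@_m.
Proof.
elim/term_ind: x => [|x y IHx IHy|k m' e'].
- by rewrite Psi0 !mcoeff0.
- by rewrite PsiD !mcoeffD IHx IHy.
rewrite PsiU !mcoeffU; case: (eqVneq e' e) => [->|ne].
  rewrite mulr1n mcoeffU; case: (eqVneq m' m) => [->|nm]; first by rewrite eqxx.
  by case: eqP => // /emb_injective[_ E]; rewrite E eqxx in nm.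
rewrite mulr0n mcoeff0; case: eqP => // /emb_injective[E _].
by rewrite E eqxx in ne.
Qed.

Lemma Psi_supp x (a : mono) : (Psi x)@_a <> 0 -> exists e m, a = emb_mono e m.
Proof.
elim/term_ind: x => [|x y IHx IHy|k m' e'].
- by rewrite Psi0 mcoeff0.
- rewrite PsiD mcoeffD => H; have [/IHx//|/contrapT E] := pselect ((Psi x)@_a <> 0).
  by apply: IHy => E'; apply: H; rewrite E E' addr0.
by rewrite PsiU mcoeffU; case: eqP => [<- _|]; [exists e', m' | rewrite mulr0n].
Qed.

Lemma Psi_inj x y : Psi x = Psi y -> x = y.
Proof.
by move=> E; apply/malgP => e; apply/malgP => m; rewrite -!mcoeff_Psi E.
Qed.

Lemma Psi_Z k l x :
  Psi (<< k *g cm l >> *: x) = k *: lin (mact (map emb_var l) id) (Psi x).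
Proof.
elim/term_ind: x => [|x y IHx IHy|k' m' e'].
- by rewrite scaler0 Psi0 lin0 scaler0.
- rewrite [_ *: (x + y)]scalerDr; apply: etrans (PsiD _ _) _.
  apply: etrans (congr2 +%R IHx IHy) _; apply: etrans (esym (scalerDr _ _ _)) _.
  apply: (congr1 (fun z => k *: z)); apply: etrans (esym (linD _ _ _)) _.
  exact: (congr1 (lin _) (esym (PsiD x y))).
have E : mact (map emb_var l) id (emb_mono e' m') = emb_mono e' (mmul (cm l) m').
  rewrite /emb_mono /mact /= cembM cemb_cm -cmon_mulA; congr (_, mmul _ _).
  by rewrite -[RHS]letters_ofK /cmap (eq_map (g := id)) ?map_id // => -[].
have -> : << k *g cm l >> *: (<< << k' *g m' >> *g e' >> : F) =
    << << k * k' *g mmul (cm l) m' >> *g e' >> by rewrite malgZU malgUM.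
apply: etrans (PsiU _ _ _) _; apply/esym.
apply: etrans (congr1 (fun z => k *: lin _ z) (PsiU _ _ _)) _.
by rewrite linU malgZU E.
Qed.

Lemma varP_mul v m : varP K v * << m >> = << mmul (ucm v) m >> :> P.
Proof. by rewrite /varP malgUM (mulr1 (1 : K)). Qed.

Lemma prod_var (l : seq ('I_c * nat)) : \prod_(v <- l) varP K v = << cm l >> :> P.
Proof.
elim: l => [|v l IH]; first by rewrite /cm !big_nil.
rewrite big_cons IH varP_mul {IH}.
by have -> : cm (v :: l) = mmul (ucm v) (cm l) by rewrite /cm big_cons.
Qed.

Lemma actPU s k m : actP s << k *g m >> = << k *g cm (map (sym_var s) (letters_of m)) >> :> P.
Proof.
have E l : << k *g cm l >> = k *: \prod_(v <- l) varP K v :> P.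
  by rewrite prod_var malgZU mulr1.
rewrite -{1}[m]letters_ofK !E actPZ rmorph_prod big_map; apply: (congr1 ( *:%R k)).
by apply: eq_bigr => v _; rewrite -actPX.
Qed.

Lemma Psi_act s x : Psi (free_act s x) = lin (mact [::] s) (Psi x).
Proof.
elim/term_ind: x => [|x y IHx IHy|k m e].
- by rewrite free_act0 Psi0 lin0.
- rewrite free_actD; apply: etrans (PsiD _ _) _.
  apply: etrans (congr2 +%R IHx IHy) _; apply: etrans (esym (linD _ _ _)) _.
  exact: (congr1 (lin _) (esym (PsiD x y))).
have E : mact [::] s (emb_mono e m) =
    emb_mono (act_basis s e) (cm (map (sym_var s) (letters_of m))).
  rewrite /emb_mono /mact /= posn_act markers_map cemb_cm; congr (_, _).
  by rewrite cmapM !cmap_cm -!map_comp -!cm_cat.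
rewrite free_actU actPU; apply: etrans (PsiU _ _ _) _; apply/esym.
by apply: etrans (congr1 (lin _) (PsiU _ _ _)) _; rewrite linU E.
Qed.

Definition raw_poly (p : poly_repr K c) : rpoly K :=
  [seq (t.1, map emb_var t.2) | t <- p].

Definition raw_elt (q : elt_repr K c d) : rtelt K :=
  [seq (raw_poly t.1, (nat_of_ord (tag t.2), posn t.2)) | t <- q].

Lemma Psi_elt_of q : Psi (elt_of q) = sem (flat c o (raw_elt q)).
Proof.
elim: q => [|[p e] q IH]; first by rewrite /elt_of /sem !big_nil Psi0.
rewrite /flat /= sem_cat -/(flat _ _ _) -IH /elt_of big_cons PsiD; congr (_ + _).
elim: p => [|[k l] p IHp] /=.
  by rewrite /poly_of /sem !big_nil scale0r Psi0.
have -> : poly_of ((k, l) :: p) = << k *g cm l >> + poly_of p :> P.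
  by rewrite /poly_of big_cons prod_var malgZU mulr1.
have E : Psi (<< k *g cm l >> *: (<< e >> : F)) =
    << k *g rmono_of ((o + tag e)%N, map emb_var l ++ markers c (posn e)) >>.
  have -> : << k *g cm l >> *: (<< e >> : F) = << << k *g cm l >> *g e >>.
    by rewrite malgZU mulr1.
  by apply: etrans (PsiU _ _ _) _; rewrite /emb_mono /rmono_of /= cm_cat cemb_cm.
rewrite [_ *: _]scalerDl; apply: etrans (PsiD _ _) _.
apply: etrans (congr2 +%R E IHp) _; clear.
by rewrite /sem big_cons.
Qed.

Lemma wfq_flat (D : seq nat) (q : elt_repr K c d) :
  (forall i, (i < size d)%N -> (o + i < size D)%N /\ nth 0%N D (o + i)%N = nth 0%N d i) ->
  wfq c D (flat c o (raw_elt q)).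
Proof.
move=> HD t /flatten_mapP[u /mapP[[p e] _ ->] /mapP[w /mapP[[k l] _ ->] ->]] /=.
have [i1 i2] := HD (tag e) (ltn_ord _).
by apply: wfr_markers; rewrite ?size_posn ?posn_uniq ?rows_lt_emb.
Qed.

End OneModule.

End Link.

(** * Kernels by elimination *)

Section KernelAlgorithm.
Context (K : fieldType) (c : nat).
Implicit Types (B : seq (rtelt K)) (w : seq nat).

Definition widths B : seq nat := [seq wd (flat c 0 b) | b <- B].

Definition unit_elt (i n : nat) : relt K := [:: (1, (i, markers c (iota 0 n)))].

Definition graph_elt B (i : nat) : relt K :=
  unit_elt i (nth 0%N (widths B) i) ++ flat c (size B) (nth [::] B i).

(** Any injection of the columns of a generator is a permutation of them followed by an increasing
    map. With the permuted generators listed, operators suffice to reach all of the graph. *)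
Definition graph_gens B : seq (relt K) :=
  flatten [seq [seq scal 1 [::] p (graph_elt B i) | p <- perms (nth 0%N (widths B) i)]
          | i <- iota 0 (size B)].

(** The value pi(k) is read off the unique marker in row [c + k]. The filter matters since the list
    of an element of F_1 may still contain cancelling terms with an index of F_0. *)
Definition unflat w (g : relt K) : rtelt K :=
  [seq ([:: (t.1, [seq v <- t.2.2 | (v.1 < c)%N])],
        (t.2.1, [seq head 0%N [seq v.2 | v <- [seq v <- t.2.2 | v.1 == (c + k)%N]]
                | k <- iota 0 (nth 0%N w t.2.1)]))
  | t <- [seq t <- g | (t.2.1 < size w)%N]].

Definition kernel_gens w (G : seq (relt K)) : seq (rtelt K) :=
  [seq unflat w g | g <- [seq g <- G | ((lead g).1 < size w)%N]].

End KernelAlgorithm.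

Lemma cmap_id (m : cmon) : cmap id m = m.
Proof. by rewrite -[RHS]letters_ofK /cmap (eq_map (g := id)) ?map_id // => -[]. Qed.

Lemma mact_id (f : nat -> nat) (a : mono) :
  (forall v : letter, (0 < a.2 v)%N -> f v.2 = v.2) -> mact [::] f a = a.
Proof.
case: a => i m /= H; rewrite /mact /= (@eq_cmap f id) // cmap_id.
by congr (_, _); apply/eqP/cmP => v; rewrite cmM cm_cnt /cnt /= add0n.
Qed.

Lemma uniqbP l : reflect (uniq l) (uniqb l).
Proof.
apply: (iffP idP) => [/allP H|Ul].
  apply/(uniqP 0%N) => i j; rewrite !inE => il jl E.
  have := H i; rewrite mem_iota => /(_ il)/allP/(_ j); rewrite mem_iota => /(_ jl).
  by rewrite E eqxx orbF => /eqP.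
apply/allP => i; rewrite mem_iota add0n /= => il.
apply/allP => j; rewrite mem_iota add0n /= => jl.
by rewrite nth_uniq // orbN.
Qed.

Lemma perms_mem w p : (p \in perms w) = [&& uniq p, size p == w & all (fun j => (j < w)%N) p].
Proof. by rewrite mem_filter seqs_mem (sameP (uniqbP p) idP). Qed.

Lemma wd_flat_shift (K : fieldType) c o (q : rtelt K) : wd (flat c o q) = wd (flat c 0 q).
Proof.
elim: q => //= -[p e] q IH; rewrite /flat /=.
by elim: p => //= u p IHp; rewrite IHp.
Qed.

Lemma wd_cat (K : fieldType) (q r : relt K) : wd (q ++ r) = maxn (wd q) (wd r).
Proof. by elim: q => [|t q IH] /=; rewrite ?max0n // IH maxnA. Qed.

Lemma sem_cons (K : fieldType) (t : K * rmono) q :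
  sem (t :: q) = << t.1 *g rmono_of t.2 >> + sem q.
Proof. exact: big_cons. Qed.

Section Vectors.
Context (K : fieldType) (c : nat).
Local Notation V := {malg K[mono]}.
Local Notation act := (@op_act c).

Lemma column_bound (x : V) : exists N, forall (a : mono) (v : letter),
  x@_a != 0 -> (0 < a.2 v)%N -> (v.2 < N)%N.
Proof.
exists (\max_(a <- msupp x) wdl (letters_of a.2)) => a v xa av.
have le : (wdl (letters_of a.2) <= \max_(b <- msupp x) wdl (letters_of b.2))%N.
  by apply: (leq_bigmax_seq (F := fun b : mono => wdl (letters_of b.2))); rewrite // -mcoeff_neq0.
by apply: leq_trans le; apply: wdlP; rewrite -cnt_gt0 -cm_cnt letters_ofK.
Qed.

(** On a single vector, the increasing map of an operator agrees with a permutation. The bound [N]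
    is exposed so that one permutation can serve several vectors. *)
Lemma Psi_oper (d : seq nat) o (t : oper c) l (x : free_module K c d) :
  op_m t = map (@emb_var c) l -> exists N, forall s : Sym,
    (forall j, (j < N)%N -> s j = op_f t j) ->
    forall k, k *: lin (act t) (Psi o x) = Psi o (<< k *g cm l >> *: free_act s x).
Proof.
move=> tl; have [N HN] := column_bound (Psi o x); exists N => s Hs k.
apply/esym; apply: etrans (Psi_Z _ _ _ _) _; apply: (congr1 (fun z => k *: z)).
apply: etrans (congr1 (lin _) (Psi_act _ _ _)) _; rewrite lin_comp.
apply: eq_lin => a xa; rewrite -tl /= /mact /op_act /=; congr (_, mmul _ _).
have -> : mmul (cm [::]) (cmap s a.2) = cmap s a.2.
  by apply/eqP/cmP => v; rewrite cmM cm_cnt /cnt /= add0n.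
by rewrite cmap_id; apply: eq_cmap => v av; apply: Hs; apply: HN xa av.
Qed.

End Vectors.

Section Decode.
Context (K : fieldType) (c : nat) (e D : seq nat).

Lemma decode_mono (a : rmono) : wfr c D a -> (a.1 < size e)%N ->
  nth 0%N D a.1 = nth 0%N e a.1 -> exists (l : seq ('I_c * nat)) (u : free_basis e),
  [/\ map (@emb_var c) l = [seq v <- a.2 | (v.1 < c)%N], tag u = a.1 :> nat,
      posn u = [seq head 0%N [seq v.2 | v <- [seq v <- a.2 | v.1 == (c + k)%N]]
               | k <- iota 0 (nth 0%N e a.1)] &
      emb_mono 0 u (cm l) = rmono_of a].
Proof.
case: a => i m [/= iD Hr Hd] ie De; rewrite De in Hr.
have [l El] : exists l, [seq v : letter <- m | (v.1 < c)%N] = map (@emb_var c) l.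
  by apply: rows_lt_letters; apply/allP => v; rewrite mem_filter => /andP[].
pose pk k := head 0%N [seq v.2 | v <- [seq v : letter <- m | v.1 == (c + k)%N]].
pose n := nth 0%N e i.
have pkm k : (k < n)%N -> ((c + k)%N, pk k) \in m.
  move=> kn; have := Hr (c + k)%N (leq_addr _ _).
  rewrite ltn_add2l kn /pk /rowcnt -size_filter.
  have sub v : v \in [seq v : letter <- m | v.1 == (c + k)%N] -> ((c + k)%N, v.2) \in m.
    by rewrite mem_filter => /andP[/eqP <-]; rewrite -surjective_pairing.
  by case: [seq v : letter <- m | _] sub => // v s sub _ /=; apply: sub; apply: mem_head.
have pkI j k : (j < n)%N -> (k < n)%N -> pk j = pk k -> j = k.
  move=> jn kn E; have := Hd _ _ (pkm _ jn) (pkm _ kn) (leq_addr _ _) (leq_addr _ _) E.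
  by move/addnI.
have fI : injectiveb [ffun k : 'I_(nth 0%N e (Ordinal ie)) => pk k].
  apply/injectiveP => j k; rewrite !ffunE => /pkI E; apply/val_inj/E; exact: ltn_ord.
pose u : free_basis e := Tagged (fun i : 'I_(size e) => inj_maps (nth 0%N e i))
  (exist (fun f : {ffun _ -> nat} => injectiveb f) _ fI).
have pu : posn u = [seq pk k | k <- iota 0 n].
  rewrite /posn -val_enum_ord -map_comp; apply: eq_map => j /=.
  by rewrite ffunE.
exists l, u; split=> //.
rewrite /emb_mono /rmono_of /= cemb_cm -El -cm_cat pu; congr (_, _).
apply: eq_cm => v; apply: cnt_perm.
(* The letters split into variables and markers. The markers have no repetition, as each row from
   [c] on occurs at most once, so they can be compared by membership. *)
rewrite perm_sym; apply: perm_trans (_ : perm_eq _ ([seq v : letter <- m | (v.1 < c)%N] ++ [seq v : letter <- m | ~~ (v.1 < c)%N])) _.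
  by rewrite perm_sym; apply/permEl/perm_filterC.
rewrite perm_cat2l; apply: uniq_perm.
- apply: count_mem_uniq => x; have [xm|/count_memPn //] := boolP (x \in _).
  move: (xm); rewrite mem_filter -leqNgt => /andP[cx xm'].
  apply/eqP; rewrite eqn_leq -has_count has_pred1 xm andbT.
  have : (rowcnt x.1 m <= 1)%N by rewrite Hr //; case: (_ < _)%N.
  apply: leq_trans; rewrite /rowcnt count_filter; apply: sub_count => y /= /andP[/eqP -> _].
  by rewrite eqxx.
- rewrite map_inj_uniq ?iota_uniq // => j k [/addnI].
  by [].
move=> x; rewrite mem_filter -leqNgt; apply/andP/idP => [[cx xm]|].
  have xn : (x.1 < c + n)%N.
    have := Hr x.1 cx; case: ltnP => // _ /eqP.
    by rewrite eqn0Ngt -has_count => /hasPn/(_ x xm); rewrite eqxx.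
  have kn : (x.1 - c < n)%N by rewrite ltn_subLR.
  have xE : x = ((c + (x.1 - c))%N, pk (x.1 - c)%N).
    have xc : (c + (x.1 - c))%N = x.1 by rewrite subnKC.
    have := pkm _ kn; rewrite xc => ym.
    have := Hr x.1 cx; rewrite xn => R1.
    rewrite [LHS]surjective_pairing; congr (_, _).
    move: R1; rewrite /rowcnt -size_filter => R1.
    have x1 : x \in [seq v : letter <- m | v.1 == x.1] by rewrite mem_filter eqxx.
    have y1 : (x.1, pk (x.1 - c)%N) \in [seq v : letter <- m | v.1 == x.1].
      by rewrite mem_filter /= eqxx.
    move: R1 x1 y1; case: [seq v : letter <- m | _] => [|z [|? ?]] // _.
    by rewrite !inE => /eqP E1 /eqP E2; rewrite {1}E1 -E2.
  have := @mem_markers c [seq pk k | k <- iota 0 n] (x.1 - c)%N.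
  by rewrite size_map size_iota (nth_map 0%N) ?size_iota // nth_iota // -xE; apply.
case/markers_mem => k; rewrite size_map size_iota => kn -> /=.
by rewrite leq_addr (nth_map 0%N) ?size_iota // nth_iota // pkm.
Qed.

Lemma unflatP (g : relt K) : wfq c D g ->
  (forall i, (i < size e)%N -> nth 0%N D i = nth 0%N e i) ->
  (forall a : mono, (sem g)@_a != 0 -> (a.1 < size e)%N) ->
  exists q : elt_repr K c e, raw_elt q = unflat c e g /\ Psi 0 (elt_of q) = sem g.
Proof.
move=> wg HD Hg; have -> : sem g = sem [seq t <- g | (t.2.1 < size e)%N].
  apply/malgP => a; have [ae|ae] := boolP (a.1 < size e)%N.
    rewrite /sem big_filter (bigID (fun t : K * rmono => (t.2.1 < size e)%N)) /=.
    rewrite mcoeffD [X in _ + X]raddf_sum [X in _ + X]big1 ?addr0 // => t te.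
    rewrite /= mcoeffU; case: eqP => [E|]; last by rewrite mulr0n.
    by case/negP: te; rewrite -E in ae.
  have -> : (sem g)@_a = 0 by apply: contrapT => /eqP/Hg; rewrite (negPf ae).
  apply/esym; apply: contrapT => /eqP/sem_supp[t].
  by rewrite mem_filter => /andP[te _] E; rewrite -E te in ae.
rewrite /unflat; have : forall t, t \in [seq t <- g | (t.2.1 < size e)%N] ->
    wfr c D t.2 /\ (t.2.1 < size e)%N.
  by move=> t; rewrite mem_filter => /andP[te /wg].
elim: [seq t <- g | _] => [|t s IH] Hs.
  by exists [::]; rewrite /elt_of /sem !big_nil Psi0.
have [q [E1 E2]] := IH (fun u us => Hs u (mem_behead (s := t :: s) us)).
have [wt te] := Hs t (mem_head _ _).
have [l [u [Hl Hu Hp He]]] := decode_mono wt te (HD _ te).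
exists (([:: (t.1, l)], u) :: q); split.
  by rewrite /= E1 /raw_poly /= Hl Hu Hp.
rewrite Psi_elt_of [RHS]sem_cons -E2 Psi_elt_of.
have -> : flat c 0 (raw_elt (([:: (t.1, l)], u) :: q)) =
    (t.1, ((0 + tag u)%N, map (@emb_var c) l ++ markers c (posn u))) :: flat c 0 (raw_elt q).
  by [].
have E3 : rmono_of ((0 + tag u)%N, map (@emb_var c) l ++ markers c (posn u)) = rmono_of t.2.
  by rewrite -He /emb_mono /rmono_of /= cm_cat cemb_cm.
rewrite [LHS]sem_cons.
exact: (congr1 (fun a => << t.1 *g a >> + sem (flat c 0 (raw_elt q))) E3).
Qed.

End Decode.

Lemma lin_id (K : fieldType) (h : mono -> mono) (x : {malg K[mono]}) :
  (forall a, x@_a != 0 -> h a = a) -> lin h x = x.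
Proof.
move=> H; rewrite [RHS]monalgE /lin [LHS]big_seq [RHS]big_seq.
by apply: eq_bigr => a; rewrite -mcoeff_neq0 => /H ->.
Qed.

(** This is the condition of [free_hom] on the image of a generator whose rank is the width of
    [q]. *)
Lemma elt_of_fixed (K : fieldType) c d (q : elt_repr K c d) (s : Sym) :
  (forall j, (j < wd (flat c 0 (raw_elt q)))%N -> s j = j) ->
  free_act s (elt_of q) = elt_of q.
Proof.
move=> Hs; apply: (@Psi_inj _ _ _ 0); rewrite Psi_act Psi_elt_of.
apply: lin_id => a qa; apply: mact_id => v av; apply: Hs.
by rewrite ltnNge; apply/negP => /(sem_colbound qa) E; rewrite E in av.
Qed.

Section Kernel.
Context (K : fieldType) (c : nat) (d : seq nat) (B : seq (elt_repr K c d)).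
Local Notation V := {malg K[mono]}.
Local Notation act := (@op_act c).
Local Notation rB := [seq raw_elt b | b <- B].

Definition gen_widths : seq nat := widths c rB.
Local Notation e := gen_widths.
Local Notation o := (size e).
Local Notation D := (e ++ d).
Local Notation F := (free_module K c e).

Lemma size_gen_widths : size e = size B.
Proof. by rewrite !size_map. Qed.

Lemma nth_gen_widths i : (i < size B)%N ->
  nth 0%N e i = wd (flat c 0 (raw_elt (nth [::] B i))).
Proof. by move=> iB; rewrite (nth_map [::]) ?size_map // (nth_map [::]). Qed.

Context (phi : symHom F (free_module K c d)).
Context (phi_gen : forall i : 'I_(size e), phi (free_gen K c i) = elt_of (nth [::] B i)).

Definition graph (y : F) : V := Psi 0 y + Psi o (phi y).

(** One permutation is chosen for both components, and [phi] is linear and equivariant. The extra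
    bound [n] lets [rep_graph] control the permutation on the columns of a generator. *)
Lemma graph_oper (t : oper c) (y : F) n : exists l (s : Sym),
  [/\ forall j, (j < n)%N -> s j = op_f t j, op_m t = map (@emb_var c) l &
      forall k, k *: lin (act t) (graph y) = graph (<< k *g cm l >> *: free_act s y)].
Proof.
have [l tl] := rows_lt_letters (op_rows t).
have [N1 H1] := Psi_oper 0 y tl; have [N2 H2] := Psi_oper o (phi y) tl.
have [s Hs] : exists s : Sym, forall j, (j < maxn n (maxn N1 N2))%N -> s j = op_f t j.
  by apply: sym_extend => i j _ _; apply: (incr_inj (@op_incr _ t)).
exists l, s; split=> // [j jn|k]; first by apply: Hs; rewrite leq_max jn.
rewrite /graph linD scalerDr (H1 s) => [|j jN]; last by apply: Hs; rewrite !leq_max jN !orbT.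
rewrite (H2 s) => [|j jN]; last by apply: Hs; rewrite !leq_max jN !orbT.
apply: (congr1 (fun z => Psi 0 (<< k *g cm l >> *: free_act s y) + Psi o z)).
apply/esym; apply: etrans (linearZ _ _) _; apply: (congr1 (fun z => << k *g cm l >> *: z)).
exact: sh_equiv.
Qed.

Lemma graphD x y : graph (x + y) = graph x + graph y.
Proof.
rewrite /graph raddfD; apply: etrans (congr2 +%R (PsiD _ _ _) (PsiD _ _ _)) _.
exact: addrACA.
Qed.

Lemma graph0 : graph 0 = 0.
Proof. by rewrite /graph raddf0 !Psi0 addr0. Qed.

Lemma graph_closed : oper_closed c (fun x => exists y, x = graph y).
Proof.
split; first by exists 0; rewrite graph0.
move=> _ k t _ [x ->] [y ->]; have [l [s [_ _ H]]] := graph_oper t y 0.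
by exists (x + << k *g cm l >> *: free_act s y); rewrite graphD -H.
Qed.

Lemma graph_eltE (i : 'I_(size e)) : graph_elt c rB i =
  unit_elt K c i (nth 0%N e i) ++ flat c o (raw_elt (nth [::] B i)).
Proof.
have iB : (i < size B)%N by rewrite -size_gen_widths.
rewrite /graph_elt size_map (nth_map [::]) //; congr (_ ++ flat c _ _).
exact: esym size_gen_widths.
Qed.

Lemma sem_graph_elt (i : 'I_(size e)) : sem (graph_elt c rB i) = graph (free_gen K c i).
Proof.
rewrite graph_eltE sem_cat /graph phi_gen -Psi_elt_of; congr (_ + _).
rewrite /sem big_seq1 /=; apply/esym.
have E : emb_mono 0 (Tagged (fun i : 'I_(size e) => inj_maps (nth 0%N e i))
    (incl_inj (nth 0%N e i))) (cm ([::] : seq ('I_c * nat))) = rmono_of (nat_of_ord i, markers c (iota 0 (nth 0%N e i))).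
  rewrite /emb_mono /rmono_of cemb_cm -cm_cat; congr (_, cm (markers c _)).
  by rewrite /posn -val_enum_ord; apply: eq_map => j /=; rewrite ffunE.
have -> : free_gen K c i = << << 1 *g cm ([::] : seq ('I_c * nat)) >> *g Tagged
    (fun i : 'I_(size e) => inj_maps (nth 0%N e i)) (incl_inj (nth 0%N e i)) >>.
  by rewrite /cm big_nil.
apply: etrans (PsiU _ _ _ _) _.
exact: (congr1 (fun a : mono => << (1 : K) *g a >>) E).
Qed.

Lemma wd_graph_elt (i : 'I_(size e)) : (wd (graph_elt c rB i) <= nth 0%N e i)%N.
Proof.
have iB : (i < size B)%N by rewrite -size_gen_widths.
rewrite graph_eltE wd_cat wd_flat_shift nth_gen_widths // geq_max leqnn andbT.
rewrite /= maxn0; set n := wd _.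
suff : forall v, v \in markers c (iota 0 n) -> (v.2 < n)%N.
  elim: (markers c _) => //= v l IH H; rewrite geq_max IH ?andbT ?H ?mem_head // => u ul.
  by apply: H; rewrite inE ul orbT.
move=> v /markers_mem[k]; rewrite size_iota => kn -> /=; by rewrite nth_iota.
Qed.

Lemma sem_graph_perm (i : 'I_(size e)) p : p \in perms (nth 0%N e i) ->
  exists s : Sym, (forall j, (j < nth 0%N e i)%N -> s j = nth 0%N p j) /\
    sem (scal 1 [::] p (graph_elt c rB i)) = graph (free_act s (free_gen K c i)).
Proof.
rewrite perms_mem => /and3P[Up /eqP sp _].
have [j k jn kn|s Hs] := @sym_extend (nth 0%N e i) (nth 0%N p).
  by apply: (uniqP 0%N Up); rewrite inE sp.
exists s; split=> //; rewrite (@sem_scal _ _ _ _ s); last first.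
  by move=> j jw; rewrite Hs //; apply: leq_trans jw (wd_graph_elt i).
rewrite scale1r sem_graph_elt /graph linD -!Psi_act.
apply: (congr1 (fun z => Psi 0 (free_act s (free_gen K c i)) + Psi o z)).
exact: (esym (sh_equiv phi s _)).
Qed.

Lemma graph_gens_wf b : b \in graph_gens c rB -> wfq c D b.
Proof.
case/flatten_mapP=> i; rewrite mem_iota add0n size_map -size_gen_widths /= => ie.
case/mapP=> p Hp ->; have wdi := wd_graph_elt (Ordinal ie).
move: Hp; rewrite perms_mem => /and3P[Up /eqP sp _].
apply: (@wfq_scal K c D 1 [::] p (graph_elt c rB i)) => //; last first.
  move=> j k jn kn; apply: (uniqP 0%N Up); rewrite inE sp.
    exact: leq_trans jn wdi.
  exact: leq_trans kn wdi.
rewrite (graph_eltE (Ordinal ie)); apply: wfq_cat; last first.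
  apply: wfq_flat => j jd; rewrite size_cat ltn_add2l jd; split=> //.
  by rewrite nth_cat ltnNge leq_addr addKn.
move=> t; rewrite inE => /eqP -> /=.
apply: (@wfr_markers c D i [::] (iota 0 (nth 0%N e i))) => //; last exact: iota_uniq.
  by rewrite size_cat ltn_addr.
by rewrite nth_cat ie size_iota.
Qed.

Context (G : seq (relt K)) (G_wf : wfG c D G)
  (G_buch : buchberger ltM act (gens G : V -> mono -> Prop))
  (G_rep : forall b, b \in graph_gens c rB -> rep act (gens G) (fun=> True) (sem b))
  (G_graph : forall g, g \in G -> exists y, sem g = graph y).

(** By additivity one term suffices. Its basis element maps the columns of the generator by the
    permutation [p] followed by the increasing enumeration [E] of the image, so its graph vector is
    a multiple of a translate of a listed generator. *)
Lemma rep_graph y : rep act (gens G) (fun=> True) (graph y).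
Proof.
elim/term_ind: y => [|x y Hx Hy|k m u].
- by rewrite graph0; apply: Rep0.
- by rewrite graphD; apply: rep_add Hx Hy.
pose i := tag u; pose E := sort leq (posn u).
have UE : uniq E by rewrite sort_uniq posn_uniq.
have sE : size E = nth 0%N e i by rewrite size_sort size_posn.
have IE : incrb E.
  apply/incrbP => j jE; apply: (sorted_ltn_nth ltn_trans) => //; last by rewrite inE ltnW.
  by rewrite ltn_sorted_uniq_leq UE sort_sorted //; exact: leq_total.
pose p := [seq index x E | x <- posn u].
have memE x : x \in posn u -> x \in E by rewrite mem_sort.
have Hp : p \in perms (nth 0%N e i).
  rewrite perms_mem size_map size_posn eqxx /=; apply/andP; split.
    rewrite map_inj_in_uniq ?posn_uniq // => x y xu yu.
    by move=> ixy; rewrite -(nth_index 0%N (memE _ xu)) ixy nth_index // memE.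
  by apply/allP => _ /mapP[x xu ->]; rewrite -sE index_mem memE.
have [s [Hs Es]] := sem_graph_perm Hp.
pose t := Oper (rows_lt_emb (letters_of m)) (inc_ext_incr IE).
have [l [s' [Hs' tl H]]] := graph_oper t (free_act s (free_gen K c i)) (nth 0%N e i).
have Em : cm l = m.
  by apply: cemb_inj; rewrite cemb_cm -tl -cemb_cm letters_ofK.
suff <- : k *: lin (act t) (sem (scal 1 [::] p (graph_elt c rB i))) = graph << << k *g m >> *g u >>.
  apply: rep_scale; apply: (rep_lin (@op_act_mul c) (bd := fun=> True)) => //.
  apply: G_rep; apply/flatten_mapP; exists (nat_of_ord i).
    by rewrite mem_iota size_map -size_gen_widths ltn_ord.
  exact: map_f.
rewrite Es H Em; apply: (congr1 graph).
have -> : free_act s' (free_act s (free_gen K c i)) = << u >>.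
  rewrite -free_actM free_actU rmorph1 -act_basis_gen // => j /=.
  have jp : (j < size (posn u))%N by rewrite size_posn ltn_ord.
  have sp : size p = size (posn u) := size_map _ _.
  rewrite Hs ?ltn_ord // Hs'; last first.
    have : nth 0%N p j \in p by apply: mem_nth; rewrite sp.
    by case/mapP=> x xu ->; rewrite -sE index_mem memE.
  rewrite (nth_map 0%N) // /= /inc_ext index_mem memE ?mem_nth //.
  by rewrite nth_index ?memE ?mem_nth // nth_posn.
by rewrite malgZU mulr1.
Qed.

Lemma Psi_tag (d' : seq nat) o' (x : free_module K c d') (a : mono) :
  (Psi o' x)@_a <> 0 -> (o' <= a.1)%N /\ (a.1 < o' + size d')%N.
Proof. by case/Psi_supp=> u [m ->]; rewrite /= leq_addr ltn_add2l ltn_ord. Qed.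

Lemma graph_low y : (forall a : mono, (graph y)@_a != 0 -> (a.1 < o)%N) ->
  phi y = 0 /\ graph y = Psi 0 y.
Proof.
move=> H; suff E : phi y = 0 by rewrite /graph E Psi0 addr0.
apply: (@Psi_inj _ _ _ o); rewrite Psi0; apply/malgP => a; rewrite mcoeff0.
apply: contrapT => Ha; have [oa _] := Psi_tag Ha.
have : (graph y)@_a <> 0.
  rewrite mcoeffD; suff -> : (Psi 0 y)@_a = 0 by rewrite add0r.
  by apply: contrapT => /Psi_tag[_]; rewrite add0n ltnNge oa.
by move/eqP/H; rewrite ltnNge oa.
Qed.

(** The elimination property: as indices are compared first, a lead in F_1 forces the whole vector
    into F_1. *)
Lemma lead_low g : g \in G -> ((lead g).1 < o)%N ->
  forall a : mono, (sem g)@_a != 0 -> (a.1 < o)%N.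
Proof.
move=> /G_wf[_ lg] lo a /eqP ga; have [_ [_ /(_ a ga)]] := leadP lg.
by case=> [->//|[al|[-> _]//]]; apply: ltn_trans al lo.
Qed.

Lemma kernel_decode : exists Q : seq (elt_repr K c e),
  map (@raw_elt K c e) Q = kernel_gens c e G /\
  (forall q, q \in Q -> exists2 g, g \in G & Psi 0 (elt_of q) = sem g) /\
  (forall g, g \in G -> ((lead g).1 < o)%N -> exists2 q, q \in Q & Psi 0 (elt_of q) = sem g).
Proof.
rewrite /kernel_gens; have : forall g, g \in [seq g <- G | ((lead g).1 < o)%N] ->
    exists q : elt_repr K c e, raw_elt q = unflat c e g /\ Psi 0 (elt_of q) = sem g.
  move=> g; rewrite mem_filter => /andP[lo gG].
  apply: (@unflatP _ _ _ D); first by have [] := G_wf gG.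
    by move=> i ie; rewrite nth_cat ie.
  exact: lead_low gG lo.
have sub g : g \in [seq g <- G | ((lead g).1 < o)%N] -> g \in G by rewrite mem_filter => /andP[].
have sup g : g \in G -> ((lead g).1 < o)%N -> g \in [seq g <- G | ((lead g).1 < o)%N].
  by move=> gG lo; rewrite mem_filter lo.
suff H L : (forall g, g \in L -> exists q : elt_repr K c e,
    raw_elt q = unflat c e g /\ Psi 0 (elt_of q) = sem g) ->
  exists Q : seq (elt_repr K c e), [/\ map (@raw_elt K c e) Q = map (unflat c e) L,
    forall q, q \in Q -> exists2 g, g \in L & Psi 0 (elt_of q) = sem g &
    forall g, g \in L -> exists2 q, q \in Q & Psi 0 (elt_of q) = sem g].
  move=> /H[Q [Q1 Q2 Q3]]; exists Q; split=> //; split=> [q /Q2[g /sub gG E]|g gG lo].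
    by exists g.
  by apply: Q3; apply: sup.
elim: L => [|g L IH] HL; first by exists [::].
have [|Q [Q1 Q2 Q3]] := IH; first by move=> h hL; apply: HL; rewrite inE hL orbT.
have [q [q1 q2]] := HL g (mem_head _ _); exists (q :: Q); split.
- by rewrite /= q1 Q1.
- move=> q'; rewrite inE => /predU1P[->|/Q2[h hL E]]; first by exists g; rewrite ?mem_head.
  by exists h; rewrite // inE hL orbT.
move=> h; rewrite inE => /predU1P[->|/Q3[q' q'Q E]]; first by exists q; rewrite ?mem_head.
by exists q'; rewrite // inE q'Q orbT.
Qed.

Lemma kernel_submodule : symSubmodule (fun y : F => phi y = 0).
Proof.
split=> [|x y Hx Hy|a x Hx|s x Hx].
- exact: raddf0.
- exact: etrans (raddfD phi x y) (etrans (congr2 +%R Hx Hy) (addr0 _)).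
- apply: etrans (linearZ _ _) _; exact: etrans (congr1 (fun z => a *: z) Hx) (scaler0 _ _).
by apply: etrans (sh_equiv phi s x) _; rewrite Hx; exact: free_act0.
Qed.

(** If [phi y = 0], the graph vector of [y] lies in F_1 and has a standard representation. All leads
    in it are at most the lead of this vector, so their indices belong to F_1 and the elements used
    are among those kept by [kernel_gens]. *)
Theorem kernel_correct : exists Q : seq (elt_repr K c e),
  map (@raw_elt K c e) Q = kernel_gens c e G /\
  forall y, phi y = 0 <-> in_span (M := F) [seq elt_of q | q <- Q] y.
Proof.
have [Q [rQ [Q1 Q2]]] := kernel_decode; exists Q; split=> // y; split; last first.
  move=> Hy; apply: (Hy _ kernel_submodule) => _ /mapP[q /Q1[g gG E] ->].
  have [z zE] := G_graph gG.
  have [|p0 pz] := @graph_low z.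
    by move=> a; rewrite -zE -E => /eqP/Psi_tag[_].
  by have -> : elt_of q = z by apply: (@Psi_inj _ _ _ 0); rewrite E zE.
move=> py0; have gy : graph y = Psi 0 y by rewrite /graph py0 Psi0 addr0.
have Hrep := rep_graph y; rewrite gy in Hrep.
have [y0|[a [ya _] Ha]] := rep_lead ltM_trans ltM_irr ltM_total (@op_act_lt c)
    (ltM_wf (size D) (maxrow c D)) (fun v m => @gens_lead _ _ _ _ v m G_wf)
    (fun v m t => @gens_ok _ _ _ _ v m t G_wf) G_buch Hrep.
  have -> : y = 0 by apply: (@Psi_inj _ _ _ 0); rewrite y0 Psi0.
  exact: ss_0 (in_span_submodule _).
have [_ ao] := Psi_tag ya; rewrite add0n in ao.
have [S0 SD SZ SA] := in_span_submodule (M := F) [seq elt_of q | q <- Q].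
have [z Hz zE] : exists2 z : F, in_span (M := F) [seq elt_of q | q <- Q] z & Psi 0 z = Psi 0 y.
  elim: Ha => {y py0 gy Hrep ya} [|x k t _ _ _ [z Hz zE] [g gG [-> ->]] ta].
    by exists 0; [exact: S0 | rewrite Psi0].
  have lo : ((lead g).1 < o)%N.
    by case: ta => [ta|[ta|[ta _]]]; move: ao; rewrite -?ta //; apply: ltn_trans.
  have [q qQ qE] := Q2 g gG lo.
  have [l tl] := rows_lt_letters (op_rows t).
  have [N HN] := Psi_oper 0 (elt_of q) tl.
  have [s Hs] := @sym_extend N (op_f t) (fun i j _ _ => @incr_inj _ (@op_incr _ t) i j).
  exists (z + << k *g cm l >> *: free_act s (elt_of q)).
    apply: SD => //; apply: SZ; apply: SA => N' SN' HN'; apply: HN'; exact: map_f.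
  by apply: etrans (PsiD _ _ _) _; rewrite zE -qE (HN s Hs).
by rewrite -(Psi_inj zE).
Qed.

End Kernel.

(** * Programs for kernels and resolutions *)

Section KernelPrograms.
Context (K : fieldType) (c : nat).
Context (A : Type) (eA : encodable K A).

Lemma cbl_markers (l : A -> seq nat) : cbl l -> cbl (fun g => markers c (l g)).
Proof. by apply: cbl_app1; rewrite /markers; compute_step. Qed.

Lemma cbl_unit_elt (i n : A -> nat) : cbl i -> cbl n ->
  cbl (fun g => unit_elt K c (i g) (n g)).
Proof.
apply: cbl_app2; rewrite /unit_elt.
have H : cbl (fun x : nat * nat => markers c (iota 0 x.2)).
  by rewrite /markers; compute_step.
by compute_step.
Qed.

End KernelPrograms.
#[global] Hint Resolve cbl_markers cbl_unit_elt : cbl.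

Section KernelPrograms2.
Context (K : fieldType) (c : nat).
Context (A : Type) (eA : encodable K A).
Implicit Types B : A -> seq (rtelt K).

Lemma cbl_flat (o : A -> nat) (q : A -> rtelt K) : cbl o -> cbl q ->
  cbl (fun g => flat c (o g) (q g)).
Proof. by apply: cbl_app2; rewrite /flat; compute_step. Qed.

Lemma cbl_unflat (w : A -> seq nat) (q : A -> relt K) : cbl w -> cbl q ->
  cbl (fun g => unflat c (w g) (q g)).
Proof. by apply: cbl_app2; rewrite /unflat; compute_step. Qed.

End KernelPrograms2.
#[global] Hint Resolve cbl_flat cbl_unflat : cbl.

Section KernelPrograms3.
Context (K : fieldType) (c : nat).
Context (A : Type) (eA : encodable K A).
Implicit Types B : A -> seq (rtelt K).

Lemma cbl_widths B : cbl B -> cbl (fun g => widths c (B g)).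
Proof. by apply: cbl_app1; rewrite /widths; compute_step. Qed.

Lemma cbl_kernel_gens (w : A -> seq nat) (G : A -> seq (relt K)) : cbl w -> cbl G ->
  cbl (fun g => kernel_gens c (w g) (G g)).
Proof. by apply: cbl_app2; rewrite /kernel_gens; compute_step. Qed.

End KernelPrograms3.
#[global] Hint Resolve cbl_widths cbl_kernel_gens : cbl.

Section KernelPrograms4.
Context (K : fieldType) (c : nat).
Context (A : Type) (eA : encodable K A).
Implicit Types B : A -> seq (rtelt K).

Lemma cbl_graph_elt B (i : A -> nat) : cbl B -> cbl i ->
  cbl (fun g => graph_elt c (B g) (i g)).
Proof. by apply: cbl_app2; rewrite /graph_elt; compute_step. Qed.

End KernelPrograms4.
#[global] Hint Resolve cbl_graph_elt : cbl.

Section KernelPrograms5.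
Context (K : fieldType) (c : nat).

Lemma cbl_graph_gens : cbl (@graph_gens K c).
Proof. by rewrite /graph_gens; compute_step. Qed.

End KernelPrograms5.

Section Encodings2.
Context (K : fieldType) (c : nat).

Lemma enc_list_map (T U : Type) (eU : encodable K U) (enc : T -> data K) (f : T -> U) l :
  (forall t, enc t = encode (f t)) -> enc_list enc l = encode (map f l).
Proof. by move=> H; elim: l => //= t l IH; rewrite H IH. Qed.

Lemma enc_elt_raw d (q : elt_repr K c d) : enc_elt q = encode (raw_elt q).
Proof.
apply: enc_list_map => -[p u]; congr (Pair _ _); apply: enc_list_map => -[k l].
by congr (Pair _ _); apply: enc_list_map.
Qed.

Lemma enc_input_raw s d (B : seq (elt_repr K c d)) :
  enc_input s B = encode (s, (d, [seq raw_elt b | b <- B])).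
Proof.
congr (Pair _ (Pair _ _)); apply: enc_list_map; exact: enc_elt_raw.
Qed.

Lemma enc_output_raw s (rk : nat -> seq nat) (B : forall k, seq (elt_repr K c (rk k))) :
  (forall k, size (rk k.+1) = size (B k)) ->
  enc_output s (fun k (i : 'I_(size (rk k.+1))) => nth [::] (B k) i) =
  encode [seq (rk k.+1, [seq raw_elt b | b <- B k]) | k <- iota 0 s].
Proof.
move=> sB; apply: enc_list_map => k; congr (Pair _ _).
rewrite (@enc_list_map _ _ _ _ (fun i : 'I_(size (rk k.+1)) => raw_elt (nth [::] (B k) i))).
  congr encode; rewrite -[in RHS](mkseq_nth [::] (B k)) /mkseq -sB -val_enum_ord.
  by rewrite -!map_comp.
by move=> i; apply: enc_elt_raw.
Qed.

End Encodings2.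

(** The states are raw data along a given trace, because the kernel step is known only through
    [eval] and not as a function covered by [cbl]. *)
Lemma eval_while_seq (K : fieldType) p q (x : nat -> data K) n :
  (forall k, (k < n)%N -> exists2 b, eval p (x k) b & truthy b) ->
  (exists2 b, eval p (x n) b & ~~ truthy b) ->
  (forall k, (k < n)%N -> eval q (x k) (x k.+1)) -> eval (While p q) (x 0%N) (x n).
Proof.
elim: n x => [|n IH] x Hp [b Hb fb] Hq; first exact: EvalWhileFalse Hb fb.
have [b0 Hb0 tb0] := Hp 0%N isT.
apply: EvalWhileTrue Hb0 tb0 (Hq 0%N isT) _.
by apply: (IH (fun k => x k.+1)) => [k kn||k kn]; [apply: Hp | exists b | apply: Hq].
Qed.

Section FreeMaps.
Context (K : fieldType) (c : nat).

Lemma free_fg d : finitely_generated (free_module K c d).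
Proof.
exists [seq free_gen K c i | i <- enum 'I_(size d)]; apply: free_ind.
  exact: in_span_submodule.
by move=> i N _; apply; apply: map_f; rewrite mem_enum.
Qed.

Lemma image_span e d (B : seq (elt_repr K c d))
    (phi : symHom (free_module K c e) (free_module K c d)) :
  size e = size B -> (forall i : 'I_(size e), phi (free_gen K c i) = elt_of (nth [::] B i)) ->
  forall v, in_span (M := free_module K c d) [seq elt_of b | b <- B] v <->
    exists x, phi x = v.
Proof.
move=> sB Hphi v; split.
  move=> Hv; apply: (Hv (fun v => exists x, phi x = v)).
    split=> [|_ _ [x <-] [y <-]|a _ [x <-]|s _ [x <-]].
    - by exists 0; exact: raddf0.
    - by exists (x + y); exact: raddfD.
    - by exists (a *: x); exact: linearZ.
    by exists (sm_act s x); exact: sh_equiv.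
  move=> _ /mapP[b /(nthP [::])[i iB <-] ->].
  have ie : (i < size e)%N by rewrite sB.
  by exists (free_gen K c (Ordinal ie)); rewrite Hphi.
case=> x <-; have [S0 SD SZ SA] := in_span_submodule (M := free_module K c d) [seq elt_of b | b <- B].
move: x; apply: free_ind.
  split=> [|x y Hx Hy|a x Hx|s x Hx].
  - have -> : phi 0 = 0 by exact: raddf0.
    exact: S0.
  - have -> : phi (x + y) = phi x + phi y by exact: raddfD.
    exact: SD.
  - have -> : phi (a *: x) = a *: phi x by exact: linearZ.
    exact: SZ.
  by rewrite sh_equiv; apply: SA.
move=> i; rewrite Hphi => N _; apply; apply: map_f; apply: mem_nth.
by rewrite -sB ltn_ord.
Qed.

Lemma lift_elts d (B : seq (elt_repr K c d)) :
  exists phi : symHom (free_module K c (gen_widths B)) (free_module K c d),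
    forall i : 'I_(size (gen_widths B)), phi (free_gen K c i) = elt_of (nth [::] B i).
Proof.
apply: (@free_hom K c (gen_widths B) (free_module K c d)
  (fun i => elt_of (nth [::] B i) : free_module K c d)) => i s Hs.
apply: elt_of_fixed => j jw; apply: Hs.
by rewrite nth_gen_widths // -size_gen_widths.
Qed.

(** The generators go into the span, so the universal property gives a morphism to it; agreement
    with [phi] on generators extends to all elements. *)
Lemma augmentation d (B : seq (elt_repr K c d))
    (phi : symHom (free_module K c (gen_widths B)) (free_module K c d)) :
  (forall i : 'I_(size (gen_widths B)), phi (free_gen K c i) = elt_of (nth [::] B i)) ->
  exists aug : symHom (free_module K c (gen_widths B))
      (span_module (M := free_module K c d) [seq elt_of b | b <- B]),
    forall x, span_val (aug x) = phi x.
Proof.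
move=> Hphi.
pose M := span_module (M := free_module K c d) [seq elt_of b | b <- B].
have inM (i : 'I_(size (gen_widths B))) : (elt_of (nth [::] B i) : free_module K c d) \in
    span_pred (M := free_module K c d) [seq elt_of b | b <- B].
  apply/span_predP => N _; apply; apply: map_f; apply: mem_nth.
  by rewrite -size_gen_widths.
have [aug Haug] : exists aug : symHom (free_module K c (gen_widths B)) M,
    forall i, aug (free_gen K c i) = SpanType (inM i) :> M.
  apply: free_hom => i s Hs; apply: val_inj; apply: elt_of_fixed => j jw; apply: Hs.
  by rewrite nth_gen_widths // -size_gen_widths.
exists aug; apply: free_ind.
  split=> [|x y Hx Hy|a x Hx|s x Hx].
  - have -> : aug 0 = 0 by exact: raddf0.
    by apply/esym; exact: raddf0.
  - have -> : aug (x + y) = aug x + aug y by exact: raddfD.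
    have -> : phi (x + y) = phi x + phi y by exact: raddfD.
    by rewrite -Hx -Hy.
  - have -> : aug (a *: x) = a *: aug x by exact: linearZ.
    have -> : phi (a *: x) = a *: phi x by exact: linearZ.
    by rewrite -Hx.
  by rewrite !sh_equiv -Hx.
by move=> i; rewrite Haug Hphi.
Qed.

End FreeMaps.

(** * Iterated kernels *)

Section Resolution.
Context (K : fieldType) (c : nat).

Lemma kernel_program : exists p : program, forall d (B : seq (elt_repr K c d)),
  exists (Q : seq (elt_repr K c (gen_widths B)))
    (phi : symHom (free_module K c (gen_widths B)) (free_module K c d)),
  [/\ eval p (encode (d, [seq raw_elt b | b <- B]))
        (encode (gen_widths B, [seq raw_elt q | q <- Q])),
      forall i : 'I_(size (gen_widths B)), phi (free_gen K c i) = elt_of (nth [::] B i) &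
      forall y, phi y = 0 <->
        in_span (M := free_module K c (gen_widths B)) [seq elt_of q | q <- Q] y].
Proof.
have [w Hw] := @eval_while K _ _ (fun S : seq (relt K) * seq (relt K) => ~~ nilp S.2)
  (@buch_step K c) ltac:(compute_step) (@cbl_buch_step K c).
have [pre Hpre] : cbl (fun x : seq nat * seq (rtelt K) =>
    ([::] : seq (relt K), graph_gens c x.2)).
  have H : cbl (fun x : seq nat * seq (rtelt K) => graph_gens c x.2).
    by apply: (cbl_comp (cbl_graph_gens K c)); compute_step.
  by compute_step.
have [post Hpost] : cbl (fun x : (seq nat * seq (rtelt K)) * (seq (relt K) * seq (relt K)) =>
    (widths c x.1.2, kernel_gens c (widths c x.1.2) x.2.1)) by compute_step.
exists (Seq (Fork (Op OpId) (Seq pre w)) post) => d B.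
have [phi Hphi] := lift_elts B.
pose rB := [seq raw_elt b | b <- B].
have [n] := buch_correct (graph_gens_wf (B := B)).
set S := iter n _ _ => -[[S2 Slt] Gwf Gb Grep Gcl].
have Gg g : g \in S.1 -> exists y, sem g = graph phi y.
  apply: (Gcl (fun v => exists y, v = graph phi y)); first exact: graph_closed.
  move=> b /flatten_mapP[i]; rewrite mem_iota add0n size_map -size_gen_widths /= => ie /mapP[p Hp ->].
  have [s [_ Es]] := sem_graph_perm Hphi (i := Ordinal ie) Hp.
  by eexists; exact: Es.
have [Q [rQ HQ]] := kernel_correct Hphi Gwf Gb Grep Gg.
exists Q, phi; split=> //; rewrite rQ.
apply: EvalSeq (Hpost ((d, rB), S)); apply: EvalFork; first exact: eval_op.
apply: EvalSeq (Hpre (d, rB)) _; apply: Hw => [k kn|]; first exact: Slt.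
by rewrite negbK.
Qed.

(** An entry of the output consists of the ranks of F_(k+1), known only after the k-th kernel step,
    and of the images in F_k, known before it; hence [(x k.+1).1] beside [(x k).2]. The state holds
    a counter, the current input of [p] and the output so far. *)
Lemma resolution_program (p : program) : exists A : program,
  forall s (x : nat -> seq nat * seq (rtelt K)),
    (forall k, eval p (encode (x k)) (encode (x k.+1))) ->
    eval A (encode (s, x 0%N)) (encode [seq ((x k.+1).1, (x k).2) | k <- iota 0 s]).
Proof.
pose state := ((nat * (seq nat * seq (rtelt K))) * seq (seq nat * seq (rtelt K)))%type.
have [pc Hc] : cbl (fun S : state => ~~ (S.1.1 == 0%N)) by compute_step.
have [pg Hg] : cbl (fun S : state => S.1.2) by compute_step.
have [pu Hu] : cbl (fun T : state * (seq nat * seq (rtelt K)) =>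
    ((T.1.1.1.-1, T.2), T.1.2 ++ [:: (T.2.1, T.1.1.2.2)])) by compute_step.
have [pi Hi] : cbl (fun y : nat * (seq nat * seq (rtelt K)) =>
    (y, [::] : seq (seq nat * seq (rtelt K)))) by compute_step.
have [pf Hf] : cbl (fun S : state => S.2) by compute_step.
exists (Seq (Seq pi (While pc (Seq (Fork (Op OpId) (Seq pg p)) pu))) pf) => s x Hx.
pose S k : state := (((s - k)%N, x k), [seq ((x j.+1).1, (x j).2) | j <- iota 0 k]).
apply: EvalSeq (Hf (S s)); apply: EvalSeq (Hi (s, x 0%N)) _.
have -> : ((s, x 0%N), [::]) = S 0%N by rewrite /S subn0.
apply: (@eval_while_seq _ _ _ (fun k => encode (S k))) => [k ks||k ks].
- by eexists; [exact: (Hc (S k)) | rewrite /= subn_eq0 -ltnNge ks].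
- by eexists; [exact: (Hc (S s)) | rewrite /= subnn].
apply: EvalSeq.
  by apply: EvalFork; [exact: eval_op | apply: EvalSeq (Hg (S k)) (Hx k)].
have -> : S k.+1 = (((s - k).-1, x k.+1),
    [seq ((x j.+1).1, (x j).2) | j <- iota 0 k] ++ [:: ((x k.+1).1, (x k).2)]).
  by rewrite /S subnS -[X in iota 0 X]addn1 iotaD map_cat.
exact: (Hu (S k, x k.+1)).
Qed.

End Resolution.

Theorem mainTheorem6 (K : fieldType) (c : nat) :
  exists A : program,
  forall (s : nat) (d : seq nat) (B : seq (elt_repr K c d)), (1 <= s)%N ->
  exists (e : nat -> seq nat),
  let rk := with_head d e in
  let F := fun k => free_module K c (rk k) in
  let M := @span_module K c (F 0%N) [seq elt_of b | b <- B] in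
  exists (img : forall k, 'I_(size (rk k.+1)) -> elt_repr K c (rk k)),
    eval A (enc_input s B) (enc_output s img) /\
  exists (aug : symHom (F 1%N) M) (phi : forall k, symHom (F k.+2) (F k.+1)),
    [/\ finitely_generated M
          /\ (forall k, (1 <= k <= s)%N -> finitely_generated (F k)),
        forall i, span_val (aug (free_gen K c i)) = elt_of (img 0%N i),
        forall k, (k.+1 < s)%N ->
          forall i, phi k (free_gen K c i) = elt_of (img k.+1 i),
        surjective_hom aug
      & ((1 < s)%N -> exact_at (phi 0%N) aug)
          /\ (forall k, (k.+2 < s)%N -> exact_at (phi k.+1) (phi k))].
Proof.
have [p Hp] := kernel_program K c; have [A HA] := resolution_program K p.
exists A => s d B _.
pose Q d' (B' : seq (elt_repr K c d')) := projT1 (cid (Hp d' B')).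
have HQ d' (B' : seq (elt_repr K c d')) := projT2 (cid (Hp d' B')).
(* The type of each list of generators depends on ranks that are computed along the way, hence the
   dependent pairs. *)
pose st := fix st k : {d' & seq (elt_repr K c d')} :=
  if k is k'.+1 then existT _ (gen_widths (tagged (st k'))) (Q _ (tagged (st k')))
  else existT _ d B.
pose e k := tag (st k.+1); pose rk := with_head d e.
(* The case distinction gives [BB k] the type demanded by [rk k] by computation alone. *)
pose BB k : seq (elt_repr K c (rk k)) :=
  match k with 0%N => B | k'.+1 => tagged (st k'.+1) end.
have HB k : exists phi : symHom (free_module K c (rk k.+1)) (free_module K c (rk k)),
  [/\ rk k.+1 = gen_widths (BB k),
      eval p (encode (rk k, [seq raw_elt b | b <- BB k]))
        (encode (rk k.+1, [seq raw_elt q | q <- BB k.+1])),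
      forall i : 'I_(size (rk k.+1)), phi (free_gen K c i) = elt_of (nth [::] (BB k) i) &
      forall y, phi y = 0 <->
        in_span (M := free_module K c (rk k.+1)) [seq elt_of q | q <- BB k.+1] y].
  case: k => [|k].
    have [phi [H1 H2 H3]] := HQ d B.
    exists phi; split; [exact: erefl | exact: H1 | exact: H2 | exact: H3].
  have [phi [H1 H2 H3]] := HQ _ (tagged (st k.+1)).
  exists phi; split; [exact: erefl | exact: H1 | exact: H2 | exact: H3].
pose phi k := projT1 (cid (HB k)).
have Hphi k := projT2 (cid (HB k)).
have sBB k : size (rk k.+1) = size (BB k).
  have [E _ _ _] := Hphi k; apply: etrans (congr1 size E) _.
  exact: size_gen_widths.
exists e => rk' F M; exists (fun k (i : 'I_(size (rk k.+1))) => nth [::] (BB k) i); split.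
  rewrite enc_input_raw enc_output_raw //.
  have := HA s (fun k => (rk k, [seq raw_elt b | b <- BB k])); apply => k.
  by case: (Hphi k).
have [_ _ gen0 ker0] := Hphi 0%N.
have [aug Haug] := augmentation (B := B) gen0.
(* The inclusion of M into F_0 is injective, so [aug] and the first map have the same kernel. *)
have aug0 y : aug y = 0 <-> phi 0%N y = 0.
  rewrite -Haug; split=> [-> //|H]; exact: val_inj.
have surj : surjective_hom aug.
  case=> v Hv; have /span_predP Hv' := Hv.
  have [x Hx] := (image_span (sBB 0%N) gen0 v).1 Hv'.
  by exists x; apply: val_inj; exact: etrans (Haug x) Hx.
exists aug, (fun k => phi k.+1); split.
- split=> [|k _]; last exact: free_fg.
  exists [seq aug (free_gen K c i) | i <- enum 'I_(size (rk 1%N))] => y.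
  have [x <-] := surj y.
  have [S0 SD SZ SA] := in_span_submodule (M := M)
    [seq aug (free_gen K c i) | i <- enum 'I_(size (rk 1%N))].
  move: x; apply: free_ind.
    split=> [|u v Hu Hv|a u Hu|t u Hu].
    - have -> : aug 0 = 0 by exact: raddf0.
      exact: S0.
    - have -> : aug (u + v) = aug u + aug v by exact: raddfD.
      exact: SD.
    - have -> : aug (a *: u) = a *: aug u by exact: linearZ.
      exact: SZ.
    by rewrite sh_equiv; apply: SA.
  by move=> i N _; apply; apply: map_f; rewrite mem_enum.
- by move=> i; rewrite Haug gen0.
- by move=> k _ i; have [_ _ -> _] := Hphi k.+1.
- exact: surj.
have ker_im k y : phi k y = 0 <-> exists x, phi k.+1 x = y.
  have [_ _ _ ker] := Hphi k; have [_ _ gen _] := Hphi k.+1.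
  by rewrite -(image_span (sBB k.+1) gen y); apply: ker.
split=> [_ y|k _ y]; last exact: (ker_im k.+1 y).
exact: iff_trans (aug0 y) (ker_im 0%N y).
Qed.
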